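(* Let $p\ge 1$ be an integer. For every constant $\epsilon>0$ there exists an online (possibly randomized) algorithm for the submodular secretary problem with $p$-matchoid constraints and shortlists which, on every instance with $n$ items, a $p$-matchoid given by matroids $\mathcal{M}_1,\dots,\mathcal{M}_q$ whose largest feasible set has size $k$, and a monotone submodular function $f$, achieves a competitive ratio of $$\frac{1}{p+1}\left(1-\frac{1}{e^{p+1}}-\epsilon-O\!\left(\frac1k\right)\right)$$ using a shortlist of size at most $\eta_\epsilon(k)=O(k)$, where more precisely $\eta_\epsilon(k)=O\!\left(2^{\mathrm{poly}(1/\epsilon)}\,k\right)$. The running time of this online algorithm is $O(n\kappa^{p})$, where $\kappa=\max_{i\in[q]} rk(\mathcal{M}_i)$.
   Context: $p$-matchoid. Let $\mathcal{M}_1=(\mathcal{N}_1,\mathcal{I}_1),\dots,\mathcal{M}_q=(\mathcal{N}_q,\mathcal{I}_q)$ be matroids over (possibly overlapping) ground sets. Let $\mathcal{N}=\mathcal{N}_1\cup\dots\cup\mathcal{N}_q$ and $\mathcal{I}=\{S\subseteq\mathcal{N}: S\cap\mathcal{N}_\ell\in\mathcal{I}_\ell\ \text{for all }\ell\in[q]\}$. The set system $(\mathcal{N},\mathcal{I})$ is a $p$-matchoid if every $e\in\mathcal{N}$ belongs to $\mathcal{N}_\ell$ for at most $p$ indices $\ell\in[q]$. Sets in $\mathcal{I}$ are called feasible, and $k$ denotes the size of the largest feasible set. Submodular secretary problem with $p$-matchoid constraints and shortlists. An instance consists of a $p$-matchoid $(\mathcal{N},\mathcal{I})$ with $|\mathcal{N}|=n$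 and a monotone submodular function $f:2^{\mathcal{N}}\to\mathbb{R}_{\ge0}$. The $n$ items of $\mathcal{N}$ arrive one at a time in uniformly random order. The set of items is fixed in advance but unknown to the algorithm; $n$ and $k$ are known. The algorithm has value oracle access to $f$ and independence oracle access to the matroids (on sets of items that have already arrived). In each round it must irrevocably decide whether or not to add the arriving item to a shortlist $A$. Its value is $\mathrm{ALG}=\mathbb{E}\big[\max_{S\subseteq A,\,S\in\mathcal{I}} f(S)\big]$ (expectation over the arrival order and internal randomness), and $\mathrm{OPT}=\max_{S\in\mathcal{I}}f(S)$. The algorithm achieves competitive ratio $c$ using a shortlist of size $\eta(k)$ if at the end $|A|\le\eta(k)$ and $\mathrm{ALG}\ge c\cdot\mathrm{OPT}$. $O(\cdot)$ is asymptotic in $n$, $k$, $\kappa$, with $\epsilon$ and $p$ regarded as constants; in $O(2^{\mathrm{poly}(1/\epsilon)}k)$ the dependence on $\epsilon$ is explicit, $\mathrm{poly}$ being some fixed polynomial. For the running time, each oracle query counts as one step. *)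

(* Defs.v *)
From HB Require Import structures.
From mathcomp Require Import all_boot all_order all_algebra.
From mathcomp Require Import reals sequences exp.

Set Implicit Arguments.
Unset Strict Implicit.
Unset Printing Implicit Defensive.
Import Order.TTheory GRing.Theory Num.Theory.
Local Open Scope ring_scope.

Record matroid (E : finType) := Matroid {
  ground : {set E};
  indep : {set {set E}};
  indep_ground : forall A, A \in indep -> A \subset ground;
  indep_set0 : set0 \in indep;
  indep_subset : forall A B : {set E},
    A \subset B -> B \in indep -> A \in indep;
  indep_augment : forall A B, A \in indep -> B \in indep ->
    (#|A| < #|B|)%N -> exists2 x, x \in B :\: A & x |: A \in indep
}.

Definition mrank (E : finType) (M : matroid E) : nat :=
  \max_(A in indep M) #|A|.

Definition max_rank (E : finType) (q : nat) (M : 'I_q -> matroid E) : nat :=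
  \max_(l < q) mrank (M l).

(** The whole type [E] plays the role of the union of the ground sets, so the
    number of items is [#|E|]. *)
Definition p_matchoid (E : finType) (q : nat) (p : nat)
    (M : 'I_q -> matroid E) : Prop :=
  \bigcup_(l < q) ground (M l) = [set: E] /\
  forall e : E, (#|[set l : 'I_q | e \in ground (M l)]| <= p)%N.

Definition feasible (E : finType) (q : nat) (M : 'I_q -> matroid E)
    (S : {set E}) : bool :=
  [forall l : 'I_q, S :&: ground (M l) \in indep (M l)].

Definition max_feasible_size (E : finType) (q : nat)
    (M : 'I_q -> matroid E) : nat :=
  \max_(S : {set E} | feasible M S) #|S|.

Definition set_nonneg (R : realType) (E : finType) (f : {set E} -> R) : Prop :=
  forall A, 0 <= f A.

Definition set_monotone (R : realType) (E : finType) (f : {set E} -> R) : Prop :=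
  forall A B : {set E}, A \subset B -> f A <= f B.

Definition submodular (R : realType) (E : finType) (f : {set E} -> R) : Prop :=
  forall A B : {set E}, f (A :|: B) + f (A :&: B) <= f A + f B.

(** The maxima below range over a nonempty family (it contains [set0]), and the
    default value [0] is harmless because [f] is nonnegative. *)
Definition best_within (R : realType) (E : finType) (q : nat)
    (M : 'I_q -> matroid E) (f : {set E} -> R) (A : {set E}) : R :=
  \big[Num.max/0]_(S : {set E} | (S \subset A) && feasible M S) f S.

Definition OPT (R : realType) (E : finType) (q : nat)
    (M : 'I_q -> matroid E) (f : {set E} -> R) : R :=
  \big[Num.max/0]_(S : {set E} | feasible M S) f S.

Section Distributions.
Variable R : realType.

(** Finitely supported distributions are lists of weighted outcomes. *)
Definition dist (A : Type) : Type := seq (R * A).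

Definition dret (A : Type) (a : A) : dist A := [:: (1, a)].

Definition dbind (A B : Type) (d : dist A) (g : A -> dist B) : dist B :=
  flatten [seq [seq (x.1 * y.1, y.2) | y <- g x.2] | x <- d].

Definition duniform (m : nat) : dist nat :=
  [seq ((m.+1%:R)^-1, i) | i <- iota 0 m.+1].

Definition expect (A : Type) (d : dist A) (g : A -> R) : R :=
  \sum_(x <- d) x.1 * g x.2.

Definition surely (A : Type) (d : dist A) (P : A -> bool) : bool :=
  all (fun x => P x.2) d.

End Distributions.

(** An online algorithm is a program for a randomized random access machine.
    The memory consists of arrays of natural numbers, of reals (values of the
    objective) and of sets of items: a cell is given by the (static) name of
    its array and a (computed) index.  The program text is finite and mentions
    neither the instance, nor [n], nor [k].

    Items are anonymous: the program refers to an item by its arrival position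
    [0, 1, ...], and any reference to an item that has not yet arrived is
    void.  Set cells therefore only ever contain items that have arrived, and
    so do the sets passed to the oracles.  An arrived item also reveals which
    ground sets it belongs to ([NumMat], [MatAt]). *)

Inductive nexp : Type :=
| NConst of nat
| NGet of nat & nexp
| NAdd of nexp & nexp
| NSub of nexp & nexp.            (* truncated subtraction *)

Inductive rexp : Type :=
| RGet of nat & nexp
| RAdd of rexp & rexp
| RSub of rexp & rexp.

Inductive bexp : Type :=
| BLeN of nexp & nexp
| BLeR of rexp & rexp
| BNot of bexp
| BAnd of bexp & bexp.

Inductive cmd : Type :=
| Skip
| Seq of cmd & cmd
| If of bexp & cmd & cmd
| While of bexp & cmd
| NSet of nat & nexp & nexp       (* NSet a i e: natural cell (a, i) := e *)
| RSet of nat & nexp & rexp       (* RSet a i e: real cell (a, i) := e *)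
| Rand of nat & nexp & nexp       (* Rand a i e: natural cell (a, i) := uniform in {0, ..., e} *)
| SIns of nat & nexp & nexp       (* SIns a i x: insert item x into set cell (a, i) *)
| SDel of nat & nexp & nexp       (* SDel a i x: delete item x from set cell (a, i) *)
| Value of nat & nexp & nat & nexp
    (* Value a i b j: real cell (a, i) := f(set cell (b, j)) *)
| Indep of nat & nexp & nexp & nat & nexp
    (* Indep a i l b j: natural cell (a, i) := 1 if the part of set cell (b, j)
       lying in the ground set of the l-th matroid is independent in that
       matroid, and 0 otherwise *)
| NumMat of nat & nexp & nexp
    (* NumMat a i x: natural cell (a, i) := number of ground sets containing x *)
| MatAt of nat & nexp & nexp & nexp
    (* MatAt a i x j: natural cell (a, i) := index of the j-th matroid whose
       ground set contains x *)
| Next                            (* end the round; the next item arrives *)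
| Accept.                         (* put the item of this round on the shortlist *)

Section Semantics.
Variables (R : realType) (E : finType).

Record state := State {
  arrived : nat;
  shortlist : {set E};
  nmem : nat -> nat -> nat;
  rmem : nat -> nat -> R;
  smem : nat -> nat -> {set E}
}.

Definition upd (T : Type) (m : nat -> nat -> T) (a i : nat) (v : T) :
    nat -> nat -> T :=
  fun b j => if (b == a) && (j == i) then v else m b j.

Definition set_nmem (st : state) a i v :=
  State (arrived st) (shortlist st) (upd (nmem st) a i v) (rmem st) (smem st).
Definition set_rmem (st : state) a i v :=
  State (arrived st) (shortlist st) (nmem st) (upd (rmem st) a i v) (smem st).
Definition set_smem (st : state) a i v :=
  State (arrived st) (shortlist st) (nmem st) (rmem st) (upd (smem st) a i v).

Fixpoint neval (st : state) (e : nexp) : nat :=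
  match e with
  | NConst c => c
  | NGet a i => nmem st a (neval st i)
  | NAdd e1 e2 => (neval st e1 + neval st e2)%N
  | NSub e1 e2 => (neval st e1 - neval st e2)%N
  end.

Fixpoint reval (st : state) (e : rexp) : R :=
  match e with
  | RGet a i => rmem st a (neval st i)
  | RAdd e1 e2 => reval st e1 + reval st e2
  | RSub e1 e2 => reval st e1 - reval st e2
  end.

Fixpoint beval (st : state) (b : bexp) : bool :=
  match b with
  | BLeN e1 e2 => (neval st e1 <= neval st e2)%N
  | BLeR e1 e2 => reval st e1 <= reval st e2
  | BNot b1 => ~~ beval st b1
  | BAnd b1 b2 => beval st b1 && beval st b2
  end.

Variables (q : nat) (M : 'I_q -> matroid E) (f : {set E} -> R).

(** [s] is the arrival order: [onth s t] is the [t]-th item to arrive. *)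
Variable s : seq E.

Definition item_at (st : state) (t : nat) : option E :=
  onth (take (arrived st) s) t.

Definition current_item (st : state) : option E :=
  item_at st (arrived st).-1.

Definition matroids_of (x : E) : seq nat :=
  [seq nat_of_ord l | l <- enum 'I_q & x \in ground (M l)].

Definition matroids_of_opt (ox : option E) : seq nat :=
  oapp matroids_of [::] ox.

Definition indep_query (l : nat) (S : {set E}) : bool :=
  oapp (fun i : 'I_q => S :&: ground (M i) \in indep (M i)) false (insub l).

Definition oset1 (ox : option E) : {set E} := oapp (fun x => [set x]) set0 ox.

(** A configuration is the stack of commands still to be executed, together
    with the memory; the machine has halted when the stack is empty. *)
Definition config : Type := (seq cmd * state)%type.

Definition step (c : config) : dist R config :=
  let: (K, st) := c in
  let nv := neval st in
  match K with
  | [::] => dret R c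
  | Skip :: K' => dret R (K', st)
  | Seq c1 c2 :: K' => dret R ([:: c1, c2 & K'], st)
  | If b c1 c2 :: K' => dret R ((if beval st b then c1 else c2) :: K', st)
  | While b c1 :: K' =>
      dret R (if beval st b then [:: c1, While b c1 & K'] else K', st)
  | NSet a i e :: K' => dret R (K', set_nmem st a (nv i) (nv e))
  | RSet a i e :: K' => dret R (K', set_rmem st a (nv i) (reval st e))
  | Rand a i e :: K' =>
      dbind (duniform R (nv e)) (fun v => dret R (K', set_nmem st a (nv i) v))
  | SIns a i x :: K' =>
      dret R (K', set_smem st a (nv i)
                    (smem st a (nv i) :|: oset1 (item_at st (nv x))))
  | SDel a i x :: K' =>
      dret R (K', set_smem st a (nv i)
                    (smem st a (nv i) :\: oset1 (item_at st (nv x))))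
  | Value a i b j :: K' =>
      dret R (K', set_rmem st a (nv i) (f (smem st b (nv j))))
  | Indep a i l b j :: K' =>
      dret R (K', set_nmem st a (nv i)
                    (nat_of_bool (indep_query (nv l) (smem st b (nv j)))))
  | NumMat a i x :: K' =>
      dret R (K', set_nmem st a (nv i)
                    (size (matroids_of_opt (item_at st (nv x)))))
  | MatAt a i x j :: K' =>
      dret R (K', set_nmem st a (nv i)
                    (nth 0%N (matroids_of_opt (item_at st (nv x))) (nv j)))
  | Next :: K' =>
      dret R (K', State (minn (arrived st).+1 (size s)) (shortlist st)
                    (nmem st) (rmem st) (smem st))
  | Accept :: K' =>
      dret R (K', State (arrived st) (shortlist st :|: oset1 (current_item st))
                    (nmem st) (rmem st) (smem st))
  end.

Fixpoint run_from (T : nat) (c : config) : dist R config :=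
  if T is T'.+1 then dbind (step c) (run_from T') else dret R c.

End Semantics.

Definition halted (R : realType) (E : finType) (c : config R E) : bool :=
  nilp c.1.

(** Before the first arrival, natural cells [(0, 0)] and [(0, 1)] hold [n] and
    [k]; the rest of the memory is blank. *)
Definition init_state (R : realType) (E : finType) (n k : nat) : state R E :=
  State 0 set0
    (upd (upd (fun _ _ => 0%N) 0 0 n) 0 1 k)
    (fun _ _ => 0) (fun _ _ => set0).

(** Distribution of the configuration after [T] steps of [prog], every command
    and every oracle query counting as one step, for the arrival order [s]. *)
Definition run (R : realType) (E : finType) (q : nat) (M : 'I_q -> matroid E)
    (f : {set E} -> R) (prog : cmd) (s : seq E) (T : nat) :
    dist R (config R E) :=
  run_from M f s T
    ([:: prog], init_state R E #|E| (max_feasible_size M)).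

Definition arrival_orders (E : finType) : {set #|E|.-tuple E} :=
  [set s : #|E|.-tuple E | uniq s].

(** On every arrival order and for all outcomes of the coin tosses, [prog] halts
    within [T] steps. *)
Definition halts_within (R : realType) (E : finType) (q : nat)
    (M : 'I_q -> matroid E) (f : {set E} -> R) (prog : cmd) (T : nat) : Prop :=
  forall s : #|E|.-tuple E, s \in arrival_orders E ->
    surely (run M f prog s T) (@halted R E).

Definition shortlist_within (R : realType) (E : finType) (q : nat)
    (M : 'I_q -> matroid E) (f : {set E} -> R) (prog : cmd) (T b : nat) : Prop :=
  forall s : #|E|.-tuple E, s \in arrival_orders E ->
    surely (run M f prog s T)
      (fun c : config R E => (#|shortlist c.2| <= b)%N).

(** Expectation over a uniformly random arrival order and the coin tosses.  It
    does not depend on [T] as soon as [prog] halts within [T] steps. *)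
Definition ALG (R : realType) (E : finType) (q : nat) (M : 'I_q -> matroid E)
    (f : {set E} -> R) (prog : cmd) (T : nat) : R :=
  (#|arrival_orders E|%:R)^-1 *
  \sum_(s in arrival_orders E)
    expect (run M f prog s T)
      (fun c : config R E => best_within M f (shortlist c.2)).

(* Main.v *)
(** Fix a large D ~ 3p/eps.  Every item falls into a uniform slot among k D^2
    and has a uniform coin among D; the first k (D^2 - D) slots are processed in
    order, maintaining a feasible solution S.  The winner of a slot is its item
    x maximising v(S, x), the best value of f after inserting x and deleting at
    most one item of S for each matroid containing x.  After slot w, S is
    changed by the better of two swaps: that of the winner, and that of the
    winner of an older slot r(w), where r(w) is uniform among all slots.

    Drift.  By matroid exchange, the gains v(S, o) - f(S), summed over an
    optimal solution O, are at least f(O) - (p+1) f(S).  Moving an item that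
    has not won so far to any slot from w on does not change the history, and an
    item that has won is redrawn through r(w): in either case, whatever the
    history, o in O is available in slot w with probability at least 1/(k D^2).
    As there are many more slots than items in O, collisions cost a factor
    1 - O(1/D), and f(S) grows to about (1 - e^-(p+1)) f(O) / (p+1).

    Shortlist.  The items of coin 0 of a slot form a sample; among the others,
    those that beat the whole sample are shortlisted, up to D^2 of them.  Coins
    do not influence S, and a winner is missed with probability at most
    1/D + (1 - 1/D)^(D^2).

    Online implementation.  Slots and coins are drawn beforehand for positions
    0, ..., n-1 rather than for items.  The positions are visited slot by slot,
    each sample first, and the arriving item takes the next position visited;
    since the arrival order is uniform, the items receive uniformly permuted
    positions. *)
Require Import Defs.
From mathcomp Require Import all_boot all_order all_algebra all_fingroup.
From mathcomp Require Import reals sequences exp.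
From mathcomp Require Import zify ring lra.

Set Implicit Arguments.
Unset Strict Implicit.
Unset Printing Implicit Defensive.
Import Order.TTheory GRing.Theory Num.Theory.
Local Open Scope ring_scope.

(** * Exchange and swaps *)

(** The obstacle is that a solution built online is correlated with the items still to come.
    Expectations are therefore sums over finite function spaces (slots, draws, coins), and
    independence becomes the overwriting of one coordinate, which is harmless exactly when the
    history does not read it.

    The last k D slots stay unprocessed so that, at every step, at least k D slots from w on cannot
    be told apart by the history. Hence another given optimal item is available at the same time
    with frequency at most 2/(k D), or 2/D for all of them together. With the fraction 1/D of
    unprocessed slots, the exponent p+1 keeps a factor of at least 1 - 3/D, a loss of at most 3
    (p+1)/D in the ratio. Missed winners cost another 2/D, and D of order (3 (p+1) + 2)/eps pays for
    both.

    The factor K^p of the running time, K being the largest rank, comes from trying, for each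
    arriving item, all ways of deleting at most one item of the solution per matroid. *)

Section Exchange.
Variables (R : realType) (E : finType).

(** The weights are the marginal values of the elements of [S] along a fixed order: the peeled
    element [y] gets [f S - f (S :\ y)], and diminishing returns make the sum a lower bound on
    subsets. It serves twice: to charge the loss of a deletion, and to average [f] over random
    subsets of the solution. *)
Lemma modular_weights (f : {set E} -> R) (S : {set E}) :
  set_monotone f -> submodular f ->
  exists w : E -> R, [/\ forall y, 0 <= w y,
    f set0 + \sum_(y in S) w y = f S &
    forall A : {set E}, A \subset S -> f set0 + \sum_(y in A) w y <= f A].
Proof.
move=> mono sub; elim: {S}_.+1 {-2}S (ltnSn #|S|) => // N IH S leSN.
have [->|[y yS]] := set_0Vmem S.
  exists (fun=> 0); split=> [y||A]; rewrite ?lexx ?big1 ?addr0 //.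
  by rewrite subset0 => /eqP ->.
have [|w [w0 wS wA]] := IH (S :\ y).
  by move: leSN; rewrite (cardsD1 y S) yS.
pose w' z := if z == y then f S - f (S :\ y) else w z.
have sumw' (A : {set E}) : y \notin A -> \sum_(z in A) w' z = \sum_(z in A) w z.
  move=> yA; apply: eq_bigr => z zA; rewrite /w'; case: eqP => // zy.
  by rewrite -zy zA in yA.
have w'y : w' y = f S - f (S :\ y) by rewrite /w' eqxx.
exists w'; split=> [z||A sAS].
- by rewrite /w'; case: eqP => // _; rewrite subr_ge0 mono ?subD1set.
- rewrite (big_setD1 y) //= sumw' ?setD11 // w'y addrCA addrC.
  by rewrite wS addrC subrK.
have [yA|yA] := boolP (y \in A); last first.
  by rewrite sumw' // wA // subsetD1 sAS.
rewrite (big_setD1 y) //= sumw' ?setD11 // w'y.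
have := wA (A :\ y) (setSD _ sAS).
have := sub A (S :\ y).
have -> : A :|: S :\ y = S.
  apply/setP=> z; rewrite !inE; case: (eqVneq z y) => [->|_] /=.
    by rewrite yA yS.
  by case zA: (z \in A) => //=; rewrite (subsetP sAS).
have -> : A :&: (S :\ y) = A :\ y.
  apply/setP=> z; rewrite !inE; case: (eqVneq z y) => //= _; first by rewrite andbF.
  by case zA: (z \in A) => //=; rewrite (subsetP sAS).
lra.
Qed.

(** Greedy matching: a maximiser [a] of [u] is removed together with some [b] of weight at least
    [u a]. For thresholds up to [u a] both counts drop by one; above it the left count is already
    zero. *)
Lemma layer_cake_le (A B : {set E}) (u v : E -> R) :
    (forall b, 0 <= v b) ->
    (forall t : R, (#|[set a in A | (t <= u a)%R]| <= #|[set b in B | (t <= v b)%R]|)%N) ->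
  \sum_(a in A) u a <= \sum_(b in B) v b.
Proof.
move=> v0; elim: {A}_.+1 {-2}A B (ltnSn #|A|) => // N IH A B leAN cnt.
have [->|[a0 a0A]] := set_0Vmem A; first by rewrite big_set0 sumr_ge0.
have [a] := arg_maxP u a0A; rewrite -/(a \in A) => aA amax.
have /card_gt0P[b] : (0 < #|[set b in B | (u a <= v b)%R]|)%N.
  apply: leq_trans (cnt (u a)); apply/card_gt0P; exists a.
  by rewrite inE aA lexx.
rewrite inE => /andP[bB uavb].
rewrite (big_setD1 a aA) (big_setD1 b bB) /= lerD // IH //.
  by move: leAN; rewrite (cardsD1 a A) aA.
move=> t; have [tua|uat] := lerP t (u a).
  have restr (C : {set E}) z h : [set x in C | t <= h x] :\ z =
      [set x in C :\ z | t <= h x] by apply/setP=> x; rewrite !inE andbA.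
  have := cnt t; rewrite (cardsD1 a [set x in A | _]) (cardsD1 b [set x in B | _]).
  by rewrite !restr !inE aA bB tua (le_trans tua uavb).
suff -> : [set x in A :\ a | t <= u x] = set0 by rewrite cards0.
apply/eqP; rewrite -subset0; apply/subsetP=> x; rewrite !inE => /andP[/andP[_ xA] tux].
by have := le_lt_trans tux (le_lt_trans (amax x xA) uat); rewrite ltxx.
Qed.

Lemma indep_extend (M : matroid E) (A B : {set E}) :
    A \in indep M -> B \in indep M -> (#|A| <= #|B|)%N ->
  exists J : {set E}, [/\ A \subset J, J \subset A :|: B, #|J| = #|B| & J \in indep M].
Proof.
move=> + Bi; elim: {A}_.+1 {-2}A (ltnSn (#|B| - #|A|)) => // N IH A lN Ai.
rewrite leq_eqVlt => /orP[/eqP eAB|ltAB].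
  by exists A; split => //; rewrite subsetUl.
have [x] := indep_augment Ai Bi ltAB.
rewrite inE => /andP[xA xB] xAi.
have cxA : #|x |: A| = #|A|.+1 by rewrite cardsU1 xA.
have [||//|J [sJ Js cJ Ji]] := IH (x |: A); rewrite ?cxA //; first lia.
exists J; split=> //; first exact: subset_trans (subsetUr _ _) sJ.
apply: subset_trans Js _; apply/subsetP=> z; rewrite !inE -orbA.
by case/or3P=> [/eqP->|->|->]; rewrite ?xB ?orbT.
Qed.

(** Extending [o |: T] inside [o |: S] to the size of [S] leaves out exactly one element of [S], and
    this one is outside [T]. *)
Lemma single_exchange (M : matroid E) (S T : {set E}) (o : E) :
    S \in indep M -> T \subset S -> o \notin S -> o |: T \in indep M ->
    o |: S \notin indep M ->
  exists2 y, y \in S :\: T & o |: (S :\ y) \in indep M.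
Proof.
move=> Si sTS oS oTi oSi.
have oT : o \notin T by apply: contra oS; apply: subsetP.
have ltTS : (#|T| < #|S|)%N.
  rewrite ltn_neqAle subset_leq_card // andbT.
  apply: contra oSi => /eqP cTS.
  by suff <- : T = S by []; apply/eqP; rewrite eqEcard sTS cTS leqnn.
have [|J [sJ Js cJ Ji]] := indep_extend oTi Si; first by rewrite cardsU1 oT.
have oJ : o \in J by apply: (subsetP sJ); rewrite !inE eqxx.
have JS : J \subset o |: S.
  apply: subset_trans Js _; apply/subsetP=> z; rewrite !inE -orbA.
  by case/or3P=> [->|/(subsetP sTS) ->|->]; rewrite ?orbT.
have /subsetPn[y yS yJ] : ~~ (S \subset J).
  apply/negP=> sSJ; have /subset_leq_card : o |: S \subset J.
    by rewrite subUset sub1set oJ.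
  by rewrite cardsU1 oS cJ ltnn.
exists y.
  rewrite inE yS andbT; apply: contra yJ => yT.
  by apply: (subsetP sJ); rewrite !inE yT orbT.
suff <- : J = o |: (S :\ y) by [].
apply/eqP; rewrite eqEcard; apply/andP; split.
  apply/subsetP=> z zJ; have := subsetP JS z zJ; rewrite !inE.
  case: eqP => //= _ ->; rewrite andbT; apply: contraNneq yJ => <-; exact: zJ.
by rewrite cardsU1 !inE (negPf oS) andbF cJ (cardsD1 y S) yS.
Qed.

(* Thresholding the weights replaces the perfect matching of the classical
   basis exchange theorem: the elements of [O] all of whose exchange partners
   weigh at least [t] are spanned by the part of [S] of weight at least [t]. *)
Lemma exchange_weights (M : matroid E) (S O : {set E}) (w : E -> R) :
    S \in indep M -> O \in indep M -> (forall y, 0 <= w y) ->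
  exists g : E -> option E,
    [/\ forall o, o \in O :\: S ->
          if g o is Some y then y \in S /\ o |: (S :\ y) \in indep M
          else o |: S \in indep M
      & \sum_(o in O :\: S) oapp w 0 (g o) <= \sum_(y in S) w y].
Proof.
move=> Si Oi w0.
pose X o := [pred y | (y \in S) && (o |: (S :\ y) \in indep M)].
(* The partner of [o] is the lightest element whose deletion makes room for [o]; [None] when [o] can
   be added as it is. *)
pose g o : option E := if o |: S \in indep M then None
  else omap (fun y0 => [arg min_(y < y0 | X o y) w y]%O) [pick y | X o y].
pose N := [set o in O :\: S | o |: S \notin indep M].
have gN o : o \in N -> exists y, [/\ g o = Some y, X o y & forall z, X o z -> w y <= w z].
  rewrite !inE => /andP[/andP[oS oO] oSi].
  have [|y] := @single_exchange M S set0 o Si (sub0set _) oS _ oSi.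
    by rewrite setU0; apply: indep_subset Oi; rewrite sub1set.
  rewrite inE => /andP[_ yS] yi.
  rewrite /g (negPf oSi); case: pickP => [y0 y0X|/(_ y)]; last by rewrite /X/= yS yi.
  rewrite /=; case: arg_minP => // z zX zmin.
  by exists z; split.
have gP o : o \in O :\: S -> o \notin N -> g o = None.
  by rewrite /g !inE => -> /=; rewrite negbK => ->.
exists g; split=> [o oOS|].
  have [/gN[y [-> /andP[yS yi] _]] //|oN] := boolP (o \in N).
  by rewrite gP //; move: oN oOS; rewrite !inE; case: (o \in S) => //=; case: (o \in O); rewrite //= negbK.
rewrite (bigID (mem N)) /= [X in _ + X]big1 ?addr0; last first.
  by move=> o /andP[oO oN]; rewrite gP.
rewrite (eq_bigl (mem N)); last first.
  move=> o /=; have [|] := boolP (o \in N); rewrite ?andbF // andbT.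
  by rewrite !inE => /andP[].
apply: layer_cake_le => // t.
(* If too many partners weighed at least [t], the heavy part [B] of [S] could be augmented by one of
   the corresponding [o]; [single_exchange] with [T := B] then yields an exchange for [o] lighter
   than [t], against the minimality of its partner. *)
rewrite leqNgt; apply/negP=> cnt.
set A := [set a in N | _] in cnt; set B := [set b in S | _] in cnt.
have sBS : B \subset S by apply/subsetP=> z; rewrite inE => /andP[].
have Bi : B \in indep M by apply: indep_subset Si.
have Ai : A \in indep M.
  by apply: indep_subset Oi; apply/subsetP=> z; rewrite !inE => /andP[/andP[/andP[]]].
have [o] := indep_augment Bi Ai cnt.
rewrite inE => /andP[oB]; rewrite inE => /andP[oN tw] oBi.
have [y [goy yX ymin]] := gN o oN; move: tw; rewrite goy /= => tw.
have := oN; rewrite !inE => /andP[/andP[oS oO] oSi].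
have [z] := single_exchange Si sBS oS oBi oSi.
rewrite !inE => /andP[+ zS] zi; rewrite zS /= => /negP; apply.
by apply: le_trans tw _; apply: ymin; rewrite /X /= zS.
Qed.

End Exchange.

Fixpoint choices (T : Type) (cs : seq (seq T)) : seq (seq T) :=
  if cs is c :: cs' then flatten [seq [seq y :: z | z <- choices cs'] | y <- c]
  else [:: [::]].

Lemma mem_choices (T : eqType) (cs : seq (seq T)) (F : nat -> T) :
  (forall j, (j < size cs)%N -> F j \in nth [::] cs j) ->
  mkseq F (size cs) \in choices cs.
Proof.
elim: cs F => //= c cs IH F memF.
apply/flattenP; exists [seq F 0%N :: z | z <- choices cs].
  by apply/mapP; exists (F 0%N) => //; exact: memF 0%N isT.
apply/mapP; exists (mkseq (fun j => F j.+1) (size cs)).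
  by apply: (IH (fun j => F j.+1)) => j jlt; exact: memF j.+1 jlt.
by rewrite /mkseq /= (iotaDl 1 0) -map_comp.
Qed.

Section Swaps.
Variables (R : realType) (E : finType) (q : nat) (M : 'I_q -> matroid E).
Variables (f : {set E} -> R) (p : nat).

(** When [x] lies in fewer than [p] matroids, the surplus positions fall back to matroid 0. This
    only offers additional deletions and adds a test that every feasible result passes; in exchange
    the number of nested loops is fixed. *)
Definition mat_at (x : E) (j : nat) : nat := nth 0%N (matroids_of M x) j.

Definition members (S : seq E) (l : nat) : seq E :=
  [seq y <- S | l \in matroids_of M y].

Definition combos (S : seq E) (x : E) : seq (seq (option E)) :=
  choices [seq None :: map Some (members S (mat_at x j)) | j <- iota 0 p].

Definition swapped (S : seq E) (x : E) (c : seq (option E)) : {set E} :=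
  x |: [set y in S | Some y \notin c].

Definition swap_ok (S : seq E) (x : E) (c : seq (option E)) : bool :=
  all (fun j => indep_query M (mat_at x j) (swapped S x c)) (iota 0 p).

Definition better_swap (S : seq E) (x : E) (acc : R * option (seq (option E)))
    (c : seq (option E)) :=
  if swap_ok S x c && (acc.1 < f (swapped S x c)) then (f (swapped S x c), Some c)
  else acc.

Definition best_swap (S : seq E) (x : E) : R * option (seq (option E)) :=
  foldl (better_swap S x) (f [set y in S], None) (combos S x).

Definition swap_value (S : seq E) (x : E) : R := (best_swap S x).1.

Definition swap (S : seq E) (x : E) : seq E :=
  if (best_swap S x).2 is Some c then rcons [seq y <- S | Some y \notin c] x
  else S.

Lemma best_swap_spec (S : seq E) (x : E) :
  [/\ f [set y in S] <= swap_value S x,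
      forall c, c \in combos S x -> swap_ok S x c ->
        f (swapped S x c) <= swap_value S x
    & if (best_swap S x).2 is Some c
      then swap_ok S x c /\ swap_value S x = f (swapped S x c)
      else swap_value S x = f [set y in S]].
Proof.
rewrite /swap_value /best_swap; set acc0 := (f _, None).
have : [/\ f [set y in S] <= acc0.1
    & if acc0.2 is Some c then swap_ok S x c /\ acc0.1 = f (swapped S x c)
      else acc0.1 = f [set y in S]] by [].
elim: (combos S x) acc0 => [|c cs IH] acc0 /= [ge0 sp]; first by split.
have [| ge le sp'] := IH (better_swap S x acc0 c).
  rewrite /better_swap; case: ifP => //= /andP[ok lt].
  by split=> //; apply: le_trans ge0 (ltW lt).
split=> // d; rewrite inE => /orP[/eqP-> okc|]; last exact: le.
have : f (swapped S x c) <= (better_swap S x acc0 c).1.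
  by rewrite /better_swap okc /=; case: ltP.
move=> /le_trans; apply.
elim: (cs) (better_swap S x acc0 c) {IH ge le sp'} => //= a cs' IHc acc.
apply: le_trans (IHc _); rewrite /better_swap; case: ifP => //= /andP[_ /ltW] //.
Qed.

Lemma swap_value_ge (S : seq E) (x : E) : f [set y in S] <= swap_value S x.
Proof. by have [] := best_swap_spec S x. Qed.

Lemma swapE (S : seq E) (x : E) c :
  [set y in rcons [seq y <- S | Some y \notin c] x] = swapped S x c.
Proof.
apply/setP=> y; rewrite !inE mem_rcons inE mem_filter.
by congr (_ || _); rewrite andbC.
Qed.

Lemma value_swap (S : seq E) (x : E) : f [set y in swap S x] = swap_value S x.
Proof.
rewrite /swap; have [_ _] := best_swap_spec S x.
by case: (best_swap S x).2 => [c [_ ->]|->] //; rewrite swapE.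
Qed.

Lemma mem_swap (S : seq E) (x y : E) : y \in swap S x -> (y == x) || (y \in S).
Proof.
rewrite /swap; case: (best_swap S x).2 => [c|->]; last by rewrite orbT.
by rewrite mem_rcons inE mem_filter => /orP[->|/andP[_ ->]]; rewrite ?orbT.
Qed.

Lemma uniq_swap (S : seq E) (x : E) : uniq S -> x \notin S -> uniq (swap S x).
Proof.
move=> uS xS; rewrite /swap; case: (best_swap S x).2 => [c|//].
by rewrite rcons_uniq filter_uniq // mem_filter (negPf xS) andbF.
Qed.

Lemma mem_matroids_of (x : E) (l : 'I_q) :
  ((l : nat) \in matroids_of M x) = (x \in ground (M l)).
Proof.
rewrite /matroids_of mem_map; last exact: ord_inj.
by rewrite mem_filter mem_enum andbT.
Qed.

Hypothesis Mp : p_matchoid p M.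

Lemma size_matroids_of (x : E) : (size (matroids_of M x) <= p)%N.
Proof.
have [_ /(_ x)] := Mp; apply: leq_trans.
rewrite size_map cardE; apply: uniq_leq_size.
  by rewrite filter_uniq ?enum_uniq.
by move=> l; rewrite mem_filter !mem_enum !inE => /andP[].
Qed.

Lemma indep_queryE (l : 'I_q) (S : {set E}) :
  indep_query M l S = (S :&: ground (M l) \in indep (M l)).
Proof. by rewrite /indep_query valK. Qed.

(** A matroid whose ground set does not contain [x] only loses elements, so testing the at most [p]
    matroids of [x] suffices. *)
Lemma swap_ok_feasible (S : seq E) (x : E) c :
  feasible M [set y in S] -> swap_ok S x c -> feasible M (swapped S x c).
Proof.
move=> /forallP Sf /allP ok; apply/forallP => l.
have [xl|xl] := boolP (x \in ground (M l)).
  rewrite -indep_queryE.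
  have lx : (l : nat) \in matroids_of M x by rewrite mem_matroids_of.
  rewrite -(nth_index 0%N lx); apply: ok; rewrite mem_iota add0n /=.
  by apply: leq_trans (size_matroids_of x); rewrite index_mem.
apply: indep_subset (Sf l); apply/subsetP=> y; rewrite !inE => /andP[/orP[/eqP->|]].
  by rewrite (negPf xl).
by case/andP=> -> _ ->.
Qed.

Lemma feasible_swap_ok (S : seq E) (x : E) c :
  feasible M (swapped S x c) -> swap_ok S x c.
Proof.
move=> /forallP ok; apply/allP => j _.
have q0 : (0 < q)%N.
  have := in_setT x; rewrite -(proj1 Mp) => /bigcupP[l _ _].
  exact: leq_ltn_trans (ltn_ord l).
(* The fallback index 0 is a genuine matroid, because [x] lies in some ground set and so [0 < q]. *)
have lq : (mat_at x j < q)%N.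
  rewrite /mat_at; have [jlt|jge] := ltnP j (size (matroids_of M x)).
    by have /mapP[l _ ->] := mem_nth 0%N jlt.
  by rewrite nth_default.
by rewrite (indep_queryE (Ordinal lq)); exact: ok.
Qed.

Lemma feasible_swap (S : seq E) (x : E) :
  feasible M [set y in S] -> feasible M [set y in swap S x].
Proof.
move=> Sf; rewrite /swap; have [_ _] := best_swap_spec S x.
case: (best_swap S x).2 => [c [okc _]|_] //.
by rewrite swapE swap_ok_feasible.
Qed.

Hypotheses (f0 : set_nonneg f) (fm : set_monotone f) (fs : submodular f).

Lemma submodular_union (S T : {set E}) :
  f (S :|: T) - f S <= \sum_(o in T :\: S) (f (o |: S) - f S).
Proof.
elim: {T}_.+1 {-2}T (ltnSn #|T :\: S|) => // N IH T ltN.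
have [TS|[o oTS]] := set_0Vmem (T :\: S).
  rewrite TS big_set0; suff -> : S :|: T = S by rewrite subrr.
  by apply/setUidPl; rewrite -setD_eq0 TS.
have := oTS; rewrite inE => /andP[oS oT].
have eTS : (T :\ o) :\: S = (T :\: S) :\ o by rewrite setDDl setUC -setDDl.
rewrite (big_setD1 o oTS) /= -eTS.
have := IH (T :\ o); rewrite eTS; move: ltN; rewrite (cardsD1 o (T :\: S)) oTS => ltN.
move=> /(_ ltN); set sm := \sum_(_ in _) _.
have := fs (S :|: T :\ o) (o |: S).
have -> : S :|: T :\ o :|: (o |: S) = S :|: T.
  apply/setP=> z; rewrite !inE; case: eqP => [->|_] /=; first by rewrite oT !orbT.
  by case: (z \in S); rewrite ?orbT ?orbF.
have -> : (S :|: T :\ o) :&: (o |: S) = S.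
  apply/setP=> z; rewrite !inE; case: eqP => [->|_] /=; first by rewrite (negPf oS).
  by case: (z \in S); rewrite ?andbF.
lra.
Qed.

(** Each [o] is swapped in by deleting its exchange partner in every matroid containing it. The
    additions gain at least [f T - f A] in total by submodularity; the deletions are charged to the
    modular weights [w], each matroid charging at most the weight of its part of [A]. As an element
    lies in at most [p] ground sets, the charges add up to at most [p * f A]. *)
Lemma sum_swap_gain (S : seq E) (T : {set E}) :
    feasible M [set y in S] -> feasible M T ->
  f T - p.+1%:R * f [set y in S]
    <= \sum_(o in T) (if o \in S then 0 else swap_value S o - f [set y in S]).
Proof.
set A := [set y in S] => /forallP Sf /forallP Tf.
have [w [w0 wA wsub]] := modular_weights A fm fs.
pose ex (l : 'I_q) g := [/\ forall o, o \in (T :&: ground (M l)) :\: (A :&: ground (M l)) ->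
          if g o is Some y then y \in A :&: ground (M l)
            /\ o |: ((A :&: ground (M l)) :\ y) \in indep (M l)
          else o |: (A :&: ground (M l)) \in indep (M l)
      & \sum_(o in (T :&: ground (M l)) :\: (A :&: ground (M l))) oapp w 0 (g o)
          <= \sum_(y in A :&: ground (M l)) w y].
have /fin_all_exists[g gP] : forall l, exists g : E -> option E, ex l g.
  by move=> l; exact: exchange_weights.
have loss o : o \in T :\: A ->
    f (o |: A) - f A - \sum_(l | o \in ground (M l)) oapp w 0 (g l o)
      <= swap_value S o - f A.
  rewrite inE => /andP[oA oT].
  have inD l : o \in ground (M l) -> o \in (T :&: ground (M l)) :\: (A :&: ground (M l)).
    by move=> ol; rewrite !inE ol oT !andbT; move: oA; rewrite inE.
  (* Position [j] deletes the partner of [o] in its [j]-th matroid; surplus positions delete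
     nothing. *)
  pose F j : option E := if insub (mat_at o j) is Some l
    then if (j < size (matroids_of M o))%N then g l o else None else None.
  pose c := mkseq F p.
  have matF j : (j < size (matroids_of M o))%N ->
      exists l : 'I_q, [/\ nat_of_ord l = mat_at o j, o \in ground (M l) & F j = g l o].
    move=> jlt; have := mem_nth 0%N jlt; rewrite -/(mat_at o j).
    move=> /[dup] lo /mapP[l _ le]; exists l.
    rewrite -mem_matroids_of -le lo; split=> //.
    by rewrite /F le valK jlt.
  have gA l y : o \in ground (M l) -> g l o = Some y -> y \in A :&: ground (M l).
    by move=> ol gl; have [/(_ o (inD l ol)) + _] := gP l; rewrite gl => -[].
  have cin : c \in combos S o.
    have := @mem_choices _ [seq None :: map Some (members S (mat_at o j)) | j <- iota 0 p] F.
    rewrite size_map size_iota; apply => j jp.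
    rewrite (nth_map 0%N) ?size_iota // nth_iota // add0n.
    have [/matF[l [lj ol ->]]|jge] := ltnP j (size (matroids_of M o)).
      case gl: (g l o) => [y|]; last by rewrite inE eqxx.
      have := gA l y ol gl; rewrite !inE => /andP[yS yl].
      by rewrite /= mem_map ?mem_filter ?yS -?lj ?mem_matroids_of ?yl // => ? ? [].
    by rewrite /F ltnNge jge /=; case: insub => [?|]; rewrite inE eqxx.
  have cF y : Some y \in c -> exists2 l, o \in ground (M l) & g l o = Some y.
    move=> /mapP[j _ Fj].
    have [/matF[l [lj ol Fg]]|jge] := ltnP j (size (matroids_of M o)).
      by exists l; rewrite // -Fg.
    by move: Fj; rewrite /F ltnNge jge /=; case: insub.
  have Fc l : o \in ground (M l) -> g l o \in c.
    move=> ol; have lo : (l : nat) \in matroids_of M o by rewrite mem_matroids_of.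
    apply/mapP; exists (index (l : nat) (matroids_of M o)).
      rewrite mem_iota add0n; apply: leq_trans (size_matroids_of o).
      by rewrite index_mem.
    by rewrite /F /mat_at nth_index // valK index_mem lo.
  have feas : feasible M (swapped S o c).
    apply/forallP => l; have [ol|ol] := boolP (o \in ground (M l)); last first.
      apply: indep_subset (Sf l); apply/subsetP=> y; rewrite !inE => /andP[/orP[/eqP->|]].
        by rewrite (negPf ol).
      by case/andP=> -> _ ->.
    have [/(_ o (inD l ol)) + _] := gP l; case gl: (g l o) => [y|].
      case=> yA; apply: indep_subset; apply/subsetP=> z; rewrite !inE.
      case/andP=> /orP[->//|/andP[zS zc]] zl; rewrite zS zl !andbT; apply/orP; right.
      by apply: contraNneq zc => ->; rewrite -gl Fc.
    apply: indep_subset; apply/subsetP=> z; rewrite !inE.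
    by case/andP=> /orP[->//|/andP[-> _]] ->; rewrite orbT.
  have [_ /(_ _ cin (feasible_swap_ok feas)) + _] := best_swap_spec S o.
  set B := [set y in S | Some y \notin c].
  have BA : B \subset A by apply/subsetP=> z; rewrite !inE => /andP[].
  (* Diminishing returns: [o] gains at least as much on top of [B] as on top of [A]. *)
  have := fs (o |: B) A.
  have -> : o |: B :|: A = o |: A by rewrite -setUA (setUidPr BA).
  have -> : (o |: B) :&: A = B.
    rewrite setIUl (setIidPl BA) (_ : _ :&: A = set0) ?set0U //.
    by apply/eqP; rewrite setI_eq0 disjoints1.
  rewrite -/(swapped S o c).
  have := wsub B BA.
  (* Each deleted element is the partner of [o] in some matroid. One such matroid is chosen for
     each, and the choice is injective because [o] has a single partner per matroid. *)
  have : \sum_(y in A) w y <= \sum_(y in B) w y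
      + \sum_(l | o \in ground (M l)) oapp w 0 (g l o).
    rewrite (big_setID B) /= (setIidPr BA) lerD2l.
    have h0 l : 0 <= oapp w 0 (g l o) by case: (g l o) => /=.
    have inj y : y \in A :\: B -> exists l, (o \in ground (M l)) && (g l o == Some y).
      rewrite !inE => /andP[+ yS]; rewrite yS /= negbK => /cF[l ol gl].
      by exists l; rewrite ol gl eqxx.
    have [l0 _|noq] := pickP [pred l : 'I_q | true]; last first.
      rewrite big1 ?sumr_ge0 // => y /inj[l]; by have := noq l.
    pose h y := odflt l0 [pick l | (o \in ground (M l)) && (g l o == Some y)].
    have hP y : y \in A :\: B -> (o \in ground (M (h y))) && (g (h y) o == Some y).
      move=> /inj[l lP]; rewrite /h; case: pickP => [l' //|/(_ l)]; by rewrite lP.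
    have hinj : {in A :\: B &, injective h}.
      move=> y z /hP/andP[_ /eqP hy] /hP/andP[_ /eqP hz] hyz.
      by move: hy; rewrite hyz hz => -[].
    rewrite (eq_bigr (fun y => oapp w 0 (g (h y) o))); last first.
      by move=> y /hP/andP[_ /eqP->].
    rewrite -(big_imset (fun l => oapp w 0 (g l o)) hinj) /=.
    rewrite [leRHS](bigID (mem (h @: (A :\: B)))) /= ler_wpDr ?sumr_ge0 //.
    rewrite le_eqVlt; apply/orP; left; apply/eqP; apply: eq_bigl => l.
    case lh: (l \in _); rewrite ?andbF // andbT.
    by have /imsetP[y /hP/andP[ol _] ->] := lh; rewrite ol.
  rewrite -/A; lra.
have step1 : \sum_(o in T) (if o \in S then 0 else swap_value S o - f A)
   = \sum_(o in T :\: A) (swap_value S o - f A).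
  rewrite (big_setID A) /= big1 ?add0r => [|o]; last first.
    by rewrite !inE => /andP[_ ->].
  by apply: eq_bigr => o; rewrite !inE => /andP[/negPf ->].
rewrite step1.
have step2 : \sum_(o in T :\: A) \sum_(l | o \in ground (M l)) oapp w 0 (g l o)
    <= p%:R * \sum_(y in A) w y.
  rewrite (exchange_big_dep predT) //= mulr_sumr.
  apply: (@le_trans _ _ (\sum_(l < q) \sum_(y in A | y \in ground (M l)) w y)).
    apply: ler_sum => l _; have [_ le1] := gP l.
    rewrite [leRHS](_ : _ = \sum_(y in A :&: ground (M l)) w y); last first.
      by apply: eq_bigl => y; rewrite [in RHS]inE.
    apply: le_trans le1; rewrite le_eqVlt; apply/orP; left; apply/eqP.
    apply: eq_bigl => o; rewrite !inE.
    by case: (o \in S); case: (o \in T); case: (o \in ground (M l)).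
  rewrite (exchange_big_dep (mem A)) /=; last by move=> l y _ /andP[].
  apply: ler_sum => y yA; rewrite (eq_bigl (fun l => y \in ground (M l))); last first.
    by move=> l; rewrite yA.
  rewrite sumr_const -[_ *+ _]mulr_natl ler_wpM2r // ler_nat.
  have [_ /(_ y)] := Mp; by rewrite cardsE.
have := @ler_sum _ _ (index_enum E) _ _ _ loss; rewrite !big_split /= !sumrN.
have := submodular_union A T; rewrite big_split /= sumrN.
have : f T <= f (A :|: T) by apply: fm; rewrite subsetUr.
have := f0 set0.
have : p%:R * \sum_(y in A) w y <= p%:R * f A.
  by rewrite ler_wpM2l // -wA lerDr f0.
rewrite -natr1 mulrDl mul1r; move: step2.
lra.
Qed.

End Swaps.

(** * The slot process *)

(** Bridges the finite functions, which form the probability space, and the process and memory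
    cells, which are indexed by [nat]. *)
Definition natf (N K : nat) (v : {ffun 'I_N -> 'I_K}) (i : nat) : nat :=
  oapp (fun j => v j : nat) 0%N (insub i).

Definition put (A : finType) (B : Type) (g : {ffun A -> B}) (a : A) (b : B) :=
  [ffun x => if x == a then b else g x].

(** Counting form of independence: fixing the coordinate [a] to [b] has the same average as
    overwriting it, since each fibre of [g a] is in bijection with the fibre over [b]. *)
Lemma resample (R : numDomainType) (A B : finType) (F : {ffun A -> B} -> R)
    (a : A) (b : B) :
  #|B|%:R * \sum_(g : {ffun A -> B} | g a == b) F g
    = \sum_(g : {ffun A -> B}) F (put g a b).
Proof.
rewrite [RHS](partition_big (fun g : {ffun A -> B} => g a) predT) //=.
rewrite mulr_natl -sumr_const; apply: eq_bigr => c _.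
symmetry; rewrite (reindex_onto (fun g => put g a c) (fun g => put g a b)) /=.
  apply: eq_big => g.
    rewrite ffunE !eqxx /=; apply/eqP/eqP => [<-|gab].
      by rewrite ffunE eqxx.
    by apply/ffunP=> x; rewrite !ffunE; case: eqP => // ->.
  case/andP=> _ /eqP; move=> gb; congr F.
  by rewrite gb.
move=> g /eqP gac; apply/ffunP=> x; rewrite !ffunE.
by case: eqP => // ->.
Qed.

Section Process.
Variables (R : realType) (E : finType) (q : nat) (M : 'I_q -> matroid E).
Variables (f : {set E} -> R) (p : nat) (vid : E -> nat).
Hypothesis vid_inj : injective vid.

Local Notation val := (swap_value M f p).

(** The injective label [vid] breaks ties, so that this is a total order and the winner of a set is
    unique, in whatever order the set is scanned. *)
Definition beats (S : seq E) (x y : E) : bool :=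
  (val S y < val S x) || ((val S y == val S x) && (vid y <= vid x)%N).

Definition winner (S : seq E) (T : {set E}) : option E :=
  [pick x in T | [forall y in T, beats S x y]].

(** A draw that hits the current or a later slot is past the end of [h] and yields [None]. Drawing
    among all slots thus gives every past winner the same probability, whatever the number of slots
    done. *)
Definition contender (S : seq E) (h : seq (option E)) (j : nat) : option E :=
  if nth None h j is Some y then if y \in S then None else Some y else None.

Definition select (S : seq E) (a b : option E) : option E :=
  match a, b with
  | Some x, Some y => if val S y <= val S x then Some x else Some y
  | None, _ => b
  | _, None => a
  end.

Definition next_solution (S : seq E) (z : option E) : seq E :=
  if z is Some x then swap M f p S x else S.

Fixpoint process (slot : E -> nat) (r : nat -> nat) (w : nat) :
    seq E * seq (option E) :=
  if w is w'.+1 then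
    let: (sol, h) := process slot r w' in
    let x := winner sol [set y | slot y == w'] in
    (next_solution sol (select sol x (contender sol h (r w'))), rcons h x)
  else ([::], [::]).

Lemma beats_refl S : reflexive (beats S).
Proof. by move=> x; rewrite /beats eqxx leqnn orbT. Qed.

Lemma beats_anti S x y : beats S x y -> beats S y x -> x = y.
Proof.
rewrite /beats => /orP[lt|/andP[/eqP e le]] /orP[lt'|/andP[/eqP e' le']].
- by have := lt_trans lt lt'; rewrite ltxx.
- by rewrite e' ltxx in lt.
- by rewrite e ltxx in lt'.
- by apply: vid_inj; apply/eqP; rewrite eqn_leq le le'.
Qed.

Lemma beats_trans S y x z : beats S x y -> beats S y z -> beats S x z.
Proof.
rewrite /beats => /orP[lt|/andP[/eqP e le]] /orP[lt'|/andP[/eqP e' le']].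
- by rewrite (lt_trans lt' lt).
- by rewrite e' lt.
- by rewrite -e lt'.
- by rewrite e' e eqxx (leq_trans le' le) orbT.
Qed.

Lemma beats_total S x y : beats S x y || beats S y x.
Proof.
rewrite /beats; case: ltgtP => //= _; exact: leq_total.
Qed.

Lemma winner_some S T x :
  (winner S T == Some x) = (x \in T) && [forall y in T, beats S x y].
Proof.
rewrite /winner; case: pickP => [z /andP[zT /forall_inP zb]|no]; last first.
  by rewrite no.
apply/eqP/andP => [[<-]|[xT /forall_inP xb]]; first by split=> //; apply/forall_inP.
by congr Some; apply: beats_anti; [exact: zb | exact: xb].
Qed.

Lemma winner_in S T x : winner S T = Some x -> x \in T.
Proof. by move=> /eqP; rewrite winner_some => /andP[]. Qed.

Lemma winner_beats S T x y : winner S T = Some x -> y \in T -> beats S x y.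
Proof. by move=> /eqP; rewrite winner_some => /andP[_ /forall_inP]; apply. Qed.

Lemma winner0 S : winner S set0 = None.
Proof. by rewrite /winner; case: pickP => // x; rewrite inE. Qed.

(** The one comparison per item by which the machine maintains its running winner. *)
Lemma winner_setU1 S T x : winner S (x |: T) =
  if winner S T is Some y then if beats S x y then Some x else Some y else Some x.
Proof.
apply/eqP; case wT: (winner S T) => [y|].
  have yT := winner_in wT; have yb z := @winner_beats S T y z wT.
  case: ifP => xy; rewrite winner_some !inE ?eqxx ?yT ?orbT /=; apply/forall_inP => z.
    rewrite !inE => /orP[/eqP->|/yb]; first exact: beats_refl.
    exact: beats_trans.
  rewrite !inE => /orP[/eqP->|/yb//].
  by have := beats_total S x y; rewrite xy.
suff -> : T = set0 by rewrite setU0 winner_some inE eqxx; apply/forall_inP => z /set1P->; exact: beats_refl.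
apply/eqP/set0Pn => -[t0 t0T].
(* As [winner] is a [pick], it must be shown that a nonempty set has one: the winner of [T :\ t0],
   if any, is compared with [t0]. *)
elim: {T}_.+1 {-2}T (ltnSn #|T|) wT t0 t0T => // N IH T ltN wT t0 t0T.
have wt0 : winner S (T :\ t0) = None \/ exists y, winner S (T :\ t0) = Some y.
  by case: (winner _ _) => [y|]; [right; exists y | left].
case: wt0 => [wt0|[y wt0]].
  have [T0|[t tT]] := set_0Vmem (T :\ t0); last first.
    by apply: (IH (T :\ t0) _ wt0 t tT); move: ltN; rewrite (cardsD1 t0) t0T.
  move/eqP: wT; apply/negP; suff : winner S T == Some t0 by move/eqP->.
  rewrite winner_some t0T; apply/forall_inP => z zT.
  have [->|zt] := eqVneq z t0; first exact: beats_refl.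
  have : z \in T :\ t0 by rewrite !inE zt.
  by rewrite T0 inE.
have := winner_in wt0; rewrite !inE => /andP[_ yT].
have yb z : z \in T -> z != t0 -> beats S y z.
  by move=> zT zt; apply: (winner_beats wt0); rewrite !inE zt.
suff [z /eqP] : exists z, winner S T == Some z by rewrite wT.
have [ty|yt] := boolP (beats S t0 y).
  exists t0; rewrite winner_some t0T; apply/forall_inP => z zT.
  have [->|zt] := eqVneq z t0; first exact: beats_refl.
  by apply: beats_trans ty _; exact: yb.
exists y; rewrite winner_some yT; apply/forall_inP => z zT.
have [->|zt] := eqVneq z t0; last exact: yb.
by have := beats_total S t0 y; rewrite (negPf yt).
Qed.

Lemma winner_none S T : winner S T = None -> T = set0.
Proof.
move=> wT; apply/eqP/set0Pn => -[t tT]; have := winner_setU1 S (T :\ t) t.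
by rewrite setD1K // wT; case: (winner _ _) => // y; case: ifP.
Qed.

Lemma winnerD1 S T o : winner S T != Some o -> winner S (T :\ o) = winner S T.
Proof.
case wT: (winner S T) => [x|].
  move=> xo; apply/eqP; rewrite winner_some !inE (winner_in wT) andbT.
  apply/andP; split; first by apply: contra xo => /eqP->.
  by apply/forall_inP => z /setD1P[_]; exact: winner_beats.
by rewrite (winner_none wT) set0D winner0.
Qed.

Lemma processS slot r w : process slot r w.+1 =
  let S := (process slot r w).1 in let h := (process slot r w).2 in
  let x := winner S [set y | slot y == w] in
  (next_solution S (select S x (contender S h (r w))), rcons h x).
Proof. by rewrite /=; case: (process slot r w). Qed.

Lemma eq_process slot slot' r r' w :
    (forall j, (j < w)%N -> [set y | slot y == j] = [set y | slot' y == j]) ->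
    (forall j, (j < w)%N -> r j = r' j) ->
  process slot r w = process slot' r' w.
Proof.
elim: w => // w IH es er; rewrite !processS IH; last 2 first.
- by move=> j jw; apply: es; apply: ltnW.
- by move=> j jw; apply: er; apply: ltnW.
by rewrite es // er.
Qed.

Lemma size_process slot r w : size (process slot r w).2 = w.
Proof. by elim: w => // w IH; rewrite processS /= size_rcons IH. Qed.

Lemma nth_process slot r w w' j : (j < w)%N -> (w <= w')%N ->
  nth None (process slot r w').2 j = nth None (process slot r w).2 j.
Proof.
move=> jw; elim: w' => [|w' IH]; first by case: w jw.
rewrite leq_eqVlt => /orP[/eqP->//|]; rewrite ltnS => ww'.
by rewrite processS /= nth_rcons size_process (leq_trans jw ww') IH.
Qed.

Lemma nth_process_winner slot r w j : (j < w)%N ->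
  nth None (process slot r w).2 j
    = winner (process slot r j).1 [set y | slot y == j].
Proof.
move=> jw; rewrite (@nth_process _ _ j.+1) // processS /=.
by rewrite nth_rcons size_process ltnn eqxx.
Qed.

Lemma process_slot slot r w j x :
  nth None (process slot r w).2 j = Some x -> slot x = j /\ (j < w)%N.
Proof.
have [jw|wj] := ltnP j w; last by rewrite nth_default ?size_process.
by rewrite nth_process_winner // => /winner_in; rewrite inE => /eqP.
Qed.

(** Whatever enters the solution has won some slot, possibly an earlier one. Shortlisting winners at
    the time they win therefore covers the final solution. *)
Lemma process_solution slot r w x : x \in (process slot r w).1 ->
  Some x \in (process slot r w).2.
Proof.
elim: w x => // w IH x; rewrite processS /=; set S := (process _ _ w).1.
rewrite mem_rcons inE.
have step z : z \in S -> (Some z == winner S [set y | slot y == w])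
    || (Some z \in (process slot r w).2) by move=> /IH->; rewrite orbT.
case sel: (select S _ _) => [z|] /=; last exact: step.
move=> /mem_swap /orP[/eqP->|/step//].
move: sel; rewrite /select /contender.
case: (winner S _) => [a|]; case nh: (nth None _ _) => [b|] //;
  rewrite -/S; (try case: ifP => _); (try case: ifP => _) => // -[<-];
  rewrite ?eqxx //; apply/orP; right; rewrite -nh mem_nth // size_process;
  by have [] := process_slot nh.
Qed.

Lemma contender_notin S h j y : contender S h j = Some y -> y \notin S.
Proof.
by rewrite /contender; case: nth => // z; case: ifP => // zS [<-]; rewrite zS.
Qed.

Lemma process_uniq slot r w : uniq (process slot r w).1.
Proof.
elim: w => // w IH; rewrite processS /=; set S := (process _ _ w).1.
case sel: (select S _ _) => [z|] //=; apply: uniq_swap => //.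
apply/negP=> zS; move: sel; rewrite /select.
case wS: (winner S _) => [a|]; case cS: (contender S _ _) => [b|] //.
- case: ifP => _ [ez]; last by have := contender_notin cS; rewrite ez zS.
  have := winner_in wS; rewrite inE ez => /eqP sz.
  have /(nthP None)[j _ /process_slot[ej jw]] := process_solution zS.
  by rewrite -ej sz ltnn in jw.
- move=> [ez]; have := winner_in wS; rewrite inE ez => /eqP sz.
  have /(nthP None)[j _ /process_slot[ej jw]] := process_solution zS.
  by rewrite -ej sz ltnn in jw.
- by move=> [ez]; have := contender_notin cS; rewrite ez zS.
Qed.

(** In a slot before [w], taking out an item that does not win there keeps the winner, and the new
    slot of the item has not been processed yet. *)
Lemma process_move slot slot' r w o :
    Some o \notin (process slot r w).2 ->
    (forall x, x != o -> slot' x = slot x) -> (w <= slot' o)%N ->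
  process slot' r w = process slot r w.
Proof.
move=> + es; elim: w => // w IH; rewrite !processS /= mem_rcons inE negb_or.
move=> /andP[wo oh] wlt; rewrite IH //; last exact: ltnW.
set S := (process slot r w).1.
suff -> : winner S [set y | slot' y == w] = winner S [set y | slot y == w] by [].
suff -> : [set y | slot' y == w] = [set y | slot y == w] :\ o.
  by rewrite winnerD1 // eq_sym.
apply/setP=> y; rewrite !inE; have [->|yo] /= := eqVneq y o; last by rewrite es.
by rewrite gtn_eqF.
Qed.

Lemma process_gain slot r w x :
    (slot x == w) || (nth None (process slot r w).2 (r w) == Some x) ->
    x \notin (process slot r w).1 ->
  val (process slot r w).1 x <= f [set y in (process slot r w.+1).1].
Proof.
rewrite processS /=; set S := (process slot r w).1; set h := (process slot r w).2.
move=> xP xS; rewrite /next_solution.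
have key z : select S (winner S [set y | slot y == w]) (contender S h (r w)) = Some z ->
    val S x <= val S z.
  have wb a : winner S [set y | slot y == w] = Some a -> slot x == w -> val S x <= val S a.
    move=> /winner_beats wa sx; have /orP[/ltW//|/andP[/eqP->]//] : beats S a x.
    by apply: wa; rewrite inE.
  move: xP; rewrite /select => /orP[sx|/eqP hx].
    case wS: (winner S _) => [a|]; last first.
      by have := winner_none wS => /setP/(_ x); rewrite !inE sx.
    have xa := wb a wS sx.
    case: (contender S h _) => [b|]; last by move=> [<-].
    by case: leP => [_ [<-] //|ab [<-]]; exact: le_trans xa (ltW ab).
  rewrite /contender hx (negPf xS); case: (winner S _) => [a|]; last by move=> [<-].
  by case: leP => [? [<-] //|ab [<-]].
case sel: (select S _ _) => [z|]; first by rewrite value_swap key.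
have /eqP := sel; rewrite /select /contender; case/orP: xP => [sx|/eqP ->].
  case wS: (winner S _) => [a|]; first by case: nth => // b; case: ifP => //; case: ifP.
  by have := winner_none wS => /setP/(_ x); rewrite !inE sx.
by rewrite (negPf xS); case: winner => // a; case: ifP.
Qed.

Lemma process_mono slot r w :
  f [set y in (process slot r w).1] <= f [set y in (process slot r w.+1).1].
Proof.
rewrite processS /=; case: select => [z|] //=.
by rewrite value_swap swap_value_ge.
Qed.

Hypothesis Mp : p_matchoid p M.

Lemma process_feasible slot r w : feasible M [set y in (process slot r w).1].
Proof.
elim: w => [|w IH]; last first.
  by rewrite processS /=; case: select => [z|] //=; apply: feasible_swap.
apply/forallP => l; apply: (indep_subset _ (indep_set0 _)).
by apply/subsetP=> z; rewrite !inE.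
Qed.

End Process.

(** * Drift *)

Lemma natfE (N K : nat) (v : {ffun 'I_N -> 'I_K}) (i : 'I_N) : natf v i = v i.
Proof. by rewrite /natf valK. Qed.

(** Redraw of a coordinate on which an event depends: [G] ignores the coordinate [a], and [Q g] sees
    it only through its second argument, so that the event can be averaged separately. *)
Lemma resample_cond (R : numDomainType) (A B : finType) (a : A)
    (Q : {ffun A -> B} -> B -> bool) (G : {ffun A -> B} -> R) :
    (forall g b c, Q (put g a b) c = Q g c) -> (forall g b, G (put g a b) = G g) ->
  #|B|%:R * \sum_(g : {ffun A -> B}) (Q g (g a))%:R * G g
    = \sum_(g : {ffun A -> B}) (\sum_b (Q g b)%:R) * G g.
Proof.
move=> QE GE; rewrite (partition_big (fun g : {ffun A -> B} => g a) predT) //=.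
rewrite mulr_sumr; under [RHS]eq_bigr do rewrite mulr_suml.
rewrite [RHS]exchange_big /=; apply: eq_bigr => b _.
rewrite (eq_bigr (fun g : {ffun A -> B} => (Q g b)%:R * G g)).
  by rewrite resample; apply: eq_bigr => g _; rewrite QE GE.
by move=> g /eqP->.
Qed.

(** One swap is made per slot, so the gains of several available items cannot be added. The
    correction multiplies each gain by [2 - N], where [N] is the number of available items: a single
    one counts in full, and two or more contribute nothing positive. Only pairwise collisions remain
    to be estimated. *)
Lemma sum_isolated_le (R : realDomainType) (E : finType) (O : {set E})
    (J : pred E) (d : E -> R) (G : R) :
    0 <= G -> (forall o, 0 <= d o) -> (forall o, o \in O -> J o -> d o <= G) ->
  \sum_(o in O) (J o)%:R * d o * (1 - \sum_(o' in O :\ o) (J o')%:R) <= G.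
Proof.
move=> G0 d0 dG.
have -> : \sum_(o in O) (J o)%:R * d o * (1 - \sum_(o' in O :\ o) (J o')%:R)
   = \sum_(o in O) (J o)%:R * d o * (2%:R - \sum_(o' in O) (J o')%:R).
  apply: eq_bigr => o oO; rewrite [in RHS](big_setD1 o oO) /=.
  case: (J o) => /=; last by rewrite !mul0r.
  by congr (_ * _); rewrite opprD addrA (_ : 2%:R - 1 = 1 :> R) //; ring.
rewrite -natr_sum; set N := (\sum_(o in O) _)%N.
have [N0|N1|N2] : [\/ N = 0, N = 1 | 1 < N]%N.
  by case: (N) => [|[|N']]; [constructor 1|constructor 2|constructor 3].
- rewrite big1 // => o oO; case Jo: (J o); last by rewrite !mul0r.
  by have /eqP := N0; rewrite /N (big_setD1 o oO) /= Jo.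
- rewrite N1 (_ : 2%:R - 1%:R = 1 :> R); last by ring.
  apply: (@le_trans _ _ (\sum_(o in O) (J o)%:R * G)).
    apply: ler_sum => o oO; rewrite mulr1; case Jo: (J o); rewrite ?mul0r //.
    by rewrite !mul1r dG.
  by rewrite -mulr_suml -natr_sum -/N N1 mul1r.
- apply: le_trans G0; apply: sumr_le0 => o oO; apply: mulr_ge0_le0.
    by rewrite mulr_ge0 // ler0n.
  by rewrite subr_le0 ler_nat.
Qed.

Section Drift.
Variables (R : realType) (E : finType) (q : nat) (M : 'I_q -> matroid E).
Variables (f : {set E} -> R) (p : nat) (vid : E -> nat).
Hypotheses (vid_inj : injective vid) (Mp : p_matchoid p M).
Hypotheses (f0 : set_nonneg f) (fm : set_monotone f) (fs : submodular f).
Variable m : nat.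

Local Notation val := (swap_value M f p).

Definition proc (g : {ffun E -> 'I_m}) (r : {ffun 'I_m -> 'I_m}) (w : nat) :=
  process M f p vid (fun x => g x : nat) (natf r) w.

(** An expectation over slots and draws, left unnormalised so that everything stays a sum over
    finite functions. *)
Definition potential (w : nat) : R :=
  \sum_(g : {ffun E -> 'I_m}) \sum_(r : {ffun 'I_m -> 'I_m}) f [set y in (proc g r w).1].

Definition gain (S : seq E) (o : E) : R :=
  if o \in S then 0 else val S o - f [set y in S].

Lemma gain_ge0 S o : 0 <= gain S o.
Proof. by rewrite /gain; case: ifP => // _; rewrite subr_ge0 swap_value_ge. Qed.

Lemma proc_put_slot g r o (i j : 'I_m) w : (w <= i)%N -> (w <= j)%N ->
  proc (put g o i) r w = proc (put g o j) r w.
Proof.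
move=> wi wj; apply: eq_process => // l lw; apply/setP=> y; rewrite !inE !ffunE.
by case: (y =P o) => // _; rewrite (gtn_eqF (leq_trans lw wi)) (gtn_eqF (leq_trans lw wj)).
Qed.

Lemma proc_put_draw g r (iw i : 'I_m) : proc g (put r iw i) iw = proc g r iw.
Proof.
apply: eq_process => // j jw; rewrite /natf; case: insubP => //= u _ uj.
by rewrite ffunE -val_eqE /= uj ltn_eqF.
Qed.

(** The factor [m] compensates the frequency [1 / m] with which an item of [O] is available, and
    [sum_swap_gain] bounds the gains so collected. The factor [1 - k.*2 / h] accounts for
    collisions: each of the at most [k] other items is available at the same time with frequency at
    most [2 / h], where [h] counts slots from [iw] on that the history cannot tell apart. *)
Lemma drift (O : {set E}) (k h : nat) (iw : 'I_m) :
    feasible M O -> (#|O| <= k)%N -> (0 < h)%N -> (iw + h <= m)%N ->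
    (k.*2 <= h)%N ->
  (1 - k.*2%:R / h%:R) *
     ((#|{ffun E -> 'I_m}| * #|{ffun 'I_m -> 'I_m}|)%:R * f O - p.+1%:R * potential iw)
    <= m%:R * (potential iw.+1 - potential iw).
Proof.
move=> Of Ok h0 ihm kh.
have m0 : (0 < m)%N by apply: leq_ltn_trans (ltn_ord iw).
(* An item is available through its slot ([I1]) or as a past winner drawn again ([I2]); [H] tells
   which draw produces it. *)
pose I1 (g : {ffun E -> 'I_m}) o := g o == iw.
pose H g r (j : 'I_m) o := nth None (proc g r iw).2 j == Some o.
pose I2 (g : {ffun E -> 'I_m}) (r : {ffun 'I_m -> 'I_m}) o := H g r (r iw) o.
pose J g r o := I1 g o || I2 g r o.
pose d g r o := gain (proc g r iw).1 o.
have d0 g r o : 0 <= d g r o by exact: gain_ge0.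
have HE g r o j : H g r j o -> (g o : nat) = j.
  by rewrite /H => /eqP Ho; have [] := process_slot vid_inj Ho.
have Hlt g r o j : H g r j o -> (g o < iw)%N.
  by rewrite /H => /eqP Ho; have [gj jw] := process_slot vid_inj Ho; rewrite gj.
have excl g r o : I1 g o -> I2 g r o = false.
  by move=> /eqP go; apply/negP => /Hlt; rewrite go ltnn.
pose SS (F : {ffun E -> 'I_m} -> {ffun 'I_m -> 'I_m} -> R) :=
  \sum_(g : {ffun E -> 'I_m}) \sum_(r : {ffun 'I_m -> 'I_m}) F g r.
have SSle F G : (forall g r, F g r <= G g r) -> SS F <= SS G.
  by move=> FG; apply: ler_sum => g _; apply: ler_sum.
have SSge0 F : (forall g r, 0 <= F g r) -> 0 <= SS F.
  by move=> F0; apply: sumr_ge0 => g _; apply: sumr_ge0.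
have SSsum (A : {set E}) F : SS (fun g r => \sum_(o in A) F o g r) = \sum_(o in A) SS (F o).
  rewrite /SS exchange_big /=; under eq_bigr do rewrite exchange_big /=.
  rewrite exchange_big /=; apply: eq_bigr => o _; exact: exchange_big.
have SSD F G : SS (fun g r => F g r + G g r) = SS F + SS G.
  by rewrite /SS -big_split /=; apply: eq_bigr => g _; rewrite big_split.
pose X o := SS (fun g r => (J g r o)%:R * d g r o).
have X0 o : 0 <= X o by apply: SSge0 => g r; rewrite mulr_ge0 ?ler0n.
have swapSS F : SS F = \sum_(r : {ffun 'I_m -> 'I_m}) \sum_(g : {ffun E -> 'I_m}) F g r.
  exact: exchange_big.
have Xsplit o : X o = SS (fun g r => (I1 g o)%:R * d g r o)
                     + SS (fun g r => (I2 g r o)%:R * d g r o).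
  rewrite -SSD; apply: eq_bigr => g _; apply: eq_bigr => r _; rewrite -mulrDl /J.
  by case i1: (I1 g o) => /=; rewrite ?add0r // excl ?addr0.
have drawE g o (G : {ffun 'I_m -> 'I_m} -> R) :
    (forall r i, G (put r iw i) = G r) ->
  m%:R * \sum_(r : {ffun 'I_m -> 'I_m}) (I2 g r o)%:R * G r
    = \sum_(r : {ffun 'I_m -> 'I_m}) (\sum_(j : 'I_m) (H g r j o)%:R) * G r.
  move=> GE; have := @resample_cond R _ _ iw (fun r (j : 'I_m) => H g r j o) G.
  rewrite card_ord => /(_ _ GE) <-; last by move=> r b c; rewrite /H proc_put_draw.
  by [].
have dput g r i o : d g (put r iw i) o = d g r o by rewrite /d proc_put_draw.
(* Since [G] does not distinguish the slots from [iw] on, the [h] slots [iw + i] carry equal weight,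
   which leaves at most a fraction [1 / h] for [iw] itself. *)
have slotE o' (G : {ffun E -> 'I_m} -> R) : (forall g, 0 <= G g) ->
    (forall g (i j : 'I_m), (iw <= i)%N -> (iw <= j)%N -> G (put g o' i) = G (put g o' j)) ->
  h%:R * \sum_(g : {ffun E -> 'I_m}) (I1 g o')%:R * G g <= \sum_(g : {ffun E -> 'I_m}) G g.
  move=> G0 GE; rewrite [leRHS](partition_big (fun g : {ffun E -> 'I_m} => g o') predT) //=.
  have eqj (j : 'I_m) : (iw <= j)%N ->
      \sum_(g : {ffun E -> 'I_m} | g o' == j) G g
        = \sum_(g : {ffun E -> 'I_m}) (I1 g o')%:R * G g.
    move=> wj; apply: (@mulfI _ #|'I_m|%:R).
      by rewrite card_ord pnatr_eq0 -lt0n.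
    rewrite resample (eq_bigr (fun g => G (put g o' iw))) => [|g _]; last exact: GE.
    rewrite -resample; congr (_ * _); rewrite big_mkcond /=; apply: eq_bigr => g _.
    by rewrite /I1; case: eqP; rewrite ?mul1r ?mul0r.
  rewrite (bigID (fun j : 'I_m => (iw <= j)%N)) /= ler_wpDr //.
    by apply: sumr_ge0 => j _; apply: sumr_ge0.
  rewrite (eq_bigr _ eqj) sumr_const -[leRHS]mulr_natl ler_wpM2r //.
    by apply: sumr_ge0 => g _; rewrite mulr_ge0 ?ler0n.
  rewrite ler_nat -(card_ord h).
  pose em (i : 'I_h) : 'I_m := insubd iw (iw + i)%N.
  have emE i : em i = (iw + i)%N :> nat.
    by rewrite val_insubd (leq_trans _ ihm) // ltn_add2l.
  rewrite -(card_codom (f := em)); last first.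
    by move=> i j /(congr1 (@nat_of_ord m)); rewrite !emE => /addnI/val_inj.
  apply: subset_leq_card; apply/subsetP=> j /codomP[i ->].
  suff : (iw <= em i)%N by []; by rewrite emE leq_addr.
(* A past winner is hit by one of the [m] draws. Any other item is moved into slot [iw], which
   changes neither the history nor the gain. *)
have hitE : forall o, SS (fun g r => d g r o) <= m%:R * X o.
  move=> o; rewrite Xsplit mulrDr.
  have -> : m%:R * SS (fun g r => (I1 g o)%:R * d g r o)
      = SS (fun g r => d (put g o iw) r o).
    rewrite !swapSS mulr_sumr; apply: eq_bigr => r _.
    have := resample (fun g => d g r o) o iw; rewrite card_ord => <-.
    congr (_ * _); rewrite [RHS]big_mkcond /=; apply: eq_bigr => g _.
    by rewrite /I1; case: eqP; rewrite ?mul1r ?mul0r.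
  have -> : m%:R * SS (fun g r => (I2 g r o)%:R * d g r o)
      = SS (fun g r => (\sum_(j : 'I_m) (H g r j o)%:R) * d g r o).
    rewrite mulr_sumr; apply: eq_bigr => g _; apply: drawE => r i; exact: dput.
  rewrite -SSD; apply: SSle => g r.
  have [oh|oh] := boolP (Some o \in (proc g r iw).2).
    rewrite ler_wpDl // ler_peMl //.
    have /(nthP None)[j jw Hj] := oh; rewrite size_process in jw.
    have jm : (j < m)%N by apply: ltn_trans jw _.
    by rewrite (bigD1 (Ordinal jm)) //= /H Hj eqxx ler_wpDr // sumr_ge0.
  rewrite (_ : d (put g o iw) r o = d g r o).
    by rewrite ler_wpDr // mulr_ge0 // sumr_ge0.
  rewrite /d /proc (@process_move R E q M f p vid vid_inj (fun x => g x : nat)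
     (fun x => put g o iw x : nat) _ _ o) //.
    by move=> x /negPf xo; rewrite ffunE xo.
  by rewrite ffunE eqxx.
(* Two items are never both drawn, since a slot has a single winner. So either [o'] is in slot [iw]
   ([le1]), or [o'] is drawn while [o] is in that slot ([le2], weakened from [1 / m] to [1 / h] in
   [le3]). *)
have coll o o' : o != o' ->
   h%:R * SS (fun g r => (J g r o)%:R * (J g r o')%:R * d g r o)
     <= 2%:R * X o.
  move=> oo'.
  have le1 : h%:R * SS (fun g r => (I1 g o')%:R * ((J g r o)%:R * d g r o)) <= X o.
    rewrite /X !swapSS mulr_sumr; apply: ler_sum => r _.
    apply: (slotE o' (fun g => (J g r o)%:R * d g r o)) => // [g|g i j wi wj].
      by rewrite mulr_ge0 ?ler0n.
    have pe := proc_put_slot g r o' wi wj.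
    by rewrite /J /I1 /I2 /H /d pe !ffunE (negPf oo').
  have le2 : m%:R * SS (fun g r => (I2 g r o')%:R * ((I1 g o)%:R * d g r o)) <= X o.
    rewrite Xsplit -[leLHS]addr0 lerD //; last first.
      by apply: SSge0 => g r; rewrite mulr_ge0 ?ler0n.
    rewrite mulr_sumr; apply: ler_sum => g _; rewrite drawE; last first.
      by move=> r i; rewrite dput.
    apply: ler_sum => r _; rewrite ler_piMl //; first by rewrite mulr_ge0 ?ler0n.
    rewrite (bigD1 (g o')) //= big1 ?addr0 => [|i ig]; first by case: (H _ _ _ _).
    case Hi: (H g r i o') => //; have /eqP := HE _ _ _ _ Hi.
    by rewrite eq_sym (inj_eq val_inj) (negPf ig).
  have le3 : h%:R * SS (fun g r => (I2 g r o')%:R * ((I1 g o)%:R * d g r o)) <= X o.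
    apply: le_trans le2; rewrite ler_wpM2r ?ler_nat //; last first.
      by apply: leq_trans ihm; exact: leq_addl.
    by apply: SSge0 => g r; rewrite !mulr_ge0 ?ler0n.
  rewrite (_ : 2%:R * X o = X o + X o); last by ring.
  apply: le_trans (lerD le1 le3); rewrite -mulrDr -SSD ler_wpM2l ?ler0n //.
  apply: SSle => g r; rewrite !mulrA -mulrDl ler_wpM2r // /J.
  rewrite -!natrM -natrD ler_nat.
  have := excl g r o; have := excl g r o'.
  have noth : I2 g r o -> I2 g r o' -> false.
    by rewrite /I2 /H => /eqP-> /eqP[] /eqP; rewrite (negPf oo').
  case: (I1 g o) (I1 g o') (I2 g r o) (I2 g r o') noth => [] [] [] [] //= noth e1 e2;
    by [have := noth isT isT | have := e1 isT | have := e2 isT].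
have sumgain g r : \sum_(o in O) (J g r o)%:R * d g r o *
      (1 - \sum_(o' in O :\ o) (J g r o')%:R)
    <= f [set y in (proc g r iw.+1).1] - f [set y in (proc g r iw).1].
  apply: sum_isolated_le => [|o|o _ Jo]; rewrite ?subr_ge0 ?process_mono //.
  rewrite /d /gain; case: ifPn => oS; first by rewrite subr_ge0 process_mono.
  by rewrite lerB //; apply: process_gain => //; rewrite natfE.
have tot : \sum_(o in O) (1 - k.*2%:R / h%:R) * X o <= potential iw.+1 - potential iw.
  apply: (@le_trans _ _ (SS (fun g r => \sum_(o in O) (J g r o)%:R * d g r o *
      (1 - \sum_(o' in O :\ o) (J g r o')%:R)))); last first.
    rewrite /potential -sumrB; apply: ler_sum => g _; rewrite -sumrB.
    by apply: ler_sum => r _; exact: sumgain.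
  rewrite SSsum; apply: ler_sum => o oO.
  have -> : SS (fun g r => (J g r o)%:R * d g r o * (1 - \sum_(o' in O :\ o) (J g r o')%:R))
     = X o - \sum_(o' in O :\ o) SS (fun g r => (J g r o)%:R * (J g r o')%:R * d g r o).
    apply/eqP; rewrite eq_sym subr_eq -SSsum -SSD; apply/eqP.
    apply: eq_bigr => g _; apply: eq_bigr => r _; rewrite mulrBr mulr1.
    rewrite (_ : \sum_(o' in O :\ o) (J g r o)%:R * (J g r o')%:R * d g r o =
       (J g r o)%:R * d g r o * \sum_(o' in O :\ o) (J g r o')%:R) ?subrK //.
    by rewrite mulr_sumr; apply: eq_bigr => o' _; rewrite mulrAC.
  rewrite mulrBl mul1r lerD2l lerN2.
  apply: (@le_trans _ _ (\sum_(o' in O :\ o) 2%:R / h%:R * X o)).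
    apply: ler_sum => o'; rewrite !inE => /andP[o'o _].
    rewrite mulrAC ler_pdivlMr ?ltr0n // mulrC; apply: coll.
    by rewrite eq_sym.
  rewrite sumr_const -[leLHS]mulr_natl mulrA ler_wpM2r //.
  rewrite mulrA ler_wpM2r ?invr_ge0 ?ler0n // -muln2 natrM ler_wpM2r ?ler0n // ler_nat.
  by apply: leq_trans Ok; rewrite (cardsD1 o O) oO.
have c0 : 0 <= 1 - k.*2%:R / h%:R :> R.
  by rewrite subr_ge0 ler_pdivrMr ?ltr0n // mul1r ler_nat.
apply: le_trans (ler_wpM2l (ler0n R m) tot).
rewrite -[X in _ <= _ * X]mulr_sumr mulrCA ler_wpM2l // [leRHS]mulr_sumr.
apply: (@le_trans _ _ (\sum_(o in O) SS (fun g r => d g r o))); last first.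
  by apply: ler_sum => o _; exact: hitE.
rewrite -SSsum /potential.
have -> : (#|{ffun E -> 'I_m}| * #|{ffun 'I_m -> 'I_m}|)%:R * f O = SS (fun _ _ => f O).
  rewrite /SS; under eq_bigr do rewrite sumr_const.
  by rewrite sumr_const -mulrnA mulr_natl mulnC.
rewrite mulr_sumr -sumrB; apply: ler_sum => g _.
rewrite mulr_sumr -sumrB; apply: ler_sum => r _.
by apply: sum_swap_gain => //; exact: process_feasible.
Qed.
End Drift.

(** * Sampling a slot *)

Lemma card_ffun_avoid (E : finType) (D : nat) (i0 : 'I_D) (Y : {set E}) :
  (#|[set g : {ffun E -> 'I_D} | [forall y in Y, g y != i0]]| * D ^ #|Y|
    = D.-1 ^ #|Y| * D ^ #|E|)%N.
Proof.
pose F (y : E) : pred 'I_D := if y \in Y then predC1 i0 else predT.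
have -> : #|[set g : {ffun E -> 'I_D} | [forall y in Y, g y != i0]]| = #|family F|.
  rewrite cardsE; apply: eq_card => g; apply/forall_inP/familyP => gP y.
    by rewrite /F; case: ifP => // /gP.
  by move=> yY; have := gP y; rewrite /F yY.
rewrite card_family foldrE big_map big_enum /= (bigID (mem Y)) /=.
rewrite (eq_bigr (fun=> D.-1)); last first.
  by move=> y yY; rewrite /F yY cardC1 card_ord.
rewrite prod_nat_const (eq_bigr (fun=> D)); last first.
  by move=> y /negPf yY; rewrite /F yY card_ord.
rewrite prod_nat_const -mulnA -expnD; congr (_ * D ^ _)%N.
by rewrite addnC -(cardC Y).
Qed.

Section Coins.
Variables (R : realType) (E : finType) (q : nat) (M : 'I_q -> matroid E).
Variables (f : {set E} -> R) (p : nat) (vid : E -> nat).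
Hypotheses (vid_inj : injective vid) (Mp : p_matchoid p M).
Hypotheses (f0 : set_nonneg f) (fm : set_monotone f) (fs : submodular f).

Local Notation beats := (beats M f p vid).
Local Notation winner := (winner M f p vid).
Local Notation process := (process M f p vid).

(* Coin 0 marks the sample of a slot. *)
Definition above (S : seq E) (T : {set E}) (coin : E -> nat) : {set E} :=
  [set y in T | (coin y != 0%N)
     && [forall z in T, (coin z == 0%N) ==> beats S y z]].

(** This set is fixed before any coin is tossed, so the coins of its members average
    independently. *)
Fixpoint top_items (S : seq E) (L : nat) (T : {set E}) : {set E} :=
  if L is L'.+1 then
    if winner S T is Some x then x |: top_items S L' (T :\ x) else set0
  else set0.

Lemma top_items_sub S L (T : {set E}) : top_items S L T \subset T.
Proof.
elim: L T => [|L IH] T /=; first exact: sub0set.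
case wT: winner => [x|]; last exact: sub0set.
rewrite subUset sub1set (winner_in vid_inj wT).
exact: subset_trans (IH _) (subD1set _ _).
Qed.

Lemma card_top_items S L (T : {set E}) : (L <= #|T|)%N -> #|top_items S L T| = L.
Proof.
elim: L T => [|L IH] T LT /=; first by rewrite cards0.
case wT: winner => [x|]; last first.
  by move: LT; rewrite (winner_none vid_inj wT) cards0.
have xT := winner_in vid_inj wT.
rewrite cardsU1 IH; last by move: LT; rewrite (cardsD1 x T) xT.
by rewrite (contraNN (subsetP (top_items_sub S L (T :\ x)) x)) ?setD11.
Qed.

Lemma top_items_upward S L (T U : {set E}) : U \subset T -> (L <= #|U|)%N ->
    (forall y z, y \in U -> z \in T -> beats S z y -> z \in U) ->
  top_items S L T \subset U.
Proof.
elim: L T U => [|L IH] T U UT LU up /=; first exact: sub0set.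
case wT: winner => [x|]; last exact: sub0set.
have xT := winner_in vid_inj wT.
have xU : x \in U.
  have /card_gt0P[u uU] : (0 < #|U|)%N by apply: leq_trans LU.
  apply: (up u) => //; apply: (winner_beats vid_inj wT); exact: (subsetP UT).
rewrite subUset sub1set xU /=; apply: subset_trans (subD1set U x).
apply: IH; first exact: setSD.
  by move: LU; rewrite (cardsD1 x U) xU.
move=> y z; rewrite !inE => /andP[yx yU] /andP[-> zT] /=; exact: up.
Qed.

(** An item is lost if it falls into the sample, with frequency [1 / D], or if more than [L] items
    beat the sample. In the latter case the [L] best items of [T] are among these, so that none of
    them has coin 0, which has frequency [(1 - 1 / D) ^ L]. *)
Lemma coins_missed (S : seq E) (T : {set E}) (D L : nat) (x : E) :
    (0 < D)%N -> x \in T ->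
  (\sum_(c : {ffun E -> 'I_D})
     (~~ (((c x : nat) != 0) && (#|above S T (fun y => c y)| <= L))%N)%:R : R)
    <= (D ^ #|E|)%:R * (D%:R^-1 + (1 - D%:R^-1) ^+ L).
Proof.
move=> D0 xT; pose i0 : 'I_D := Ordinal D0.
have Dn0 : D%:R != 0 :> R by rewrite pnatr_eq0 -lt0n.
have cnt (Y : {set E}) : (#|[set g : {ffun E -> 'I_D} | [forall y in Y, g y != i0]]|%:R : R)
    = (D ^ #|E|)%:R * (1 - D%:R^-1) ^+ #|Y|.
  have := card_ffun_avoid i0 Y; move/(congr1 (fun n => n%:R : R)).
  rewrite !natrM !natrX -subn1 natrB // => eqc.
  apply: (@mulIf _ (D%:R ^+ #|Y|)); first by rewrite expf_neq0.
  rewrite eqc mulrC -mulrA; congr (_ * _).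
  rewrite -exprMn; congr (_ ^+ _); field; exact: Dn0.
have Z : (\sum_(c : {ffun E -> 'I_D}) ((c x : nat) == 0%N)%:R : R)
    = (D ^ #|E|)%:R * D%:R^-1.
  have := @resample R E 'I_D (fun=> 1) x i0.
  rewrite [RHS]sumr_const card_ffun !card_ord big_mkcond /= => <-.
  by rewrite mulrC mulKf //; apply: eq_bigr => c _; rewrite -val_eqE; case: eqP.
pose Y := top_items S L T.
apply: (@le_trans _ _ (\sum_(c : {ffun E -> 'I_D}) (((c x : nat) == 0%N)%:R
    + ((L <= #|T|)%N && [forall y in Y, c y != i0])%:R))).
  apply: ler_sum => c _; rewrite negb_and negbK -ltnNge.
  case: eqP => /= _; first by rewrite lerDl ler0n.
  rewrite add0r; case: ltnP => [gtL|_]; last exact: ler0n.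
  have UT : above S T (fun y => c y) \subset T.
    by apply/subsetP=> y; rewrite inE => /andP[].
  have -> /= : (L <= #|T|)%N by apply: leq_trans (ltnW gtL) (subset_leq_card UT).
  suff -> : [forall y in Y, c y != i0] by [].
  apply/forall_inP => y yY.
  suff : y \in above S T (fun y => c y) by rewrite inE -val_eqE => /and3P[].
  move: y yY; apply/subsetP; apply: top_items_upward => // [|y z]; first exact: ltnW.
  rewrite !inE => /and3P[yT cy /forall_inP yb] zT zy; rewrite zT /=.
  have zb u : u \in T -> ((c u : nat) == 0%N) -> beats S z u.
    move=> uT cu; apply: beats_trans zy _; exact: (implyP (yb u uT)).
  apply/andP; split; last by apply/forall_inP => u uT; apply/implyP; exact: zb.
  apply: contra cy => cz; have yz := implyP (yb z zT) cz.
  by rewrite (beats_anti vid_inj yz zy).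
rewrite big_split /= Z mulrDr lerD2l.
have [LT|TL] := leqP L #|T|; last first.
  rewrite big1 // mulr_ge0 ?ler0n // exprn_ge0 // subr_ge0 invf_le1 ?ltr0n //.
  by rewrite ler1n.
rewrite -(card_top_items S LT) -cnt -natr_sum ler_nat -sum1_card [leqRHS]big_mkcond.
by apply/eq_leq/eq_bigr => c _; rewrite inE; case: ifP.
Qed.

Lemma le_best_within (A S : {set E}) : S \subset A -> feasible M S ->
  f S <= best_within M f A.
Proof. by move=> SA Sf; apply: le_bigmax_cond; rewrite SA. Qed.

(** The solution does not read the coins, so each of its items is caught for a fraction of at least
    [1 - d] of them; the modular minorant of [f] on the solution turns this into the same fraction
    of the value. The caught part of the solution is a subset of a feasible set, hence feasible. *)
Lemma coins_value (slot : E -> nat) (r : nat -> nat) (W D L : nat)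
    (A : {ffun E -> 'I_D} -> {set E}) :
    (0 < D)%N ->
    (forall (c : {ffun E -> 'I_D}) w x, (w < W)%N ->
       nth None (process slot r W).2 w = Some x -> (c x != 0 :> nat)%N ->
       (#|above (process slot r w).1 [set y | slot y == w] (fun y => c y)| <= L)%N ->
       x \in A c) ->
  (D ^ #|E|)%:R * (1 - (D%:R^-1 + (1 - D%:R^-1) ^+ L))
      * f [set y in (process slot r W).1]
    <= \sum_(c : {ffun E -> 'I_D}) best_within M f (A c).
Proof.
move=> D0 AP; set S := [set y in (process slot r W).1].
set d := _ + _ ^+ L; set N := (D ^ #|E|)%:R.
have [w [w0 wS wsub]] := modular_weights S fm fs.
have cN : #|{ffun E -> 'I_D}|%:R = N :> R by rewrite card_ffun card_ord.
have d0 : 0 <= d.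
  rewrite addr_ge0 ?invr_ge0 ?ler0n // exprn_ge0 // subr_ge0 invf_le1 ?ltr0n //.
  by rewrite ler1n.
apply: (@le_trans _ _ (\sum_(c : {ffun E -> 'I_D}) (f set0 + \sum_(y in S :&: A c) w y))).
  rewrite big_split /= sumr_const -[_ *+ _]mulr_natl cN.
  have -> : \sum_(c : {ffun E -> 'I_D}) \sum_(y in S :&: A c) w y
     = \sum_(y in S) w y * \sum_(c : {ffun E -> 'I_D}) (y \in A c)%:R.
    under [RHS]eq_bigr do rewrite mulr_sumr; rewrite [RHS]exchange_big /=.
    apply: eq_bigr => c _; rewrite big_mkcond [RHS]big_mkcond /=.
    apply: eq_bigr => y _; rewrite inE.
    by case: (y \in S) (y \in A c) => [] []; rewrite ?mulr1 ?mulr0.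
  rewrite -wS mulrDr lerD //.
    rewrite ler_wpM2r ?f0 // ler_piMr // ?ler0n // gerBl //.
  rewrite mulr_sumr; apply: ler_sum => y yS; rewrite mulrC ler_wpM2l //.
  have := yS; rewrite inE => /(process_solution vid_inj)/(nthP None)[j].
  rewrite size_process => jW hj.
  have xT : y \in [set z | slot z == j].
    by rewrite inE; have [->] := process_slot vid_inj hj.
  have := @coins_missed (process slot r j).1 _ D L y D0 xT; rewrite -/d -/N => miss.
  rewrite mulrBr mulr1 lerBlDr -lerBlDl; apply: le_trans miss.
  rewrite -cN -sum1_card natr_sum -sumrB; apply: ler_sum => c _.
  case yA: (y \in A c); first by rewrite subrr ler0n.
  rewrite subr0; case cond: (_ && _) => //=; case/andP: cond => cy ab.
  by rewrite (AP c j y jW hj cy ab) in yA.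
apply: ler_sum => c _; apply: le_trans (wsub _ (subsetIl _ _)) _.
apply: le_best_within; first exact: subsetIr.
have /forallP Sf : feasible M S by exact: process_feasible.
apply/forallP => l; apply: indep_subset (Sf l); apply: setSI; exact: subsetIl.
Qed.

End Coins.

(** * Numerical bounds *)

Section Numerics.
Variable R : realType.

(** [a 0] may be negative, in which case the bound on the power of [1 - y] could not be multiplied
    by it; hence the nonnegative [b]. *)
Lemma geometric_decay (a : nat -> R) (y b : R) (W : nat) :
    0 <= y <= 1 -> (forall w, (w < W)%N -> a w.+1 <= (1 - y) * a w) ->
    0 <= b -> a 0%N <= b ->
  a W <= expR (- (y * W%:R)) * b.
Proof.
move=> /andP[y0 y1]; have y1' : 0 <= 1 - y by rewrite subr_ge0.
move=> rec b0 ab; have le : a W <= (1 - y) ^+ W * b.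
  elim: W rec => [|W IH] rec; first by rewrite expr0 mul1r.
  apply: le_trans (rec W (ltnSn W)) _; rewrite exprS -mulrA ler_wpM2l // IH //.
  by move=> w ww; apply: rec; apply: ltnW.
apply: le_trans le _; rewrite ler_wpM2r // -mulNr mulrC expRM_natl.
by rewrite lerXn2r ?nnegrE ?expR_ge0 // (le_trans _ (expR_ge1Dx _)).
Qed.

(** The budget for [eps]: [2 / D] for missed winners and [p.+1 * 3 / D] for the shortened exponent,
    because [e^(-P (1 - x)) - e^(-P) <= P x]. *)
Lemma ratio_bound (p D : nat) (eps d : R) :
    (3 <= D)%N -> (3 * p.+1 + 2)%:R <= eps * D%:R -> d <= 2%:R / D%:R ->
    0 <= d <= 1 ->
  1 - (expR p.+1%:R)^-1 - eps
    <= (1 - d) * (1 - expR (- (p.+1%:R * (1 - 3%:R / D%:R)))).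
Proof.
move=> D3 epsD dD /andP[d0 d1].
have D0 : 0 < D%:R :> R by rewrite ltr0n; lia.
set P : R := p.+1%:R; set x : R := 3%:R / D%:R; set y := - (P * (1 - x)).
have x1 : x <= 1 by rewrite ler_pdivrMr // mul1r ler_nat.
have P0 : 0 <= P by rewrite ler0n.
have y0 : y <= 0 by rewrite oppr_le0 mulr_ge0 // subr_ge0.
have ey1 : expR y <= 1 by rewrite -expR0 ler_expR.
have ey0 := expR_ge0 y.
have ediff : expR y - expR (- P) <= P * x.
  have := expR_ge1Dx (- (P * x)); have -> : - P = - (P * x) + y by rewrite /y; ring.
  rewrite expRD => h.
  have : expR y * (1 - expR (- (P * x))) <= expR y * (P * x).
    by rewrite ler_wpM2l //; lra.
  have Px0 : 0 <= P * x by rewrite mulr_ge0 // divr_ge0 // ?ler0n ltW.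
  have : expR y * (P * x) <= 1 * (P * x) by rewrite ler_wpM2r.
  lra.
have epsb : P * x + 2%:R / D%:R <= eps.
  rewrite /x mulrA -mulrDl ler_pdivrMr //; apply: le_trans epsD.
  by rewrite natrD natrM mulrC.
rewrite -expRN; have := mulr_ge0 d0 ey0; lra.
Qed.

(** Both sides are compared with [e^(-D)]. This is the origin of the cap of [D ^ 2] shortlisted
    items per slot: exceeding it is then no more likely than falling into the sample. *)
Lemma pow_inv_le (D : nat) : (2 <= D)%N ->
  (1 - D%:R^-1) ^+ (D ^ 2) <= D%:R^-1 :> R.
Proof.
move=> D2; have D0 : 0 < D%:R :> R by rewrite ltr0n; lia.
have i1 : D%:R^-1 <= 1 :> R by rewrite invf_le1 // ler1n; lia.
have h : 1 - D%:R^-1 <= expR (- D%:R^-1) :> R := expR_ge1Dx _.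
apply: (@le_trans _ _ (expR (- D%:R^-1) ^+ (D ^ 2))).
  by rewrite lerXn2r ?nnegrE ?expR_ge0 // subr_ge0.
rewrite -expRM_natl natrX mulrN expr2 -mulrA mulfV ?gt_eqF // mulr1 expRN.
rewrite lef_pV2 ?posrE ?expR_gt0 //.
by apply: le_trans (expR_ge1Dx _); rewrite lerDr.
Qed.

(** At most [k * D ^ 2] slots with [D ^ 2] items each give [D ^ 4] per unit of [k]. As
    [D ^ 4 <= 2 ^ (4 * D)] and [D] is at most linear in [1 / eps], a polynomial of degree one
    suffices. *)
Lemma list_size_bound (c eps : R) (p D : nat) :
    0 <= c / eps -> D = (Num.truncn (c / eps) + p + 3)%N ->
  (D ^ 4)%:R <= 2 `^ ((4 * c) *: 'X + (4 * (p + 3))%:R%:P).[eps^-1].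
Proof.
move=> ce -> {D}; set D := (_ + _ + _)%N.
have DD : (D ^ 4 <= 2 ^ (4 * D))%N.
  by rewrite mulnC expnM leq_exp2r // ltnW // ltn_expl.
apply: (@le_trans _ _ ((2 ^ (4 * D))%:R)); first by rewrite ler_nat.
rewrite natrX -powR_mulrn ?ler0n // ler_powR ?ler1n // !hornerE.
have tr : (Num.truncn (c / eps))%:R <= c / eps by rewrite truncn_le.
rewrite /D -addnA mulnDr [leLHS]natrD lerD2r natrM.
by rewrite -mulrA ler_wpM2l.
Qed.

End Numerics.

(** * Solving the drift recursion *)

Section Potential.
Variables (R : realType) (E : finType) (q : nat) (M : 'I_q -> matroid E).
Variables (f : {set E} -> R) (p : nat) (vid : E -> nat).
Hypotheses (vid_inj : injective vid) (Mp : p_matchoid p M).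
Hypotheses (f0 : set_nonneg f) (fm : set_monotone f) (fs : submodular f).

(** The deficit [N * f O - p.+1 * potential w] shrinks by the factor [1 - y] in each slot. After [W]
    slots the exponent is [p.+1 * (1 - 2 / D) * (1 - 1 / D)], where the factors stand for collisions
    and for unprocessed slots; it is at least [p.+1 * (1 - 3 / D)]. *)
Lemma potential_lower (O : {set E}) (k D m W : nat) :
    feasible M O -> (#|O| <= k)%N -> (0 < k)%N -> (p.+3 <= D)%N ->
    m = (k * D ^ 2)%N -> W = (k * (D ^ 2 - D))%N ->
  (#|{ffun E -> 'I_m}| * #|{ffun 'I_m -> 'I_m}|)%:R
      * (1 - expR (- (p.+1%:R * (1 - 3%:R / D%:R)))) * f O
    <= p.+1%:R * potential M f p vid m W.
Proof.
move=> Of Ok k0 pD mD WD.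
set N : R := (_ * _)%:R; set P : R := p.+1%:R.

have D0 : 0 < D%:R :> R by rewrite ltr0n; lia.
have k0' : 0 < k%:R :> R by rewrite ltr0n.
have m0 : (0 < m)%N by rewrite mD muln_gt0 k0 expn_gt0; lia.
have m0' : 0 < m%:R :> R by rewrite ltr0n.
have mE : m%:R = k%:R * D%:R ^+ 2 :> R by rewrite mD natrM natrX.
have DD : (D <= D ^ 2)%N by rewrite -[X in (X <= _)%N]expn1 leq_exp2l; lia.
have WE : W%:R = k%:R * (D%:R ^+ 2 - D%:R) :> R by rewrite WD natrM natrB // natrX.
have P0 : 0 <= P by rewrite ler0n.
pose c : R := 1 - 2%:R / D%:R.
have x1 : 2%:R / D%:R <= 1 :> R by rewrite ler_pdivrMr // mul1r ler_nat; lia.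
have c0 : 0 <= c <= 1.
  by rewrite subr_ge0 x1 gerBl divr_ge0 // ler0n.
pose y := P * c / m%:R.
(* The upper bound holds because [p.+1 <= D ^ 2 <= m]. *)
have y01 : 0 <= y <= 1.
  have /andP[c0' c1] := c0.
  rewrite divr_ge0 ?mulr_ge0 ?ler0n //= ler_pdivrMr // mul1r.
  apply: (@le_trans _ _ (P * 1)); first by rewrite ler_wpM2l.
  rewrite mulr1 ler_nat; nia.
pose a w := N * f O - P * potential M f p vid m w.
have rec w : (w < W)%N -> a w.+1 <= (1 - y) * a w.
  (* The [k * D] unprocessed slots guarantee [h = k * D] in [drift] at every [w < W]. *)
  move=> wW; have WmE : (W + k * D = m)%N by rewrite WD mD -mulnDr subnK.
  have wm : (w < m)%N by apply: leq_trans wW _; rewrite -WmE leq_addr.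
  have := @drift R E q M f p vid vid_inj Mp f0 fm fs m O k (k * D) (Ordinal wm) Of Ok.
  have -> : (k.*2)%:R / (k * D)%:R = 2%:R / D%:R :> R.
    rewrite -muln2 !natrM; by field; rewrite !gt_eqF.
  rewrite -/c -/N -/P /= => /(_ _ _ _)/wrap[]; last first.
  - rewrite -/(a w) => dr.
    have : P * (potential M f p vid m w.+1 - potential M f p vid m w) >= y * a w.
      rewrite /y -!mulrA ler_wpM2l // mulrCA ler_pdivrMl //.
    rewrite /a; lra.
  - by rewrite -muln2 leq_mul2l; lia.
  - by rewrite -WmE leq_add2r ltnW.
  - by rewrite muln_gt0 k0; lia.
have fO0 := f0 O.
have N0 : 0 <= N by rewrite ler0n.
have pot0 : 0 <= potential M f p vid m 0.
  by apply: sumr_ge0 => g _; apply: sumr_ge0.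
have a0 : a 0%N <= N * f O by rewrite gerBl mulr_ge0.
have := geometric_decay y01 rec (mulr_ge0 N0 fO0) a0.
rewrite /a => dec.
have ex : expR (- (y * W%:R)) <= expR (- (P * (1 - 3%:R / D%:R))).
  rewrite ler_expR lerN2 /y WE mE /c.
  have -> : P * (1 - 2 / D%:R) / (k%:R * D%:R ^+ 2) * (k%:R * (D%:R ^+ 2 - D%:R))
     = P * ((1 - 2 / D%:R) * (1 - D%:R^-1)).
    by field; rewrite !gt_eqF.
  rewrite ler_wpM2l //.
  have i0 : 0 <= D%:R^-1 :> R by rewrite invr_ge0 ltW.
  have := mulr_ge0 i0 i0; lra.
have := ler_wpM2r (mulr_ge0 N0 fO0) ex; set e := expR (- (P * _)) => h.
have -> : N * (1 - e) * f O = N * f O - e * (N * f O) by ring.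
lra.
Qed.

End Potential.

(** * A timed logic for deterministic programs *)

Fixpoint deterministic (c : cmd) : bool :=
  match c with
  | Seq c1 c2 => deterministic c1 && deterministic c2
  | If _ c1 c2 => deterministic c1 && deterministic c2
  | While _ _ | Rand _ _ _ => false
  | _ => true
  end.

Fixpoint cost (c : cmd) : nat :=
  match c with
  | Seq c1 c2 => (cost c1 + cost c2).+1
  | If _ c1 c2 => (maxn (cost c1) (cost c2)).+1
  | _ => 1
  end.

(** Unrolled into the program text, which may depend on the constant [p] though not on [n] or
    [k]. *)
Definition cfor (p : nat) (F : nat -> cmd) : cmd :=
  foldr (fun j c => Seq (F j) c) Skip (iota 0 p).

Section Logic.
Variables (R : realType) (E : finType) (q : nat) (M : 'I_q -> matroid E).
Variables (f : {set E} -> R) (s : seq E).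

Local Notation state := (state R E).
Local Notation runs := (run_from M f s).

Lemma dbind_dret (A B : Type) (a : A) (g : A -> dist R B) : dbind (dret R a) g = g a.
Proof.
rewrite /dbind /dret /= cats0 -[RHS]map_id; apply: eq_map => -[x y] /=.
by rewrite mul1r.
Qed.

(** Quantifying over the stack [K] and the remaining time [T] makes executions compose; the exact
    step count [t'] depends on neither. *)
Definition exec (c : cmd) (st : state) (t : nat) (st' : state) : Prop :=
  exists2 t', (t' <= t)%N &
    forall K T, runs (t' + T) (c :: K, st) = runs T (K, st').

Definition wp (c : cmd) (t : nat) (Q : state -> Prop) (st : state) : Prop :=
  exists2 st', exec c st t st' & Q st'.

Fixpoint den (c : cmd) (st : state) : state :=
  let nv := neval st in
  match c with
  | Seq c1 c2 => den c2 (den c1 st)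
  | If b c1 c2 => if beval st b then den c1 st else den c2 st
  | NSet a i e => set_nmem st a (nv i) (nv e)
  | RSet a i e => set_rmem st a (nv i) (reval st e)
  | SIns a i x =>
      set_smem st a (nv i) (smem st a (nv i) :|: oset1 (item_at s st (nv x)))
  | SDel a i x =>
      set_smem st a (nv i) (smem st a (nv i) :\: oset1 (item_at s st (nv x)))
  | Value a i b j => set_rmem st a (nv i) (f (smem st b (nv j)))
  | Indep a i l b j =>
      set_nmem st a (nv i) (nat_of_bool (indep_query M (nv l) (smem st b (nv j))))
  | NumMat a i x =>
      set_nmem st a (nv i) (size (matroids_of_opt M (item_at s st (nv x))))
  | MatAt a i x j =>
      set_nmem st a (nv i) (nth 0%N (matroids_of_opt M (item_at s st (nv x))) (nv j))
  | Next => State (minn (arrived st).+1 (size s)) (shortlist st)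
              (nmem st) (rmem st) (smem st)
  | Accept => State (arrived st) (shortlist st :|: oset1 (current_item s st))
                (nmem st) (rmem st) (smem st)
  | Skip | While _ _ | Rand _ _ _ => st
  end.

Lemma wp_weaken c t t' (Q Q' : state -> Prop) st :
  wp c t Q st -> (t <= t')%N -> (forall st', Q st' -> Q' st') -> wp c t' Q' st.
Proof.
move=> [st' [t0 t0t ex] Qst] tt' QQ; exists st'; last exact: QQ.
by exists t0 => //; apply: leq_trans tt'.
Qed.

Lemma wp_cost c t t' (Q : state -> Prop) st : wp c t Q st -> (t <= t')%N -> wp c t' Q st.
Proof. by move=> h tt'; apply: wp_weaken h tt' _. Qed.

Lemma wp_post c t (Q Q' : state -> Prop) st :
  wp c t Q st -> (forall st', Q st' -> Q' st') -> wp c t Q' st.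
Proof. by move=> h QQ; apply: wp_weaken h (leqnn t) QQ. Qed.

Lemma wp_seq c1 c2 t1 t2 (Q1 Q : state -> Prop) st :
  wp c1 t1 Q1 st -> (forall st1, Q1 st1 -> wp c2 t2 Q st1) ->
  wp (Seq c1 c2) (t1 + t2).+1 Q st.
Proof.
move=> [st1 [u1 u1t ex1] Q1st] /(_ st1 Q1st) [st2 [u2 u2t ex2] Qst].
exists st2 => //; exists (u1 + u2).+1; first by rewrite ltnS leq_add.
by move=> K T; rewrite addSn /= dbind_dret -addnA ex1 ex2.
Qed.

Lemma wp_if b c1 c2 t (Q : state -> Prop) st :
  wp (if beval st b then c1 else c2) t Q st -> wp (If b c1 c2) t.+1 Q st.
Proof.
move=> [st1 [u1 u1t ex1] Qst]; exists st1 => //; exists u1.+1 => // K T.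
by rewrite addSn /= dbind_dret; exact: ex1.
Qed.

Lemma wp_det c (Q : state -> Prop) st :
  deterministic c -> Q (den c st) -> wp c (cost c) Q st.
Proof.
move=> dc Qc; exists (den c st) => //; move: dc {Qc Q}.
elim: c st; try by (intros; exists 1%N => // K T; rewrite addSn /= dbind_dret).
- move=> c1 IH1 c2 IH2 st /= /andP[/(IH1 st)[t1 le1 ex1] /(IH2 (den c1 st))[t2 le2 ex2]].
  exists (t1 + t2).+1; first by rewrite ltnS leq_add.
  by move=> K T; rewrite addSn /= dbind_dret -addnA ex1 ex2.
- move=> b c1 IH1 c2 IH2 st /= /andP[/(IH1 st)[t1 le1 ex1] /(IH2 st)[t2 le2 ex2]].
  case: ifP => bst.
    exists t1.+1; first by rewrite ltnS (leq_trans le1) // leq_maxl.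
    by move=> K T; rewrite addSn /= dbind_dret bst.
  exists t2.+1; first by rewrite ltnS (leq_trans le2) // leq_maxr.
  by move=> K T; rewrite addSn /= dbind_dret bst.
Qed.

Lemma wp_while b c (N : nat) (t : nat -> nat) (Inv : nat -> state -> Prop) st :
    Inv 0%N st ->
    (forall i st, (i < N)%N -> Inv i st ->
       beval st b /\ wp c (t i) (Inv i.+1) st) ->
    (forall st, Inv N st -> ~~ beval st b) ->
  wp (While b c) (\sum_(i < N) (t i).+2 + 1) (Inv N) st.
Proof.
move=> I0 step stop.
suff H d : (d <= N)%N -> forall st, Inv (N - d)%N st ->
    wp (While b c) (\sum_(N - d <= i < N) (t i).+2 + 1)%N (Inv N) st.
  by have := H N (leqnn N) st; rewrite subnn big_mkord; apply.
elim: d => [|d IH] dN st0; rewrite ?subn0 => Ist.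
  rewrite big_geq // add0n; exists st0 => //; exists 1%N => // K T.
  by rewrite addSn /= dbind_dret (negPf (stop _ Ist)).
have lt : (N - d.+1 < N)%N by lia.
have [bt [st1 [u1 u1t ex1] I1]] := step _ _ lt Ist.
have e1 : (N - d.+1).+1 = (N - d)%N by lia.
rewrite e1 in I1; have [st2 [u2 u2t ex2] I2] := IH (ltnW dN) st1 I1.
exists st2 => //; exists (u1 + u2).+1.
  by rewrite big_ltn // e1; move: u1t u2t; lia.
by move=> K T; rewrite addSn /= dbind_dret bt -addnA ex1 ex2.
Qed.

Lemma wp_while_seq (I : Type) b c (t : nat) (Inv : seq I -> seq I -> state -> Prop)
    (xs : seq I) st :
    Inv [::] xs st ->
    (forall done x todo st, Inv done (x :: todo) st ->
       beval st b /\ wp c t (Inv (rcons done x) todo) st) ->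
    (forall done st, Inv done [::] st -> ~~ beval st b) ->
  wp (While b c) (size xs * t.+2 + 1) (Inv xs [::]) st.
Proof.
move=> I0 step stop.
suff H done todo st0 : Inv done todo st0 ->
    wp (While b c) (size todo * t.+2 + 1) (Inv (done ++ todo) [::]) st0 by exact: H I0.
elim: todo done st0 => [|x todo IH] done st0 Ist.
  rewrite cats0; exists st0 => //; exists 1%N => // K T.
  by rewrite addSn /= dbind_dret (negPf (stop _ _ Ist)).
have [bt [st1 [u1 u1t ex1] I1]] := step _ _ _ _ Ist.
have [st2 [u2 u2t ex2] I2] := IH _ _ I1.
exists st2; last by rewrite cat_rcons in I2.
exists (u1 + u2).+1; first by move: u1t u2t; rewrite /=; lia.
by move=> K T; rewrite addSn /= dbind_dret bt -addnA ex1 ex2.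
Qed.

Lemma wp_cfor p F t (Inv : nat -> state -> Prop) st :
    Inv 0%N st ->
    (forall j st, (j < p)%N -> Inv j st -> wp (F j) t (Inv j.+1) st) ->
  wp (cfor p F) (p * t.+1 + 1) (Inv p) st.
Proof.
move=> I0 step; rewrite /cfor.
suff H d : (d <= p)%N -> forall st, Inv (p - d)%N st ->
    wp (foldr (fun j c => Seq (F j) c) Skip (iota (p - d) d)) (d * t.+1 + 1) (Inv p) st.
  by have := H p (leqnn p) st; rewrite subnn; apply.
elim: d => [|d IH] dp st0; rewrite ?subn0 => Ist /=.
  exact: (wp_det (c := Skip)).
have lt : (p - d.+1 < p)%N by lia.
have e1 : (p - d.+1).+1 = (p - d)%N by lia.
apply: (@wp_weaken _ (t + (d * t.+1 + 1)).+1 _ (Inv p)) => //; last by lia.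
apply: wp_seq; first exact: step lt Ist.
by move=> st1; rewrite e1; apply: IH; apply: ltnW.
Qed.

(** A halted configuration is a fixed point of [step], so spare time does no harm. *)
Lemma exec_halt c st t st' T : exec c st t st' -> (t <= T)%N ->
  runs T ([:: c], st) = dret R ([::], st').
Proof.
move=> [t' t't ex] tT; rewrite -(subnKC (leq_trans t't tT)) ex.
by elim: (T - t')%N => //= u IH; rewrite dbind_dret.
Qed.

End Logic.

(** * Evaluating and applying swaps *)

Local Notation "a .[: i ]" := (NGet a (NConst i)) (at level 2, format "a .[: i ]").
Local Notation "c1 ;; c2" := (Seq c1 c2) (at level 60, right associativity).
Local Notation Z0 := (NConst 0).

(* Memory layout.  Natural arrays 0: inputs; 1: slot, 2: coin of each virtual
   position; 3: draws; 4, 5: heads of the bucket lists (sample, rest) of each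
   slot; 6: links of these lists; 7: winners; 8: global registers; 9-12:
   matroids of the candidate, current removals, loop counters, best removals;
   13, 14, 15: base addresses, lengths and contents of the per-matroid lists of
   the current solution; 16: membership in the current solution; 17: flags.
   Set cell (0, 0) holds the current solution. *)

Definition try_swap (p : nat) : cmd :=
  cfor p (fun j => SDel 0 Z0 10.[: j]) ;;
  SIns 0 Z0 8.[: 4] ;;
  Value 0 (NConst 1) 0 Z0 ;;
  NSet 17 (NConst 1) (NConst 1) ;;
  cfor p (fun j =>
    Indep 17 (NConst 2) 9.[: j] 0 Z0 ;;
    If (BLeN 17.[: 2] Z0) (NSet 17 (NConst 1) Z0) Skip) ;;
  SDel 0 Z0 8.[: 4] ;;
  cfor p (fun j => SIns 0 Z0 10.[: j]) ;;
  If (BAnd (BLeN (NConst 1) 17.[: 1]) (BNot (BLeR (RGet 0 (NConst 1)) (RGet 0 Z0))))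
     (RSet 0 Z0 (RGet 0 (NConst 1)) ;;
      NSet 17 Z0 (NConst 1) ;;
      cfor p (fun j => NSet 12 (NConst j) 10.[: j]))
     Skip.

(** One nested loop for each of the [p] positions. The number [n], read from cell (0, 0), is the
    position of no item, so deleting or inserting it has no effect: it encodes [None]. *)
Fixpoint try_swaps (p d j : nat) : cmd :=
  if d is d'.+1 then
    NSet 10 (NConst j) 0.[: 0] ;;
    try_swaps p d' j.+1 ;;
    NSet 11 (NConst j) Z0 ;;
    While (BNot (BLeN (NGet 14 9.[: j]) 11.[: j]))
      (NSet 10 (NConst j) (NGet 15 (NAdd (NGet 13 9.[: j]) 11.[: j])) ;;
       try_swaps p d' j.+1 ;;
       NSet 11 (NConst j) (NAdd 11.[: j] (NConst 1)))
  else try_swap p.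

Definition evaluate (p : nat) : cmd :=
  cfor p (fun j => MatAt 9 (NConst j) 8.[: 4] (NConst j)) ;;
  Value 0 Z0 0 Z0 ;;
  NSet 17 Z0 Z0 ;;
  try_swaps p p 0.

(** At most [K + 1] choices on each of [p] levels: the source of [K ^ p] in the running time. *)
Fixpoint swaps_cost (p K d : nat) : nat :=
  if d is d'.+1 then (swaps_cost p K d' + K * (swaps_cost p K d' + 10) + 10)%N
  else (30 * p.+1)%N.

Section Evaluate.
Variables (R : realType) (E : finType) (q : nat) (M : 'I_q -> matroid E).
Variables (f : {set E} -> R) (p : nat) (s : seq E).
Hypotheses (us : uniq s).

Local Notation state := (state R E).
Local Notation wp := (wp M f s).
Local Notation pos x := (index x s).

Definition enc (c : option E) : nat := oapp (fun y => pos y) (size s) c.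

Definition list_of (st : state) (l : nat) : seq nat :=
  mkseq (fun i => nmem st 15 (nmem st 13 l + i)%N) (nmem st 14 l).

(** The solution cell is modified during an evaluation and restored afterwards, hence the equality
    on all set cells. *)
Definition same_except (A : seq nat) (st st' : state) :=
  [/\ arrived st' = arrived st, shortlist st' = shortlist st,
      forall a i, a \notin A -> nmem st' a i = nmem st a i,
      forall a i, a != 0%N -> rmem st' a i = rmem st a i
    & forall a i, smem st' a i = smem st a i].

Lemma same_except_trans A st1 st2 st3 :
  same_except A st1 st2 -> same_except A st2 st3 -> same_except A st1 st3.
Proof.
move=> [a1 b1 c1 d1 e1] [a2 b2 c2 d2 e2]; split; rewrite ?a2 ?b2 //.
- by move=> a i aA; rewrite c2 ?c1.
- by move=> a i aA; rewrite d2 ?d1.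
- by move=> a i; rewrite e2 ?e1.
Qed.

Lemma same_except_sub A B st st' : {subset A <= B} ->
  same_except A st st' -> same_except B st st'.
Proof.
move=> AB [a1 b1 c1 d1 e1]; split=> // a i aB; apply: c1.
by apply: contra aB; exact: AB.
Qed.

Lemma item_at_enc (st : state) (c : option E) :
    (forall y, c = Some y -> y \in take (arrived st) s) ->
  item_at s st (enc c) = c.
Proof.
case: c => [y|] /= yt; rewrite /item_at.
  have /(_ y erefl) yts := yt.
  have pl : (pos y < arrived st)%N.
    by rewrite -in_take // (mem_take yts).
  have ys := mem_take yts.
  rewrite onthE /= (nth_map y); last by rewrite size_take_min leq_min pl index_mem.
  by rewrite nth_take // nth_index.
by rewrite onth_default // size_take; case: ltnP => // /ltnW.
Qed.

Definition acc_rep (st : state) (acc : R * option (seq (option E))) :=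
  rmem st 0 0 = acc.1 /\
  if acc.2 is Some c then nmem st 17 0 = 1%N /\
    forall j, (j < p)%N -> nmem st 12 j = enc (nth None c j)
  else nmem st 17 0 = 0%N.

Definition eval_ctx (S : seq E) (x : E) (st : state) :=
  [/\ nmem st 8 4 = pos x /\ nmem st 0 0 = size s,
      smem st 0 0 = [set y in S],
      {subset S <= take (arrived st) s} /\ x \in take (arrived st) s,
      x \notin S
    & (forall l, list_of st l = [seq pos y | y <- members M S l])
      /\ forall j, (j < p)%N -> nmem st 9 j = mat_at M x j].

Lemma eval_ctx_same S x st st' : same_except [:: 10; 11; 12; 17] st st' ->
  eval_ctx S x st -> eval_ctx S x st'.
Proof.
move=> [a1 b1 c1 d1 e1] [[h1 h1'] h2 [h3 h3'] h4 [h5 h6]].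
split; rewrite ?a1 ?e1 ?c1 //; split=> [l|j jp]; last by rewrite c1 // h6.
rewrite -h5 /list_of !c1 //; apply: eq_map => i; exact: c1.
Qed.

(** The trial is made in place and undone: removing [x] is exact because [x] is not in [S], and
    reinserting the deleted items is exact because all of them are. *)
Lemma try_swap_wp (S : seq E) (x : E) (c : seq (option E)) acc st :
    eval_ctx S x st -> size c = p ->
    (forall j, (j < p)%N -> nmem st 10 j = enc (nth None c j)) ->
    (forall y, Some y \in c -> y \in S) ->
    acc_rep st acc ->
  wp (try_swap p) (30 * p.+1)
    (fun st' => same_except [:: 12; 17] st st'
       /\ acc_rep st' (better_swap M f p S x acc c)) st.
Proof.
move=> [[X4 X0] Scell [Sarr xarr] xS [lst mats]] sc Yc cS [acc1 acc2].
pose same (st1 : state) := [/\ arrived st1 = arrived st, shortlist st1 = shortlist st,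
  rmem st1 = rmem st & forall a i, ~~ ((a == 0%N) && (i == 0%N)) -> smem st1 a i = smem st a i].
pose Inv1 j st1 := [/\ same st1, nmem st1 = nmem st &
  smem st1 0 0 = [set y in S | Some y \notin take j c]].
pose Q1 (st1 : state) := [/\ same st1, nmem st1 = nmem st & smem st1 0 0 = swapped S x c].
have itY (st1 : state) j : (j < p)%N -> arrived st1 = arrived st ->
    item_at s st1 (enc (nth None c j)) = nth None c j.
  move=> jp ar; apply: item_at_enc => y yc; rewrite ar; apply: Sarr; apply: cS.
  by rewrite -yc mem_nth // sc.
have itX (st1 : state) : arrived st1 = arrived st -> item_at s st1 (pos x) = Some x.
  by move=> ar; apply: (@item_at_enc st1 (Some x)) => y [<-]; rewrite ar.
have all_take (j : nat) y : (j < p)%N ->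
    (Some y \in take j.+1 c) = (Some y \in take j c) || (nth None c j == Some y).
  move=> jp; rewrite (take_nth None) ?sc // mem_rcons inE orbC; congr (_ || _).
  exact: eq_sym.
have take_all_c : take p c = c by rewrite -sc take_size.
eapply wp_cost.
- eapply (wp_seq (Q1 := Inv1 p)).
    apply: wp_cfor.
      split=> //; rewrite take0 Scell; apply/setP=> y; rewrite !inE.
      by rewrite in_nil andbT.
    move=> j st1 jp [[a1 b1 r1 o1] n1 S1]; apply: (wp_det (c := SDel _ _ _)) => //=.
    split=> //=; first by split=> //= a i ai; rewrite /upd (negPf ai) o1.
    rewrite /upd /= n1 Yc // itY // S1; apply/setP=> y.
    case e: (nth None c j) => [z|] /=; rewrite !inE all_take // e.
      rewrite negb_or (inj_eq Some_inj) eq_sym.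
      by case: (z == y); case: (y \in S); case: (Some y \in take j c).
    by rewrite (_ : (None == Some y) = false) // orbF.
  move=> st1 [sm1 n1 S1].
  eapply (wp_seq (Q1 := Q1)).
    apply: (wp_det (c := SIns _ _ _)) => //; have [a1 b1 r1 o1] := sm1.
    split=> //=; first by split=> //= a i ai; rewrite /upd (negPf ai) o1.
    rewrite /upd /= n1 X4 itX // S1 take_all_c /swapped setUC.
    by congr (_ :|: _); apply/setP=> y; rewrite !inE.
  move=> st2 {st1 sm1 n1 S1} [[a2 b2 r2 o2] n2 S2].
  pose same2 st1 := [/\ arrived st1 = arrived st, shortlist st1 = shortlist st,
    forall a i, ~~ ((a == 0%N) && (i == 1%N)) -> rmem st1 a i = rmem st a i,
    rmem st1 0 1 = f (swapped S x c) &
    forall a i, ~~ ((a == 0%N) && (i == 0%N)) -> smem st1 a i = smem st a i].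
  pose nsame (st1 : state) b := [/\ forall a i, a != 17%N -> nmem st1 a i = nmem st a i,
    nmem st1 17 0 = nmem st 17 0 & nmem st1 17 1 = nat_of_bool b].
  eapply (wp_seq (Q1 := fun st1 => [/\ same2 st1, nmem st1 = nmem st &
      smem st1 0 0 = swapped S x c])).
    apply: (wp_det (c := Value _ _ _ _)) => //; split=> //=.
    by split=> //= [a i ai|]; rewrite /upd ?(negPf ai) ?r2 //= S2.
  move=> st3 {st2 a2 b2 r2 o2 n2 S2} [sm3 n3 S3].
  eapply (wp_seq (Q1 := fun st1 => [/\ same2 st1, nsame st1 true &
      smem st1 0 0 = swapped S x c])).
    apply: (wp_det (c := NSet _ _ _)) => //; split=> //=.
    by split=> //= [a i ai|]; rewrite /upd ?(negPf ai) n3.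
  move=> st4 {st3 sm3 n3 S3} [sm4 n4 S4].
  eapply (wp_seq (Q1 := fun st1 => [/\ same2 st1, nsame st1 (swap_ok M p S x c) &
      smem st1 0 0 = swapped S x c])).
    apply: (wp_cfor (t := 4) (Inv := fun j st1 => [/\ same2 st1,
      nsame st1 (all (fun j => indep_query M (mat_at M x j) (swapped S x c)) (iota 0 j)) &
      smem st1 0 0 = swapped S x c])) => //.
    move=> j st1 jp [[a1 b1 r1 r1' o1] [m1 m2 m3] S1].
    apply: (wp_det (c := Seq _ _)) => //.
    have m9 : nmem st1 9 j = mat_at M x j by rewrite m1 // mats.
    rewrite -[in iota _ _]addn1 iotaD all_cat /= andbT add0n.
    rewrite /= {2 3}/upd /= m9 S1.
    case: (indep_query _ _ _); rewrite ?andbT ?andbF /=; split=> //; split=> //=.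
    - by move=> a i ai; rewrite /upd (negPf ai) m1.
    - by move=> a i ai; rewrite /upd (negPf ai) m1.
  move=> st5 {st4 sm4 n4 S4} [sm5 n5 S5].
  eapply (wp_seq (Q1 := fun st1 => [/\ same2 st1, nsame st1 (swap_ok M p S x c) &
      smem st1 0 0 = [set y in S | Some y \notin c]])).
    apply: (wp_det (c := SDel _ _ _)) => //; move: sm5 n5 => [a1 b1 r1 r1' o1] [m1 m2 m3].
    split=> //=; first by split=> //= a i ai; rewrite /upd (negPf ai) o1.
    rewrite /upd /= m1 // X4 itX //= S5; apply/setP=> y; rewrite !inE.
    by have [->|_] := eqVneq y x; rewrite //= (negPf xS).
  move=> st6 {st5 sm5 n5 S5} [sm6 n6 S6].
  eapply (wp_seq (Q1 := fun st1 => [/\ same2 st1, nsame st1 (swap_ok M p S x c) &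
      smem st1 0 0 = smem st 0 0])).
    eapply wp_post.
      apply: (wp_cfor (Inv := fun j st1 => [/\ same2 st1, nsame st1 (swap_ok M p S x c) &
        smem st1 0 0 = [set y in S | (Some y \notin c) || (Some y \in take j c)]])) => //.
        split=> //; rewrite S6; apply/setP=> y; rewrite !inE take0 in_nil orbF //.
      move=> j st1 jp [[a1 b1 r1 r1' o1] [m1 m2 m3] S1].
      apply: (wp_det (c := SIns _ _ _)) => //; split=> //=.
        by split=> //= a i ai; rewrite /upd (negPf ai) o1.
      rewrite /upd /= m1 // Yc // itY // S1; apply/setP=> y.
      case e: (nth None c j) => [z|] /=; rewrite !inE all_take // e.
        rewrite (inj_eq Some_inj) eq_sym; have [<-|_] := eqVneq z y; rewrite ?orbF // !orbT andbT.
        by rewrite cS // -e mem_nth // sc.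
      by rewrite (_ : (None == Some y) = false) // !orbF.
    move=> st' [sm ns Sc]; split=> //; rewrite Sc take_all_c Scell.
    by apply/setP=> y; rewrite !inE orNb andbT.
  move=> st7 {st6 sm6 n6 S6} [[a7 b7 r7 r7' o7] [m7 m7' m7''] S7].
  have se7 : same_except [:: 12; 17] st st7.
    split=> //.
    - by move=> a i; rewrite !inE negb_or => /andP[_ a17]; exact: m7.
    - by move=> a i a0; rewrite r7 // (negPf a0).
    - move=> a i; case ai: ((a == 0%N) && (i == 0%N)); last by rewrite o7 ?ai.
      by case/andP: ai => /eqP-> /eqP->.
  apply: (wp_if (t := (1 + (1 + (p * 2 + 1)).+1).+1)).
  have -> : beval st7 (BAnd (BLeN (NConst 1) 17.[: 1])
      (BNot (BLeR (RGet 0 (NConst 1)) (RGet 0 Z0))))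
      = swap_ok M p S x c && (acc.1 < f (swapped S x c)).
    rewrite /= m7'' r7' r7 // acc1 -ltNge; by case: swap_ok.
  rewrite /better_swap; case: ifP => _; last first.
    eapply wp_cost; [apply: (wp_det (c := Skip)) => // | by []].
    split=> //; split; first by rewrite r7.
    move: acc2; case: (acc.2) => [d|]; rewrite m7' //.
    by move=> [-> H]; split=> // j jp; rewrite m7 // H.
  eapply (wp_seq (Q1 := fun st1 => [/\ same_except [:: 12; 17] st st1,
      forall j, nmem st1 10 j = nmem st 10 j & rmem st1 0 0 = f (swapped S x c)])).
    apply: (wp_det (c := RSet _ _ _)) => //=; split=> //=.
    - have [? ? ? rr ?] := se7; split=> //= a i a0; rewrite /upd (negPf a0) /=; exact: rr.
    - by move=> j; rewrite m7.
  move=> st8 [se8 Y8 R8].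
  eapply (wp_seq (Q1 := fun st1 => [/\ same_except [:: 12; 17] st st1,
      nmem st1 17 0 = 1%N, forall j, nmem st1 10 j = nmem st 10 j &
      rmem st1 0 0 = f (swapped S x c)])).
    apply: (wp_det (c := NSet _ _ _)) => //=; split=> //=.
    have [? ? nn ? ?] := se8; split=> //= a i; rewrite !inE negb_or => /andP[a12 a17].
    by rewrite /upd (negPf a17) /= nn // !inE negb_or a12.
  move=> st9 [se9 F9 Y9 R9].
  eapply wp_post.
    apply: (wp_cfor (Inv := fun j st1 => [/\ same_except [:: 12; 17] st st1,
      nmem st1 17 0 = 1%N, forall j, nmem st1 10 j = nmem st 10 j,
      rmem st1 0 0 = f (swapped S x c) &
      forall i, (i < j)%N -> nmem st1 12 i = nmem st 10 i])) => //.
    move=> j st1 jp [se1 F1 Y1 R1 B1]; apply: (wp_det (c := NSet _ _ _)) => //=; split=> //=.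
      have [? ? nn ? ?] := se1; split=> //= a i; rewrite !inE negb_or => /andP[a12 a17].
      by rewrite /upd (negPf a12) /= nn // !inE negb_or a12.
    move=> i; rewrite ltnS leq_eqVlt /upd /= => /orP[/eqP->|ij]; first by rewrite eqxx Y1.
    by rewrite ltn_eqF // B1.
  move=> st' [se' F' _ R' B']; split=> //; split=> //=; split=> // j jp.
  by rewrite B' // Yc.
- by rewrite /=; lia.
Qed.

(** Turns the fold over a product of lists into the nested loops that the program runs. *)
Lemma foldl_choices (A T : Type) (g : A -> seq T -> A) (acc : A) (pre : seq T)
    (c : seq T) (cs : seq (seq T)) :
  foldl g acc [seq pre ++ z | z <- choices (c :: cs)] =
  foldl (fun a y => foldl g a [seq rcons pre y ++ z | z <- choices cs]) acc c.
Proof.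
rewrite /=; elim: c acc => //= y c IH acc.
rewrite map_cat foldl_cat IH -map_comp; congr (foldl _ (foldl _ _ _) _).
by apply: eq_map => z /=; rewrite cat_rcons.
Qed.

Lemma nth_map_enc (l : seq E) (i : nat) : (i < size l)%N ->
  nth 0%N [seq pos y | y <- l] i = enc (nth None (map Some l) i).
Proof. by elim: l i => // y l IH [|i] //= /IH. Qed.

Definition candidates (S : seq E) (x : E) (j : nat) : seq (option E) :=
  None :: map Some (members M S (mat_at M x j)).

(** Induction on the number [d] of inner loops, [pre] being the choices of the outer ones. Inner
    loops write arrays 10 and 11 only from index [j] on, so the choices and counters of the outer
    loops survive. *)
Lemma try_swaps_wp (S : seq E) (x : E) (K d j : nat) (pre : seq (option E)) acc st :
    (forall l, (size (members M S l) <= K)%N) ->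
    eval_ctx S x st -> size pre = j -> (j + d = p)%N ->
    (forall i, (i < j)%N -> nmem st 10 i = enc (nth None pre i)) ->
    (forall y, Some y \in pre -> y \in S) ->
    acc_rep st acc ->
  wp (try_swaps p d j) (swaps_cost p K d)
    (fun st' => [/\ same_except [:: 10; 11; 12; 17] st st',
       forall i, (i < j)%N -> nmem st' 10 i = nmem st 10 i,
       forall i, (i < j)%N -> nmem st' 11 i = nmem st 11 i
     & acc_rep st' (foldl (better_swap M f p S x) acc
         [seq pre ++ z | z <- choices [seq candidates S x i | i <- iota j d]])]) st.
Proof.
move=> szK; elim: d j pre acc st => [|d IH] j pre acc st ctx spre jd Ypre preS accst.
  rewrite addn0 in jd; rewrite /= cats0; rewrite jd in spre.
  eapply wp_post; first by apply: try_swap_wp ctx spre _ preS accst => i ip; apply: Ypre; rewrite jd.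
  move=> st' [se acc']; split=> //.
  - by apply: same_except_sub se => a; rewrite !inE => /orP[]->; rewrite ?orbT.
  - by have [_ _ nn _ _] := se => i _; rewrite nn.
  - by have [_ _ nn _ _] := se => i _; rewrite nn.
have jp : (j < p)%N by lia.
set mem := members M S (mat_at M x j).
pose F (a : R * option (seq (option E))) (y : option E) := foldl (better_swap M f p S x) a
  [seq rcons pre y ++ z | z <- choices [seq candidates S x i | i <- iota j.+1 d]].
rewrite [iota _ _]/= map_cons foldl_choices -/F.
pose Q (a : R * option (seq (option E))) (st' : state) :=
  [/\ same_except [:: 10; 11; 12; 17] st st',
       forall i, (i < j)%N -> nmem st' 10 i = nmem st 10 i,
       forall i, (i < j)%N -> nmem st' 11 i = nmem st 11 i
     & acc_rep st' a].
have setn st1 a b i v : Q a st1 -> (b \in [:: 10; 11])%N -> (j <= i)%N -> Q a (set_nmem st1 b i v).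
  move=> [[a1 s1 n1 r1 m1] Y1 I1 acc1] b1 ji; have bi i' : (i' < j)%N -> (i' == i) = false.
    by move=> lt; rewrite ltn_eqF // (leq_trans lt).
  split.
  - split=> //= a' i' a'A; rewrite /upd; case: eqP => [ab|_] /=; last exact: n1.
    by move: a'A b1; rewrite ab !inE => /norP[/negPf-> /norP[/negPf-> _]].
  - by move=> i' lt /=; rewrite /upd bi // andbF Y1.
  - by move=> i' lt /=; rewrite /upd bi // andbF I1.
  - have b1217 : (12 == b) = false /\ (17 == b) = false.
      by move: b1; rewrite !inE => /orP[]/eqP->.
    move: acc1; rewrite /acc_rep /= /upd !b1217.1 !b1217.2 /=; exact.
have rec st1 a y : Q a st1 -> (forall z, y = Some z -> z \in S) -> nmem st1 10 j = enc y ->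
    wp (try_swaps p d j.+1) (swaps_cost p K d) (fun st' => Q (F a y) st' /\ nmem st' 11 j = nmem st1 11 j) st1.
  move=> [se1 Y1 I1 acc1] yS Yj; eapply wp_post.
    apply: (IH j.+1 (rcons pre y) a st1) => //.
    - exact: eval_ctx_same se1 ctx.
    - by rewrite size_rcons spre.
    - by rewrite addSnnS.
    - move=> i; rewrite ltnS leq_eqVlt nth_rcons spre => /orP[/eqP->|ij].
        by rewrite ltnn eqxx.
      by rewrite ij Y1 // Ypre.
    - move=> z; rewrite mem_rcons inE => /orP[/eqP zy|]; last exact: preS.
      exact: yS.
  move=> st' [se2 Y2 I2 acc2]; split; last by rewrite I2.
  split=> //.
  - exact: same_except_trans se1 se2.
  - by move=> i ij; rewrite Y2 ?Y1 // ltnW.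
  - by move=> i ij; rewrite I2 ?I1 // ltnW.
have [[X4 X0] Scell [Sarr xarr] xS [lst mats]] := ctx.
have lj st1 a : Q a st1 -> [/\ nmem st1 9 j = mat_at M x j,
    nmem st1 14 (mat_at M x j) = size mem & forall i, (i < size mem)%N ->
    nmem st1 15 (nmem st1 13 (mat_at M x j) + i)%N = enc (nth None (map Some mem) i)].
  move=> [se1 _ _ _]; have [_ _ _ _ [lst1 mats1]] := eval_ctx_same se1 ctx.
  have := lst1 (mat_at M x j); rewrite -/mem => e; split; first exact: mats1.
    by have := congr1 size e; rewrite size_mkseq size_map.
  move=> i im; have := congr1 (nth 0%N ^~ i) e.
  have im' : (i < nmem st1 14 (mat_at M x j))%N.
    by have := congr1 size e; rewrite size_mkseq size_map => ->.
  by rewrite nth_mkseq // => ->; exact: nth_map_enc.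
eapply wp_cost.
eapply (wp_seq (Q1 := fun st1 => Q acc st1 /\ nmem st1 10 j = enc None)).
  apply: (wp_det (c := NSet _ _ _)) => //; split; last by rewrite /= /upd !eqxx.
  by apply: setn => //; split.
move=> st1 [Q1 Y1].
eapply (wp_seq (Q1 := Q (F acc None))).
  by eapply wp_post; [apply: (rec st1 acc None)|move=> st' []].
move=> st2 Q2.
eapply (wp_seq (Q1 := fun st1 => Q (F acc None) st1 /\ nmem st1 11 j = 0%N)).
  apply: (wp_det (c := NSet _ _ _)) => //; split; last by rewrite /= /upd !eqxx.
  exact: setn.
move=> st3 [Q3 I3].
eapply wp_post.
  apply: (wp_while (N := size mem) (t := fun=> (1 + (swaps_cost p K d + 1).+1).+1)
    (Inv := fun i st' => Q (foldl F (F acc None) (take i (map Some mem))) st' /\ nmem st' 11 j = i)).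
  - by rewrite take0.
  - move=> i st4 im [Q4 I4]; have [l9 l14 l15] := lj _ _ Q4; split.
      by rewrite /= l9 l14 I4 -ltnNge.
    rewrite (take_nth None) ?size_map // foldl_rcons.
    eapply (wp_seq (Q1 := fun st1 => [/\ Q (foldl F (F acc None) (take i (map Some mem))) st1,
       nmem st1 11 j = i & nmem st1 10 j = enc (nth None (map Some mem) i)])).
      apply: (wp_det (c := NSet _ _ _)) => //; split => //=.
        exact: setn.
      by rewrite /upd !eqxx l9 I4 l15.
    move=> st5 [Q5 I5 Y5].
    eapply (wp_seq (Q1 := fun st1 => Q (F (foldl F (F acc None) (take i (map Some mem))) (nth None (map Some mem) i)) st1 /\ nmem st1 11 j = i)).
      eapply wp_post; first apply: rec Q5 _ Y5.
        move=> z zi; have : Some z \in map Some mem by rewrite -zi mem_nth // size_map.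
        by case/mapP=> z' + [->]; rewrite mem_filter => /andP[].
      by move=> st' [? ->].
    move=> st6 [Q6 I6]; apply: (wp_det (c := NSet _ _ _)) => //; split; first exact: setn.
    by rewrite /= /upd !eqxx I6 addn1.
  - by move=> st4 [Q4 I4]; have [l9 l14 _] := lj _ _ Q4; rewrite /= l9 l14 I4 negbK.
move=> st' [Qs _]; move: Qs; rewrite -[size mem](size_map Some) take_size.
by case.
have := szK (mat_at M x j); rewrite -/mem sum_nat_const card_ord /=.
move: (swaps_cost p K d) (size mem) => a b bK.
by have := leq_mul bK (leqnn (a + 10)); lia.
Qed.

Definition solution_rep (S : seq E) (st : state) :=
  [/\ nmem st 0 0 = size s, smem st 0 0 = [set y in S],
      {subset S <= take (arrived st) s}
    & forall l, list_of st l = [seq pos y | y <- members M S l]].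

Lemma solution_rep_same S A st st' :
    0 \notin A -> 13 \notin A -> 14 \notin A -> 15 \notin A ->
    same_except A st st' -> solution_rep S st -> solution_rep S st'.
Proof.
move=> n0 n13 n14 n15 [a1 b1 c1 d1 e1] [h1 h2 h3 h5].
split; rewrite ?a1 ?e1 ?c1 // => l.
rewrite -h5 /list_of !c1 //; apply: eq_map => i; exact: c1.
Qed.

Lemma evaluate_wp (S : seq E) (x : E) (K : nat) st :
    (forall l, (size (members M S l) <= K)%N) ->
    solution_rep S st -> nmem st 8 4 = pos x -> x \in take (arrived st) s ->
    x \notin S ->
  wp (evaluate p) (swaps_cost p K p + 3 * p + 10)
    (fun st' => same_except [:: 9; 10; 11; 12; 17] st st'
      /\ acc_rep st' (best_swap M f p S x)) st.
Proof.
move=> szK rep X4 xarr xS.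
have keep st1 A : 9 \in A -> 8 \notin A -> 0 \notin A -> 13 \notin A -> 14 \notin A ->
    15 \notin A -> same_except A st st1 -> (forall j, (j < p)%N -> nmem st1 9 j = mat_at M x j) ->
    eval_ctx S x st1.
  move=> _ A8 A0 A13 A14 A15 se m9.
  have [h1 h2 h3 h5] := solution_rep_same A0 A13 A14 A15 se rep.
  have [a1 _ n1 _ _] := se.
  by split=> //; split=> //; rewrite ?n1 ?a1.
eapply wp_cost.
eapply (wp_seq (Q1 := fun st1 => same_except [:: 9] st st1 /\
    forall j, (j < p)%N -> nmem st1 9 j = mat_at M x j)).
  apply: (wp_cfor (Inv := fun j st1 => same_except [:: 9] st st1 /\
    forall i, (i < j)%N -> nmem st1 9 i = mat_at M x i)); first by split.
  move=> j st1 jp [[a1 b1 c1 d1 e1] m9]; apply: (wp_det (c := MatAt _ _ _ _)) => //; split.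
    split=> //= a i; rewrite inE => a9; rewrite /upd (negPf a9) /=.
    by apply: c1; rewrite inE.
  move=> i; rewrite ltnS leq_eqVlt /= /upd /= => /orP[/eqP->|ij]; last first.
    by rewrite ltn_eqF // m9.
  rewrite eqxx c1 // X4 (_ : item_at s st1 (pos x) = Some x) //.
  by apply: (@item_at_enc st1 (Some x)) => y [<-]; rewrite a1.
move=> st1 [se1 m9].
eapply (wp_seq (Q1 := fun st2 => [/\ same_except [:: 9] st st2,
    forall j, (j < p)%N -> nmem st2 9 j = mat_at M x j & rmem st2 0 0 = f [set y in S]])).
  apply: (wp_det (c := Value _ _ _ _)) => //; have [a1 b1 c1 d1 e1] := se1; split=> //=.
    split=> //= a i a0; rewrite /upd (negPf a0) /=; exact: d1.
  by rewrite /upd /= e1; have [_ -> _ _] := rep.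
move=> st2 [se2 m92 r2].
eapply (wp_seq (Q1 := fun st3 => [/\ same_except [:: 9; 17] st st3,
    forall j, (j < p)%N -> nmem st3 9 j = mat_at M x j & acc_rep st3 (f [set y in S], None)])).
  apply: (wp_det (c := NSet _ _ _)) => //; have [a1 b1 c1 d1 e1] := se2; split=> //=.
  split=> //= a i; rewrite !inE => /norP[a9 /negPf a17].
  by rewrite /upd a17 /= c1 // inE.
move=> st3 [se3 m93 acc3].
eapply wp_post.
  apply: (@try_swaps_wp S x K p 0 [::] _ st3 szK _ _ _ _ _ acc3) => //.
  exact: keep se3 m93.
move=> st' [se' _ _ acc']; split.
  apply: same_except_trans (same_except_sub _ se3) (same_except_sub _ se').
    by move=> a; rewrite !inE => /orP[]->; rewrite ?orbT.
  by move=> a; rewrite !inE => /or4P[]->; rewrite ?orbT.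
rewrite /best_swap /combos.
by move: acc'; rewrite (eq_map (g := id)) ?map_id.
rewrite /=; lia.
Qed.

End Evaluate.

(** * Updating the per-matroid lists of the solution *)

Definition compact : cmd :=
  NSet 8 (NConst 15) Z0 ;;
  NSet 8 (NConst 16) Z0 ;;
  While (BNot (BLeN (NGet 14 8.[: 17]) 8.[: 15]))
    (NSet 8 (NConst 18) (NGet 15 (NAdd (NGet 13 8.[: 17]) 8.[: 15])) ;;
     If (BLeN (NConst 1) (NGet 16 8.[: 18]))
        (NSet 15 (NAdd (NGet 13 8.[: 17]) 8.[: 16]) 8.[: 18] ;;
         NSet 8 (NConst 16) (NAdd 8.[: 16] (NConst 1)))
        Skip ;;
     NSet 8 (NConst 15) (NAdd 8.[: 15] (NConst 1))) ;;
  NSet 14 8.[: 17] 8.[: 16].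

(** Expressions have no products, so the list of matroid [l] cannot be placed at [l * n]. A block of
    [n] cells is allocated on first use from the pointer in register 13. Base address 0 means that
    there is no block yet, which is why the pointer starts at [n > 0]. *)
Definition append : cmd :=
  If (BLeN (NGet 13 8.[: 17]) Z0)
     (NSet 13 8.[: 17] 8.[: 13] ;; NSet 8 (NConst 13) (NAdd 8.[: 13] 0.[: 0]))
     Skip ;;
  NSet 15 (NAdd (NGet 13 8.[: 17]) (NGet 14 8.[: 17])) 8.[: 4] ;;
  NSet 14 8.[: 17] (NAdd (NGet 14 8.[: 17]) (NConst 1)).

Definition apply_swap (p : nat) : cmd :=
  cfor p (fun j => SDel 0 Z0 12.[: j] ;; NSet 16 12.[: j] Z0) ;;
  cfor p (fun j => cfor p (fun i =>
    NumMat 8 (NConst 14) 12.[: j] ;;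
    If (BLeN (NConst i.+1) 8.[: 14]) (MatAt 8 (NConst 17) 12.[: j] (NConst i) ;; compact)
       Skip)) ;;
  SIns 0 Z0 8.[: 4] ;;
  NSet 16 8.[: 4] (NConst 1) ;;
  NumMat 8 (NConst 14) 8.[: 4] ;;
  cfor p (fun j =>
    If (BLeN (NConst j.+1) 8.[: 14]) (MatAt 8 (NConst 17) 8.[: 4] (NConst j) ;; append)
       Skip).

Lemma other_cell (P : nat -> nat -> bool) (a i b k : nat) :
  P a i -> ~~ P b k -> (a == b) && (i == k) = false.
Proof. by move=> Pai; apply: contraNF => /andP[/eqP<- /eqP<-]. Qed.

Section Update.
Variables (R : realType) (E : finType) (q : nat) (M : 'I_q -> matroid E).
Variables (f : {set E} -> R) (p : nat) (s : seq E).
Hypotheses (us : uniq s) (sE : forall x, x \in s) (Mp : p_matchoid p M).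

Local Notation state := (state R E).
Local Notation wp := (wp M f s).
Local Notation pos x := (index x s).
Local Notation n := (size s).

Definition layout (st : state) :=
  [/\ forall l, nmem st 13 l = 0%N -> nmem st 14 l = 0%N,
      forall l, nmem st 13 l <> 0%N -> (nmem st 13 l + n <= nmem st 8 13)%N,
      forall l l', l <> l' -> nmem st 13 l <> 0%N -> nmem st 13 l' <> 0%N ->
        (nmem st 13 l + n <= nmem st 13 l')%N \/ (nmem st 13 l' + n <= nmem st 13 l)%N,
      (0 < nmem st 8 13)%N
    & forall l, (nmem st 14 l <= n)%N].

Definition untouched (a i : nat) : bool :=
  (a \notin [:: 8; 13; 14; 15; 16]) || ((a == 8) && (i \notin iota 13 6)).

Definition same_on (P : nat -> nat -> bool) (st st' : state) :=
  [/\ arrived st' = arrived st, shortlist st' = shortlist st,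
      rmem st' = rmem st & forall a i, P a i -> nmem st' a i = nmem st a i].

Lemma same_on_trans P st1 st2 st3 :
  same_on P st1 st2 -> same_on P st2 st3 -> same_on P st1 st3.
Proof.
move=> [a1 b1 c1 d1] [a2 b2 c2 d2]; split; rewrite ?a2 ?b2 ?c2 //.
by move=> a i P1; rewrite d2 ?d1.
Qed.

Lemma same_on_sub (P P' : nat -> nat -> bool) st st' :
  (forall a i, P' a i -> P a i) -> same_on P st st' -> same_on P' st st'.
Proof. by move=> PP [a1 b1 c1 d1]; split=> // a i /PP; exact: d1. Qed.

Definition keep_compact (a i : nat) : bool :=
  (a \notin [:: 8; 14; 15]) || ((a == 8) && (i \notin [:: 15; 16; 18])).

(** The list is filtered in place: the write index never passes the read index ([done_le]), so every
    cell is read before it is overwritten. *)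
Lemma compact_wp (st : state) (l K : nat) :
    layout st -> nmem st 8 17 = l -> (nmem st 14 l <= K)%N ->
  wp compact (10 * K + 10) (fun st' =>
    [/\ same_on keep_compact st st' /\ smem st' = smem st, layout st',
        list_of st' l = [seq t <- list_of st l | (0 < nmem st 16 t)%N]
      & forall l', l' <> l -> list_of st' l' = list_of st l']) st.
Proof.
move=> lay l17 lK; set L := list_of st l.
have szL : size L = nmem st 14 l by rewrite size_mkseq.
pose done i := [seq t <- take i L | (0 < nmem st 16 t)%N].
have done_le i : (size (done i) <= i)%N.
  by rewrite size_filter; apply: leq_trans (count_size _ _) _; rewrite size_take_min geq_minl.
pose B := nmem st 13 l.
pose Inv i (st1 : state) :=
  [/\ same_on keep_compact st st1 /\ smem st1 = smem st,
      nmem st1 8 15 = i /\ nmem st1 8 16 = size (done i),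
      nmem st1 14 = nmem st 14,
      forall j, (j < size (done i))%N -> nmem st1 15 (B + j)%N = nth 0%N (done i) j
    & forall c, (c < B)%N \/ (B + i <= c)%N -> nmem st1 15 c = nmem st 15 c].
eapply wp_cost.
eapply (wp_seq (Q1 := fun st1 => [/\ same_on keep_compact st st1 /\ smem st1 = smem st,
   nmem st1 8 15 = 0%N, nmem st1 14 = nmem st 14 & nmem st1 15 = nmem st 15])).
  apply: (wp_det (c := NSet _ _ _)) => //; split=> //=; split=> //; split=> //= a i kc.
  by rewrite /upd (other_cell kc).
move=> st1 [[[a1 b1 c1 d1] e1] f1 g1 h1].
eapply (wp_seq (Q1 := Inv 0%N)).
  apply: (wp_det (c := NSet _ _ _)) => //; split=> //=.
  - split=> //; split=> //= a i kc; by rewrite /upd (other_cell kc) // d1.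
  - by rewrite /done take0.
  - by rewrite /done take0.
  - by move=> c _; rewrite /upd /= h1.
move=> st2 I2.
eapply (wp_seq (Q1 := Inv (size L))).
  apply: (wp_while (t := fun=> 8%N)) => //; last first.
    move=> st3 [[[a3 b3 c3 d3] e3] [i3 w3] g3 _ _].
    have d17 : nmem st3 8 17 = l by rewrite d3.
    by rewrite /= d17 g3 i3 szL negbK.
  move=> i st3 iL [[[a3 b3 c3 d3] e3] [i3 w3] g3 h3 o3]; split.
    have d17 : nmem st3 8 17 = l by rewrite d3.
    by rewrite /= d17 g3 i3 -szL -ltnNge.
  set y := nth 0%N L i.
  have y3 : nmem st3 15 (B + i)%N = y.
    by rewrite o3; [rewrite /y nth_mkseq // -szL | right].
  have d17 : nmem st3 8 17 = l by rewrite d3.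
  have d13 l' : nmem st3 13 l' = nmem st 13 l' by rewrite d3.
  have d16 t : nmem st3 16 t = nmem st 16 t by rewrite d3.
  have doneS : done i.+1 = if (0 < nmem st 16 y)%N then rcons (done i) y else done i.
    by rewrite /done (take_nth 0%N) // filter_rcons.
  apply: (wp_det (c := Seq _ _)) => //.
  rewrite /= /upd /= d17 d13 -/B i3 y3 d16.
  case: ifP => yin; rewrite /Inv doneS yin /=; rewrite /= /upd /= ?d17 ?d13 -/B ?w3 ?i3 ?addn1.
  - split=> //; rewrite ?size_rcons //.
    + by split=> //; split=> //= a j kc; rewrite /upd !(other_cell kc) // d3.
    + move=> j; rewrite ltnS eqn_add2l nth_rcons.
      by case: ltngtP => // jlt _; rewrite h3.
    + move=> c cB; rewrite (_ : (c == _) = false) ?o3 //; last first.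
        by apply/eqP; have := done_le i; lia.
      by case: cB; [left | right; lia].
  - split=> //.
    + by split=> //; split=> //= a j kc; rewrite /upd !(other_cell kc) // d3.
    + by move=> c cB; apply: o3; case: cB; [left | right; lia].
move=> st3 [[[a3 b3 c3 d3] e3] [i3 w3] g3 h3 o3].
apply: (wp_det (c := NSet _ _ _)) => //.
have d17 : nmem st3 8 17 = l by rewrite d3.
have doneE : done (size L) = [seq t <- L | (0 < nmem st 16 t)%N] by rewrite /done take_size.
rewrite doneE in w3 h3.
have [l1 l2 l3 l4 l5] := lay.
split=> //=.
- by split=> //; split=> //= a j kc; rewrite /upd !(other_cell kc) // d3.
- have d13 l' : nmem st3 13 l' = nmem st 13 l' by rewrite d3.
  have d813 : nmem st3 8 13 = nmem st 8 13 by rewrite d3.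
  split; rewrite /= /upd /= ?d813 //.
  + move=> l'; rewrite d13 d17 g3 w3; case: eqP => [->|_]; last exact: l1.
    by move=> /l1; rewrite -szL => /eqP; rewrite size_eq0 => /eqP ->.
  + by move=> l'; rewrite d13; exact: l2.
  + by move=> l' l'' ll; rewrite !d13; exact: l3.
  + move=> l'; rewrite d17 g3 w3; case: eqP => [_|_]; last exact: l5.
    by apply: leq_trans (l5 l); rewrite -szL size_filter count_size.
- rewrite /list_of /= /upd /= d17 eqxx w3 d3 // -/B.
  apply: (@eq_from_nth _ 0%N); rewrite size_mkseq // => j jlt.
  by rewrite nth_mkseq // h3.
- move=> l' ll'; rewrite /list_of /= /upd /= d17; case: eqP => // _; rewrite g3 d3 //.
  apply/eq_in_map => j; rewrite mem_iota add0n => /= jlt.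
  apply: o3; have B' : nmem st 13 l' <> 0%N by move=> /l1 e; rewrite e in jlt.
  (* A list without a block is empty, so nothing has been written. *)
  have [B0|B0] := eqVneq B 0%N.
    by right; rewrite B0 szL (l1 l B0) add0n.
  have := l5 l'; have := l5 l; rewrite -szL => Ln l'n.
  by case: (l3 l l' (fun e => ll' (esym e)) (elimN eqP B0) B') => ?; [right | left]; lia.
rewrite /= sum_nat_const card_ord -szL in lK *; lia.
Qed.

Definition keep_append (a i : nat) : bool :=
  (a \notin [:: 8; 13; 14; 15]) || ((a == 8) && (i != 13)).

Lemma append_wp (st : state) (l : nat) :
    layout st -> nmem st 8 17 = l -> (nmem st 14 l < n)%N -> nmem st 0 0 = n ->
  wp append 10 (fun st' =>
    [/\ same_on keep_append st st' /\ smem st' = smem st, layout st',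
        list_of st' l = rcons (list_of st l) (nmem st 8 4)
      & forall l', l' <> l -> list_of st' l' = list_of st l']) st.
Proof.
move=> [l1 l2 l3 l4 l5] l17 ln n0.
pose Q (st1 : state) := [/\ same_on keep_append st st1 /\ smem st1 = smem st, layout st1,
  forall l', list_of st1 l' = list_of st l',
  nmem st1 14 = nmem st 14 & nmem st1 13 l <> 0%N].
eapply wp_cost.
eapply (wp_seq (Q1 := Q)).
  apply: (wp_det (c := If _ _ _)) => //=; rewrite l17 leqn0; case: eqP => B0; last by split.
  split=> //=.
  - by split=> //; split=> //= a i ka; rewrite /upd !(other_cell ka).
  - split; rewrite /= /upd /= ?l17 ?n0 //.
    + move=> l'; case: eqP => [->|_]; last exact: l1.
      by move=> e; rewrite e in l4.
    + move=> l'; case: eqP => [_|_ /l2 h]; first by rewrite leqnn.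
      by apply: leq_trans h _; rewrite leq_addr.
    + move=> l' l'' ll; case: eqP => [e1|_]; case: eqP => [e2|_]; first by rewrite e1 e2 in ll.
      * by move=> _ /l2; right.
      * by move=> /l2; left.
      * exact: l3.
    + by rewrite addn_gt0 l4.
  - move=> l'; rewrite /list_of /= /upd /= ?l17; case: (l' =P l) => [->|//].
    by rewrite (l1 l B0).
  - by rewrite /upd /= eqxx => e; rewrite e in l4.
move=> st1 [[[a1 b1 c1 d1] e1] [m1 m2 m3 m4 m5] lst1 n14 B1].
have d17 : nmem st1 8 17 = l by rewrite d1.
eapply (wp_seq (Q1 := fun st2 => [/\ same_on keep_append st st2 /\ smem st2 = smem st,
    nmem st2 13 = nmem st1 13, nmem st2 14 = nmem st1 14, nmem st2 8 13 = nmem st1 8 13 &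
    forall c, nmem st2 15 c = if c == (nmem st1 13 l + nmem st1 14 l)%N then nmem st 8 4
       else nmem st1 15 c])).
  apply: (wp_det (c := NSet _ _ _)) => //; split=> //=.
  - split=> //; split=> //= a i ka; by rewrite /upd !(other_cell ka) // d1.
  - by move=> c; rewrite /upd /= d17 (d1 8 4).
move=> st2 [[[a2 b2 c2 d2] e2] f2 g2 h2 i2].
have d17' : nmem st2 8 17 = l by rewrite d2.
apply: (wp_det (c := NSet _ _ _)) => //; split=> //=.
- split=> //; split=> //= a i ka; by rewrite /upd !(other_cell ka) // d2.
- split=> //=; rewrite /= /upd /= ?f2 ?g2 ?h2 //.
  + by move=> l'; rewrite d17'; case: eqP => [->/B1//|_]; exact: m1.
  + by move=> l'; rewrite d17'; case: eqP => [_|_]; [rewrite addn1 n14 | exact: m5].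
- rewrite -lst1 /list_of /= /upd /= d17' eqxx f2 g2 addn1 /mkseq.
  rewrite -[in iota _ _]addn1 iotaD map_cat /= -cats1 add0n i2 eqxx; congr (_ ++ _).
  apply/eq_in_map => j; rewrite mem_iota add0n => /= jlt.
  by rewrite i2 eqn_add2l ltn_eqF.
- move=> l' ll'; rewrite -lst1 /list_of /= /upd /= d17' f2 g2; case: eqP => // _.
  apply/eq_in_map => j; rewrite mem_iota add0n => /= jlt; rewrite i2.
  case: eqP => // e; have B' : nmem st1 13 l' <> 0%N by move=> /m1 e'; rewrite e' in jlt.
  have := m5 l'; have := m5 l; rewrite n14 in e jlt *.
  by case: (m3 l l' (fun e => ll' (esym e)) B1 B') => ?; lia.
by [].
Qed.

Definition full_rep (S : seq E) (st : state) :=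
  [/\ solution_rep M s S st, layout st,
      forall y, nmem st 16 (pos y) = (y \in S) & uniq S].

Lemma uniq_matroids_of (x : E) : uniq (matroids_of M x).
Proof. by rewrite (map_inj_uniq (@ord_inj q)) filter_uniq ?enum_uniq. Qed.

Lemma same_on_lists (P : nat -> nat -> bool) st st' l : (forall i, P 13 i) -> (forall i, P 14 i) ->
  (forall i, P 15 i) -> same_on P st st' -> list_of st' l = list_of st l.
Proof.
move=> p13 p14 p15 [_ _ _ d]; rewrite /list_of !d //.
by apply: eq_map => i; rewrite d.
Qed.

Lemma same_on_layout (P : nat -> nat -> bool) st st' : (forall i, P 13 i) -> (forall i, P 14 i) ->
  P 8 13 -> same_on P st st' -> layout st -> layout st'.
Proof.
move=> p13 p14 p8 [_ _ _ d] [l1 l2 l3 l4 l5]; split; rewrite ?d //.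
- by move=> l; rewrite !d //; exact: l1.
- by move=> l; rewrite !d //; exact: l2.
- by move=> l l'; rewrite !d //; exact: l3.
- by move=> l; rewrite !d //; exact: l5.
Qed.

Lemma apply_swap_wp (S : seq E) (x : E) (c : seq (option E)) (K : nat) (st : state) :
    (forall l, (size (members M S l) <= K)%N) ->
    full_rep S st -> nmem st 8 4 = pos x -> x \in take (arrived st) s -> x \notin S ->
    size c = p -> (forall y, Some y \in c -> y \in S) ->
    (forall j, (j < p)%N -> nmem st 12 j = enc s (nth None c j)) ->
  wp (apply_swap p) (p * (p * (10 * K + 20) + 40) + 40)
    (fun st' => same_on untouched st st'
       /\ full_rep (rcons [seq y <- S | Some y \notin c] x) st') st.
Proof.
move=> szK [[n0 Scell Sarr lst] lay IN uS] X4 xarr xS sc cS Bc.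
set S1 := [seq y <- S | Some y \notin c].
have itB (st1 : state) j : (j < p)%N -> arrived st1 = arrived st ->
    item_at s st1 (enc s (nth None c j)) = nth None c j.
  move=> jp ar; apply: item_at_enc => y yc; rewrite ar; apply: Sarr; apply: cS.
  by rewrite -yc mem_nth // sc.
have itX (st1 : state) : arrived st1 = arrived st -> item_at s st1 (pos x) = Some x.
  by move=> ar; apply: (@item_at_enc _ _ s st1 (Some x)) => y [<-]; rewrite ar.
have all_take (j : nat) y : (j < p)%N ->
    (Some y \in take j.+1 c) = (Some y \in take j c) || (nth None c j == Some y).
  move=> jp; rewrite (take_nth None) ?sc // mem_rcons inE orbC; congr (_ || _).
  exact: eq_sym.
pose flags (b : pred E) (st1 : state) := [/\ forall y, nmem st1 16 (pos y) = b y &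
    smem st1 0 0 = [set y | b y]].
pose P16 (a i : nat) := a != 16%N.
pose b1 y := y \in S1.
eapply wp_cost.
eapply (wp_seq (Q1 := fun st1 => same_on P16 st st1 /\ flags b1 st1)).
  eapply wp_post.
    apply: (wp_cfor (t := 3) (Inv := fun j st1 => same_on P16 st st1 /\
      flags (fun y => (y \in S) && (Some y \notin take j c)) st1)).
      split; first by split.
      split=> [y|]; first by rewrite IN take0 in_nil andbT.
      by rewrite Scell; apply/setP=> y; rewrite !inE take0 in_nil andbT.
    move=> j st1 jp [[a1 b1' c1 d1] [F1 S1']].
    apply: (wp_det (c := Seq _ _)) => //; split.
      by split=> //= a i a16; rewrite /upd (negPf a16) /= d1.
    have e12 : nmem st1 12 j = enc s (nth None c j) by rewrite d1 // Bc.
    split=> [y|] /=.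
      rewrite /upd /= e12 F1; case e: (nth None c j) => [z|] /=; rewrite all_take // e.
        rewrite (inj_eq Some_inj); case: (z =P y) => [->|zy]; first by rewrite eqxx orbT andbF.
        rewrite orbF; case: eqP => // /(congr1 (nth z s)).
        by rewrite !nth_index // => e'; case: zy.
      rewrite (_ : (None == Some y) = false) // orbF ltn_eqF // index_mem; exact: sE.
    rewrite /upd /= e12 itB // S1'; apply/setP=> y.
    case e: (nth None c j) => [z|] /=; rewrite !inE all_take // e.
      rewrite negb_or (inj_eq Some_inj) eq_sym.
      by case: (z == y); case: (y \in S); case: (Some y \in take j c).
    by rewrite (_ : (None == Some y) = false) // orbF.
  move=> st' [se [F1 F2]]; split=> //.
  have ef y : (y \in S) && (Some y \notin take p c) = b1 y.
    by rewrite /b1 mem_filter andbC -sc take_size.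
  by split=> [y|]; rewrite ?F1 ?F2 ?ef //; apply/setP=> y; rewrite !inE ef.
move=> st1 [se1 [F1 C1]].
have lay1 : layout st1 by apply: same_on_layout se1 lay.
have lst1 l : list_of st1 l = [seq pos y | y <- members M S l].
  by rewrite (same_on_lists _ _ _ _ se1).
pose tgt l := [seq pos y | y <- members M S1 l].
have filt (st2 : state) l : (forall y, nmem st2 16 (pos y) = b1 y) ->
    [seq t <- [seq pos y | y <- members M S l] | (0 < nmem st2 16 t)%N] = tgt l.
  move=> F; rewrite filter_map /tgt; congr map; rewrite /members /S1 -!filter_predI.
  apply: eq_in_filter => y yS /=; rewrite F /b1 mem_filter yS andbT andbC.
  by case: (Some y \notin c).
(* Filtering twice is harmless; a list is compacted again when several deleted items share its
   matroid. *)
have filt2 (st2 : state) l : (forall y, nmem st2 16 (pos y) = b1 y) ->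
    [seq t <- tgt l | (0 < nmem st2 16 t)%N] = tgt l.
  move=> F; rewrite filter_map /tgt; congr map; rewrite /members -filter_predI.
  by apply: eq_in_filter => y yS /=; rewrite F /b1 yS.
have szt l : (size (tgt l) <= K)%N.
  rewrite size_map; apply: leq_trans (szK l).
  by rewrite /members /S1 -filter_predI !size_filter; apply: sub_count => y /= /andP[].
pose P8 (a i : nat) := (a \notin [:: 8; 14; 15]) || ((a == 8) && (i \notin iota 14 5)).
(* During the compactions each list is either the old one or final; [D] marks the pairs of a deleted
   item and one of its matroids already treated. *)
pose InvC (D : nat -> nat -> Prop) (st2 : state) :=
  [/\ same_on P8 st1 st2 /\ smem st2 = smem st1, layout st2,
     forall l, list_of st2 l = [seq pos y | y <- members M S l] \/ list_of st2 l = tgt l &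
     forall j i y, D j i -> nth None c j = Some y -> (i < size (matroids_of M y))%N ->
       list_of st2 (mat_at M y i) = tgt (mat_at M y i)].
have lenK (st2 : state) l D : InvC D st2 -> (nmem st2 14 l <= K)%N.
  move=> [_ _ /(_ l) [] e _]; have := congr1 size e; rewrite size_mkseq => ->.
    by rewrite size_map.
  exact: szt.
have InvC_sub D D' (st2 : state) : (forall j i, D' j i -> D j i) -> InvC D st2 -> InvC D' st2.
  by move=> DD [h1 h2 h3 h4]; split=> // j i y /DD; exact: h4.
eapply (wp_seq (Q1 := InvC (fun j _ => (j < p)%N))).
  apply: (wp_cfor (t := p * (10 * K + 17).+1 + 1) (Inv := fun j => InvC (fun j' _ => (j' < j)%N))).
    by split=> // l; left.
  move=> j st2 jp I2; eapply wp_post.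
    apply: (wp_cfor (t := 10 * K + 17)
      (Inv := fun i => InvC (fun j' i' => (j' < j)%N \/ j' = j /\ (i' < i)%N))).
      by apply: InvC_sub I2 => j' i' [|[]].
    move=> i st3 ip I3; have [[[a3 b3 c3 d3] e3] lay3 ls3 h3] := I3.
    have [a0 b0 c0 d0] := se1.
    have e12 : nmem st3 12 j = enc s (nth None c j) by rewrite d3 // d0 // Bc.
    have ar3 : arrived st3 = arrived st by rewrite a3 a0.
    set D := fun j' i' => (j' < j)%N \/ j' = j /\ (i' < i)%N in I3.
    pose P14 (a k : nat) := (a != 8) || (k \notin [:: 14; 17]).
    have keep_step (st4 : state) : same_on P14 st3 st4 -> smem st4 = smem st3 -> InvC D st4.
      move=> se4 sm4; have ls4 l : list_of st4 l = list_of st3 l by apply: same_on_lists se4.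
      split.
      - split; last by rewrite sm4.
        apply: (@same_on_trans P8 st1 st3 st4); first by split.
        apply: same_on_sub se4 => a k; rewrite /P8 /P14 !inE; lia.
      - by apply: same_on_layout se4 lay3.
      - by move=> l; rewrite ls4.
      - by move=> j' i' y Dj' nj si; rewrite ls4; exact: h3 Dj' nj si.
    eapply wp_cost.
    eapply (wp_seq (Q1 := fun st4 => [/\ InvC D st4,
        nmem st4 8 14 = size (matroids_of_opt M (nth None c j)) & nmem st4 12 j = enc s (nth None c j)])).
      apply: (wp_det (c := NumMat _ _ _)) => //; split=> //=; last by rewrite /upd /= e12 itB.
      apply: keep_step => //; split=> //= a k; rewrite /P14 /upd inE.
      by case: (a == 8) => //=; case: (k == 14).
    move=> st4 [I4 s4 m12]; apply: (wp_if (t := (1 + (10 * K + 10)).+1)).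
    rewrite /= s4; case: ifP => isz; last first.
      apply: (wp_cost (t := cost Skip)) => //; apply: wp_det => //=.
      have [h1 h2 h3' h4] := I4; split=> // j' i' y Dj nj si.
      case: Dj => [j'j|[ej]]; first by apply: h4 nj si; left.
      rewrite ltnS leq_eqVlt => /orP[/eqP ei|i'i]; last by apply: h4 nj si; right.
      by move: isz; rewrite -ej nj /= -ei si.
    case ej: (nth None c j) isz => [y|] //= isz.
    have [[[a4 b4 c4 d4] e4] lay4 ls4 h4] := I4.
    have IN4 y' : nmem st4 16 (pos y') = b1 y' by rewrite d4.
    eapply (wp_seq (Q1 := fun st5 => [/\ same_on P14 st4 st5, smem st5 = smem st4 & nmem st5 8 17 = mat_at M y i])).
      apply: (wp_det (c := MatAt _ _ _ _)) => //; split=> //=.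
        split=> //= a k; rewrite /P14 /upd !inE; case: (a == 8) => //=.
        by case: (k == 17); rewrite ?orbT.
      have ar4 : arrived st4 = arrived st by rewrite a4 a0.
      by rewrite /upd /= m12 itB // ej.
    move=> st5 [se5 sm5 l17].
    have lay5 : layout st5 by apply: same_on_layout se5 lay4.
    have ls5 l : list_of st5 l = list_of st4 l by apply: same_on_lists se5.
    have K5 : (nmem st5 14 (mat_at M y i) <= K)%N.
      by have [_ _ _ ->] := se5 => //; exact: lenK I4.
    eapply wp_post; first exact: compact_wp lay5 l17 K5.
    move=> st6 [[se6 sm6] lay6 hl hl'].
    have IN5 y' : nmem st5 16 (pos y') = b1 y' by have [_ _ _ ->] := se5.
    have hl2 : list_of st6 (mat_at M y i) = tgt (mat_at M y i).
      by rewrite hl ls5; case: (ls4 (mat_at M y i)) => ->; [apply: filt | apply: filt2].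
    split=> //.
    + split; last by rewrite sm6 sm5.
      apply: (@same_on_trans P8 st1 st4 st6); first by split.
      apply: same_on_trans (same_on_sub _ se5) (same_on_sub _ se6) => a k.
        by rewrite /P8 /P14 !inE; lia.
      by rewrite /P8 /keep_compact !inE; lia.
    + move=> l; case: (eqVneq l (mat_at M y i)) => [->|/eqP ll]; first by right.
      by rewrite hl' // ls5.
    + move=> j' i' y' Dj nj si; case: (eqVneq (mat_at M y' i') (mat_at M y i)) => [->//|/eqP ll].
      rewrite hl' // ls5; apply: (h4 _ _ _ _ nj si); case: Dj => [|[ej' ]]; first by left.
      rewrite ltnS leq_eqVlt => /orP[/eqP ei|]; last by right.
      by case: ll; move: nj; rewrite ej' ej ei => -[->].
    rewrite /=; lia.
  move=> st' I'; have [h1 h2 h3 h4] := I'; split=> // j' i' y.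
  rewrite ltnS leq_eqVlt => /orP[/eqP ->|lt] nj si; apply: (h4 _ _ _ _ nj si); [right | by left].
  by split=> //; apply: leq_trans si (size_matroids_of Mp y).
move=> st2 [[se2 sm2] lay2 ls2 h2].
(* A list containing no deleted item already equals its filtered version. *)
have ls2' l : list_of st2 l = tgt l.
  have [/hasP[y yS /andP[yc ly]]|/hasPn no] :=
      boolP (has (fun y => (Some y \in c) && (l \in matroids_of M y)) S).
    have jy : (index (Some y) c < p)%N by rewrite -sc index_mem.
    have iy : (index l (matroids_of M y) < size (matroids_of M y))%N by rewrite index_mem.
    by have := h2 _ _ _ jy (nth_index None yc) iy; rewrite /mat_at nth_index.
  case: (ls2 l) => // ->; rewrite /tgt; congr map; rewrite /members /S1 -filter_predI.
  apply: eq_in_filter => y yS /=; have := no y yS.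
  by case: (Some y \in c); case: (l \in matroids_of M y).
have [a1 b1' c1 d1] := se1; have [a2 b2 c2 d2] := se2.
have ar2 : arrived st2 = arrived st by rewrite a2 a1.
have st02 : same_on untouched st st2.
  apply: same_on_trans (same_on_sub _ se1) (same_on_sub _ se2) => a i.
    by rewrite /untouched /P16 !inE; lia.
  by rewrite /untouched /P8 !inE; lia.
have X42 : nmem st2 8 4 = pos x by rewrite d2 // d1.
pose b2' y := (y == x) || b1 y.
eapply (wp_seq (Q1 := fun st3 => same_on (fun _ _ => true) st2 st3 /\ smem st3 0 0 = [set y | b2' y])).
  apply: (wp_det (c := SIns _ _ _)) => //; split=> //=.
  by rewrite /upd /= X42 itX // sm2 C1; apply/setP=> y; rewrite !inE orbC.
move=> st3 [se3 C3]; have [a3 b3 c3 d3] := se3.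
have ls3 l : list_of st3 l = tgt l by rewrite (same_on_lists _ _ _ _ se3).
have lay3 : layout st3 by apply: same_on_layout se3 lay2.
pose P1614 (a i : nat) := (a != 16) && ((a != 8) || (i != 14)).
eapply (wp_seq (Q1 := fun st4 => same_on P16 st3 st4 /\ flags b2' st4)).
  apply: (wp_det (c := NSet _ _ _)) => //; split=> //=.
    by split=> //= a i a16; rewrite /upd (negPf a16).
  split=> //= y; rewrite /upd /= d3 // X42 /b2'.
  case: (eqVneq y x) => [->|yx]; first by rewrite eqxx.
  case: eqP => [/(congr1 (nth x s))|_]; last by rewrite d3 // d2 // F1.
  by rewrite !nth_index // => e; rewrite e eqxx in yx.
move=> st4 [se4 [F4 C4]].
eapply (wp_seq (Q1 := fun st5 => [/\ same_on P1614 st3 st5, flags b2' st5 &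
     nmem st5 8 14 = size (matroids_of M x)])).
  apply: (wp_det (c := NumMat _ _ _)) => //; have [a4 b4 c4 d4] := se4.
  have X44 : nmem st4 8 4 = pos x by rewrite d4 // d3.
  split=> //=; last by rewrite /upd /= X44 itX // a4 a3.
  split=> //= a i /andP[a16 a8]; rewrite /upd -d4 //.
  by case: (a == 8) a8 => //= /negPf ->.
move=> st5 [se5 [F5 C5] s5]; have [a5 b5 c5 d5] := se5.
have ls5 l : list_of st5 l = tgt l by rewrite (same_on_lists _ _ _ _ se5) // => i.
have lay5 : layout st5 by apply: same_on_layout se5 lay3.
pose P9' (a i : nat) := (a \notin [:: 8; 13; 14; 15]) || ((a == 8) && (i != 13) && (i != 17)).
pose InvA j (st6 : state) := [/\ same_on P9' st5 st6 /\ smem st6 = smem st5, layout st6 &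
   forall l, list_of st6 l = tgt l ++ if l \in take j (matroids_of M x) then [:: pos x] else [::]].
(* [x] differs from the remaining items, which leaves room for it in a block of [n] cells. *)
have tgtn l : (size (tgt l) < n)%N.
  rewrite size_map; apply: (@leq_ltn_trans (size S1)).
    by rewrite size_filter count_size.
  apply: (@leq_trans (size (x :: S1))) => //.
  by apply: uniq_leq_size => //=; rewrite filter_uniq // mem_filter (negPf xS) andbF.
eapply wp_post.
  apply: (wp_cfor (t := 15) (Inv := InvA)).
    by split=> // l; rewrite take0 in_nil cats0.
  move=> j st6 jp [[se6 sm6] lay6 ls6]; have [a6 b6 c6 d6] := se6.
  have X46 : nmem st6 8 4 = pos x by rewrite d6 // d5 // d3.
  have s6 : nmem st6 8 14 = size (matroids_of M x) by rewrite d6.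
  have ar6 : arrived st6 = arrived st by rewrite a6 a5 a3.
  apply: (wp_if (t := 14)); rewrite /= s6; case: ifP => js; last first.
    apply: (wp_cost (t := cost Skip)) => //; apply: wp_det => //; split=> // l.
    have sj : (size (matroids_of M x) <= j)%N by rewrite leqNgt js.
    by rewrite ls6 !take_oversize // ltnW.
  eapply wp_cost.
  eapply (wp_seq (Q1 := fun st7 => [/\ same_on (fun a i => (a != 8) || (i != 17)) st6 st7,
      smem st7 = smem st6 & nmem st7 8 17 = mat_at M x j])).
    apply: (wp_det (c := MatAt _ _ _ _)) => //; split=> //=.
      split=> //= a i; rewrite /upd; by case: (a == 8) => //= /negPf ->.
    by rewrite /upd /= X46 itX.
  move=> st7 [se7 sm7 l17]; have [a7 b7 c7 d7] := se7.
  have ls7 l : list_of st7 l = list_of st6 l by apply: same_on_lists se7.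
  have lay7 : layout st7 by apply: same_on_layout se7 lay6.
  have fresh : mat_at M x j \notin take j (matroids_of M x).
    apply/negP => /(nthP 0%N)[i]; rewrite size_take js => ij.
    rewrite nth_take // /mat_at => /eqP; rewrite nth_uniq ?uniq_matroids_of //.
      by rewrite ltn_eqF.
    exact: ltn_trans ij js.
  have ln7 : (nmem st7 14 (mat_at M x j) < n)%N.
    have := congr1 size (ls7 (mat_at M x j)); rewrite size_mkseq => ->.
    by rewrite ls6 (negPf fresh) cats0.
  have n07 : nmem st7 0 0 = n by rewrite d7 // d6 // d5 // d3 // d2 // d1.
  eapply wp_post; first exact: append_wp lay7 l17 ln7 n07.
  move=> st8 [[se8 sm8] lay8 hl hl']; split=> //.
    split; last by rewrite sm8 sm7.
    apply: same_on_trans se6 _.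
    apply: same_on_trans (same_on_sub _ se7) (same_on_sub _ se8) => a i.
      by rewrite /P9' !inE; lia.
    by rewrite /P9' /keep_append !inE; lia.
  move=> l; rewrite (take_nth 0%N) // mem_rcons inE -/(mat_at M x j).
  case: (l =P mat_at M x j) => [->|ll] /=; last by rewrite hl' // ls7 ls6.
  by rewrite hl ls7 ls6 (negPf fresh) cats0 -cats1 d7 // X46.
  by [].
move=> st6 [[se6 sm6] lay6 ls6]; have [a6 b6 c6 d6] := se6.
have ar6 : arrived st6 = arrived st by rewrite a6 a5 a3.
have se06 : same_on untouched st st6.
  apply: same_on_trans st02 _.
  apply: same_on_trans (same_on_sub _ se3) _ => //.
  apply: same_on_trans (same_on_sub _ se5) (same_on_sub _ se6) => a i.
    by rewrite /untouched /P1614 !inE; lia.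
  by rewrite /untouched /P9' !inE; lia.
have memS' y : (y \in rcons S1 x) = b2' y by rewrite mem_rcons inE.
split=> //; split=> //.
- have [_ _ _ d06] := se06; split.
  + by rewrite d06.
  + by rewrite sm6 C5; apply/setP=> y; rewrite !inE memS'.
  + move=> y; rewrite ar6 memS' => /orP[/eqP->//|]; rewrite /b1 mem_filter => /andP[_]; exact: Sarr.
  + move=> l; rewrite ls6 /tgt /members filter_rcons.
    rewrite take_oversize ?(size_matroids_of Mp) //.
    by case: ifP => _; rewrite ?cats0 // map_rcons cats1.
- by move=> y; rewrite d6 // F5 memS'.
- by rewrite rcons_uniq filter_uniq // mem_filter (negPf xS) andbF.
rewrite /=; lia.
Qed.

End Update.

(** * Processing a slot *)

(* The evaluated candidate does not beat the one recorded in registers [wx]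
   (position plus one, 0 for none), [wr] (rank) and real cell [(1, wv)]. *)
Definition beaten_by (wx wr wv : nat) : bexp :=
  BAnd (BLeN (NConst 1) 8.[: wx])
    (BAnd (BLeR (RGet 0 Z0) (RGet 1 (NConst wv)))
       (BNot (BAnd (BLeR (RGet 1 (NConst wv)) (RGet 0 Z0)) (BLeN 8.[: wr] 8.[: 2])))).

Definition arrive (p : nat) : cmd :=
  Next ;;
  NSet 8 (NConst 4) 8.[: 3] ;;
  NSet 8 (NConst 3) (NAdd 8.[: 3] (NConst 1)) ;;
  evaluate p.

Definition track : cmd :=
  If (BNot (beaten_by 8 9 0))
     (NSet 8 (NConst 8) (NAdd 8.[: 4] (NConst 1)) ;;
      RSet 1 Z0 (RGet 0 Z0) ;;
      NSet 8 (NConst 9) 8.[: 2])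
     Skip ;;
  NSet 8 (NConst 2) (NGet 6 (NSub 8.[: 2] (NConst 1))).

Definition shortlist_item (L : nat) : cmd :=
  If (BAnd (BLeN (NAdd 8.[: 12] (NConst 1)) (NConst L)) (BNot (beaten_by 10 11 1)))
     (Accept ;; NSet 8 (NConst 12) (NAdd 8.[: 12] (NConst 1)))
     Skip.

(** Registers of array 8: 1 is the slot, 2 the bucket entry plus one, 3 the number of arrivals, 4
    the candidate, 5 the older winner plus one, 8 and 9 the running winner plus one and its rank, 10
    and 11 the same for the winner of the sample, 12 the number of items accepted in the slot. The
    selected item is evaluated once more at the end, because natural array 12 only serves the
    deletions of the latest evaluation. *)
Definition process_slot_cmd (p L : nat) : cmd :=
  (NSet 8 (NConst 8) Z0 ;;
   NSet 8 (NConst 12) Z0 ;;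
   NSet 8 (NConst 2) (NGet 4 8.[: 1])) ;;
  While (BLeN (NConst 1) 8.[: 2]) (arrive p ;; track) ;;
  (NSet 8 (NConst 10) 8.[: 8] ;;
   NSet 8 (NConst 11) 8.[: 9] ;;
   RSet 1 (NConst 1) (RGet 1 Z0) ;;
   NSet 8 (NConst 2) (NGet 5 8.[: 1])) ;;
  While (BLeN (NConst 1) 8.[: 2]) (arrive p ;; shortlist_item L ;; track) ;;
  (NSet 8 (NConst 5) (NGet 7 (NGet 3 8.[: 1])) ;;
   NSet 7 8.[: 1] 8.[: 8]) ;;
  If (BAnd (BLeN (NConst 1) 8.[: 5]) (BLeN (NGet 16 (NSub 8.[: 5] (NConst 1))) Z0))
     (NSet 8 (NConst 4) (NSub 8.[: 5] (NConst 1)) ;;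
      evaluate p ;;
      If (BNot (BAnd (BLeN (NConst 1) 8.[: 8]) (BLeR (RGet 0 Z0) (RGet 1 Z0))))
         (NSet 8 (NConst 8) 8.[: 5])
         Skip)
     Skip ;;
  If (BLeN (NConst 1) 8.[: 8])
     (NSet 8 (NConst 4) (NSub 8.[: 8] (NConst 1)) ;;
      evaluate p ;;
      If (BLeN (NConst 1) 17.[: 0]) (apply_swap p) Skip)
     Skip ;;
  NSet 8 (NConst 1) (NAdd 8.[: 1] (NConst 1)).

Lemma minn_step (L a : nat) : (minn L a + (minn L a < L))%N = minn L a.+1.
Proof. by case: leqP; lia. Qed.

(** Entries are shifted by one and 0 marks the end, so that blank memory holds empty lists. *)
Fixpoint chain (nx : nat -> nat) (h : nat) (l : seq nat) : Prop :=
  if l is t :: l' then h = t.+1 /\ chain nx (nx t) l' else h = 0%N.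

Section Slot.
Variables (R : realType) (E : finType) (q : nat) (M : 'I_q -> matroid E).
Variables (f : {set E} -> R) (p : nat) (vid : E -> nat) (s : seq E).
Hypotheses (us : uniq s) (sE : forall x, x \in s) (Mp : p_matchoid p M).
Hypothesis vid_inj : injective vid.

Local Notation state := (state R E).
Local Notation wp := (wp M f s).
Local Notation pos x := (index x s).
Local Notation n := (size s).
Local Notation val := (swap_value M f p).
Local Notation beats := (beats M f p vid).
Local Notation winner := (winner M f p vid).
Local Notation full_rep := (@full_rep R E q M s).

Definition eval_cost (K : nat) : nat := (swaps_cost p K p + 3 * p + 10)%N.

Lemma full_rep_same A S st st' :
    all (fun a => a \notin A) [:: 0; 8; 13; 14; 15; 16] ->
    same_except A st st' -> full_rep S st -> full_rep S st'.
Proof.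
move=> /and5P[A0 A8 A13 A14 /and3P[A15 A16 _]] se [rep [l1 l2 l3 l4 l5] IN uS].
have [a1 b1 c1 d1 e1] := se.
split=> //; first exact: solution_rep_same se rep.
  split; rewrite ?c1 //.
  - by move=> l; rewrite !c1 //; exact: l1.
  - by move=> l; rewrite !c1 //; exact: l2.
  - by move=> l l'; rewrite !c1 //; exact: l3.
  - by move=> l; rewrite !c1 //; exact: l5.
by move=> y; rewrite c1 // IN.
Qed.

Definition rep_cell (a i : nat) : bool :=
  (a \in [:: 0; 13; 14; 15; 16]%N) || ((a == 8) && (i == 13)).

Lemma full_rep_mem S st st' :
    (arrived st <= arrived st')%N ->
    (forall a i, rep_cell a i -> nmem st' a i = nmem st a i) ->
    smem st' 0 0 = smem st 0 0 ->
  full_rep S st -> full_rep S st'.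
Proof.
move=> ar c1 e1 [[h1 h2 h3 h4] [l1 l2 l3 l4 l5] IN uS]; split=> //.
- split; rewrite ?c1 ?e1 //.
    by move=> y /h3; rewrite !in_take //; move=> h; apply: leq_trans h ar.
  move=> l; rewrite -h4 /list_of !c1 //; apply: eq_map => i; exact: c1.
- split; rewrite ?c1 //.
  - by move=> l; rewrite !c1 //; exact: l1.
  - by move=> l; rewrite !c1 //; exact: l2.
  - by move=> l l'; rewrite !c1 //; exact: l3.
  - by move=> l; rewrite !c1 //; exact: l5.
- by move=> y; rewrite c1 // IN.
Qed.

Definition cand_rep (S : seq E) (wx wr wv : nat) (o : option E) (st : state) :=
  if o is Some y then
    [/\ nmem st 8 wx = (pos y).+1, nmem st 8 wr = (vid y).+1 & rmem st 1 wv = val S y]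
  else nmem st 8 wx = 0%N.

Lemma beaten_byE S wx wr wv o x st :
    cand_rep S wx wr wv o st -> rmem st 0 0 = val S x -> nmem st 8 2 = (vid x).+1 ->
  beval st (BNot (beaten_by wx wr wv)) = oapp (beats S x) true o.
Proof.
case: o => [y|] /=; last by move=> ->.
move=> [-> -> ->] -> -> /=; rewrite /beats ltnS negb_and negbK -ltNge.
by case: ltgtP.
Qed.

Section Fixed.
Variables (S : seq E) (K : nat).
Hypothesis szK : forall l, (size (members M S l) <= K)%N.

Lemma evaluate_full (x : E) st :
    full_rep S st -> nmem st 8 4 = pos x -> x \in take (arrived st) s -> x \notin S ->
  wp (evaluate p) (eval_cost K) (fun st' =>
    [/\ same_except [:: 9; 10; 11; 12; 17] st st', full_rep S st',
       rmem st' 0 0 = val S x & acc_rep p s st' (best_swap M f p S x)]) st.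
Proof.
move=> rep X4 xarr xS; have [r1 r2 r3 r4] := rep.
eapply wp_post; first exact: evaluate_wp szK r1 X4 xarr xS.
move=> st' [se acc]; split=> //; last by have [] := acc.
exact: full_rep_same se rep.
Qed.

Definition arrive_frame (st st' : state) :=
  [/\ arrived st' = (arrived st).+1, shortlist st' = shortlist st,
     forall a i, a \notin [:: 9; 10; 11; 12; 17] -> (a != 8) || (i \notin [:: 3; 4]) ->
       nmem st' a i = nmem st a i
   & forall i, rmem st' 1 i = rmem st 1 i].

Lemma arrive_wp (x : E) (rest : seq E) st :
    full_rep S st -> nmem st 8 3 = arrived st -> drop (arrived st) s = x :: rest ->
    x \notin S ->
  wp (arrive p) (eval_cost K + 6) (fun st' =>
    [/\ arrive_frame st st', full_rep S st', nmem st' 8 3 = arrived st' /\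
        drop (arrived st') s = rest,
        nmem st' 8 4 = pos x /\ arrived st' = (pos x).+1 & rmem st' 0 0 = val S x]) st.
Proof.
move=> rep ar dr xS.
have an : (arrived st < n)%N.
  by have := congr1 size dr; rewrite size_drop /=; lia.
have posx : pos x = arrived st.
  have := drop_nth x an; rewrite dr => -[-> _]; exact: index_uniq.
have rest' : drop (arrived st).+1 s = rest.
  by have := drop_nth x an; rewrite dr => -[_ <-].
eapply wp_cost.
eapply (wp_seq (Q1 := fun st1 => [/\ arrived st1 = (arrived st).+1,
  shortlist st1 = shortlist st, nmem st1 = nmem st, rmem st1 = rmem st & smem st1 = smem st])).
  apply: (wp_det (c := Next)) => //; split=> //=; exact/minn_idPl.
move=> st1 [a1 b1 c1 d1 e1].
eapply (wp_seq (Q1 := fun st1 => [/\ arrive_frame st st1, nmem st1 8 3 = arrived st,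
  nmem st1 8 4 = pos x & smem st1 = smem st])).
  apply: (wp_det (c := NSet _ _ _)) => //; split=> //=; last 2 first.
  - by rewrite /upd /= c1.
  - by rewrite /upd /= c1 posx.
  split=> //=; last by move=> i; rewrite d1.
  move=> a i aA; rewrite /upd c1; case: (a == 8) => //=; rewrite !inE.
  by move=> /norP[_ /negPf ->].
move=> st2 {st1 a1 b1 c1 d1 e1} [[a2 b2 c2 d2] r2 X2 e2].
eapply (wp_seq (Q1 := fun st1 => [/\ arrive_frame st st1, nmem st1 8 3 = arrived st1,
  nmem st1 8 4 = pos x & smem st1 = smem st])).
  apply: (wp_det (c := NSet _ _ _)) => //; split=> //=; last by rewrite /upd /= r2 addn1 a2.
  split=> //= a i aA ai; rewrite /upd -c2 //; move: ai; case: (a == 8) => //=.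
  by rewrite !inE => /norP[/negPf -> _].
move=> st3 {st2 a2 b2 c2 d2 r2 X2 e2} [[a3 b3 c3 d3] r3 X3 e3].
have rep3 : full_rep S st3.
  apply: full_rep_mem rep; rewrite ?a3 ?e3 //.
  move=> a i h; apply: c3; move: h; clear; rewrite /rep_cell !inE; lia.
have x3 : x \in take (arrived st3) s by rewrite in_take // posx a3.
eapply wp_post; first exact: evaluate_full rep3 X3 x3 xS.
move=> st4 [[a4 b4 c4 d4 e4] rep4 v4 _]; split=> //.
- split; rewrite ?a4 ?b4 //.
    by move=> a i aA ai; rewrite c4 // c3.
  by move=> i; rewrite d4 // d3.
- by rewrite c4 // r3 a4 a3.
- by rewrite c4 // a4 a3; split=> //; rewrite posx.
by rewrite /=; lia.
Qed.

Definition loop_cell (a i : nat) : bool :=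
  (a \notin [:: 9; 10; 11; 12; 17]) && ((a != 8) || (i \notin [:: 2; 3; 4; 8; 9; 12])).

Definition better_of (o : option E) (x : E) : option E :=
  if o is Some y then if beats S x y then Some x else Some y else Some x.

Lemma track_wp (x : E) o st :
    cand_rep S 8 9 0 o st -> rmem st 0 0 = val S x -> nmem st 8 2 = (vid x).+1 ->
    nmem st 8 4 = pos x ->
  wp track 10 (fun st' =>
    [/\ cand_rep S 8 9 0 (better_of o x) st', nmem st' 8 2 = nmem st 6 (vid x),
       arrived st' = arrived st /\ shortlist st' = shortlist st /\ smem st' = smem st,
       forall a i, (a != 8) || (i \notin [:: 2; 8; 9]) -> nmem st' a i = nmem st a i
     & forall i, i != 0%N -> rmem st' 1 i = rmem st 1 i]) st.
Proof.
move=> co vx px X4; have tst := beaten_byE co vx px.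
eapply wp_cost.
eapply (wp_seq (Q1 := fun st' => [/\ cand_rep S 8 9 0 (better_of o x) st', nmem st' 8 2 = nmem st 8 2,
       arrived st' = arrived st /\ shortlist st' = shortlist st /\ smem st' = smem st,
       forall a i, (a != 8) || (i \notin [:: 8; 9]) -> nmem st' a i = nmem st a i
     & forall i, i != 0%N -> rmem st' 1 i = rmem st 1 i])).
  apply: (wp_if (t := 5)); rewrite tst; case tt: (oapp (beats S x) true o).
    have -> : better_of o x = Some x.
      by rewrite /better_of; case: (o) tt => //= y ->.
    apply: (wp_det (c := Seq _ _)) => //; split=> //=.
    - by rewrite /upd /= X4 px addn1.
    - move=> a i; rewrite /upd; case: (a == 8) => //=; rewrite !inE.
      by move=> /norP[/negPf -> /negPf ->].
    - by move=> i /negPf i0; rewrite /upd /= i0.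
  have ob : better_of o x = o by rewrite /better_of; case: (o) tt => //= y ->.
  by rewrite ob; apply: (wp_cost (t := cost Skip)) => //; apply: wp_det.
move=> st1 [co1 p1 [a1 [b1 e1]] c1 d1].
apply: (wp_det (c := NSet _ _ _)) => //; split=> //=.
- by rewrite /upd /= p1 px subn1 c1.
- move=> a i ai; rewrite /upd -c1; last by move: ai; clear; rewrite !inE; lia.
  by move: ai; case: (a == 8) => //=; rewrite !inE => /norP[/negPf ->].
by [].
Qed.

Definition phase_frame (st st' : state) :=
  (forall a i, loop_cell a i -> nmem st' a i = nmem st a i) /\ rmem st' 1 1 = rmem st 1 1.

Lemma winner_rcons done x :
  winner S [set y in rcons done x] = better_of (winner S [set y in done]) x.
Proof.
rewrite /better_of -winner_setU1 //; congr winner; apply/setP=> y.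
by rewrite !inE mem_rcons inE.
Qed.

Lemma winner_nil : winner S [set y in [::]] = None.
Proof.
suff -> : [set y in [::]] = set0 :> {set E} by rewrite winner0.
by apply/setP=> y; rewrite !inE.
Qed.

Lemma sample_wp (xs rest : seq E) st :
    full_rep S st -> nmem st 8 3 = arrived st -> drop (arrived st) s = xs ++ rest ->
    (forall x, x \in xs -> x \notin S) ->
    chain (nmem st 6) (nmem st 8 2) (map vid xs) ->
    cand_rep S 8 9 0 None st ->
  wp (While (BLeN (NConst 1) 8.[: 2]) (arrive p ;; track))
    (size xs * (eval_cost K + 20) + 1)
    (fun st' => [/\ full_rep S st', nmem st' 8 3 = arrived st' /\ drop (arrived st') s = rest,
       cand_rep S 8 9 0 (winner S [set y in xs]) st', shortlist st' = shortlist st /\ nmem st' 8 12 = nmem st 8 12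
     & phase_frame st st']) st.
Proof.
move=> rep ar dr xS ch c0.
pose Inv (done todo : seq E) (st' : state) :=
  [/\ full_rep S st' /\ (forall x, x \in todo -> x \notin S),
     nmem st' 8 3 = arrived st' /\ drop (arrived st') s = todo ++ rest,
     cand_rep S 8 9 0 (winner S [set y in done]) st',
     [/\ shortlist st' = shortlist st, nmem st' 8 12 = nmem st 8 12 &
         chain (nmem st 6) (nmem st' 8 2) (map vid todo)]
   & phase_frame st st'].
eapply wp_post; first eapply wp_cost.
  apply: (wp_while_seq (t := eval_cost K + 18) (Inv := Inv) (xs := xs)).
  - by split=> //; rewrite winner_nil.
  - move=> done x todo st1 [[rep1 tS] [ar1 dr1] co1 [sl1 k1 [p1 ch1]] [fr1 fr1']].
    split; first by rewrite /= p1.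
    have xS1 : x \notin S by apply: tS; rewrite inE eqxx.
    eapply wp_cost.
    eapply wp_seq; first exact: (arrive_wp rep1 ar1 dr1 xS1).
    move=> st2 [[a2 b2 c2 d2] rep2 [ar2 dr2] [X2 _] v2].
    have co2 : cand_rep S 8 9 0 (winner S [set y in done]) st2.
      by move: co1; rewrite /cand_rep; case: winner => [y|]; rewrite ?c2 ?d2.
    have p2 : nmem st2 8 2 = (vid x).+1 by rewrite c2.
    eapply wp_post; first exact: track_wp co2 v2 p2 X2.
    move=> st3 [co3 p3 [a3 [b3 e3]] c3 d3]; split.
    + split; last by move=> y yt; apply: tS; rewrite inE yt orbT.
      apply: full_rep_mem rep2; rewrite ?a3 ?e3 // => a i h; apply: c3; move: h; clear.
      by rewrite /rep_cell !inE; lia.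
    + by rewrite c3 // a3.
    + by rewrite winner_rcons.
    + rewrite b3 b2 c3 // c2 // p3 c2 //; split=> //.
      by rewrite fr1.
    + split; last by rewrite d3 // d2.
      move=> a i lc; rewrite c3; last by move: lc; clear; rewrite /loop_cell !inE; lia.
      by rewrite c2 ?fr1 //; move: lc; clear; rewrite /loop_cell !inE; lia.
    + rewrite /=; lia.
  - by move=> done st1 [_ _ _ [_ _ p1] _]; rewrite /= p1.
  - lia.
by move=> st' [[rep' _] [ar' dr'] co' [sl' k' _] fr']; split.
Qed.

Definition passing (th : option E) (l : seq E) : {set E} :=
  [set y in l | oapp (beats S y) true th].

Lemma shortlist_item_wp (L : nat) (th : option E) (x : E) st :
    cand_rep S 10 11 1 th st -> rmem st 0 0 = val S x -> nmem st 8 2 = (vid x).+1 ->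
    arrived st = (pos x).+1 ->
    let tk := (nmem st 8 12 < L)%N && oapp (beats S x) true th in
  wp (shortlist_item L) 10 (fun st' =>
    [/\ nmem st' 8 12 = (nmem st 8 12 + tk)%N,
       shortlist st' = shortlist st :|: (if tk then [set x] else set0),
       [/\ arrived st' = arrived st, smem st' = smem st & rmem st' = rmem st]
     & forall a i, (a != 8) || (i != 12) -> nmem st' a i = nmem st a i]) st.
Proof.
move=> cth vx px ax tk; have tst := beaten_byE cth vx px.
apply: (wp_if (t := 9)).
have -> : beval st (BAnd (BLeN (NAdd 8.[: 12] (NConst 1)) (NConst L)) (BNot (beaten_by 10 11 1))) = tk.
  by rewrite /tk -tst /= addn1.
have tx : x \in take (arrived st) s by rewrite in_take // ax.
case: tk; last first.
  apply: (wp_cost (t := cost Skip)) => //; apply: wp_det => //=.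
  by split=> //; rewrite ?addn0 ?setU0.
apply: (wp_cost (t := cost (Accept ;; NSet 8 (NConst 12) (NAdd 8.[: 12] (NConst 1))))) => //.
apply: wp_det => //; split=> //=.
- rewrite /current_item ax /= (_ : item_at s st (pos x) = Some x) //.
  by apply: (@item_at_enc _ _ s st (Some x)) => y [<-].
- by move=> a i; rewrite /upd; case: (a == 8) => //= /negPf ->.
Qed.

(** The counter equals the minimum of [L] and the number of items that have passed the threshold. So
    the shortlist grows by at most [L], and if no more than [L] items pass, none is turned away. *)
Lemma rest_wp (L : nat) (th : option E) (xs ys rest : seq E) st :
    full_rep S st -> nmem st 8 3 = arrived st -> drop (arrived st) s = ys ++ rest ->
    (forall x, x \in ys -> x \notin S) -> uniq ys ->
    chain (nmem st 6) (nmem st 8 2) (map vid ys) ->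
    cand_rep S 8 9 0 (winner S [set y in xs]) st -> cand_rep S 10 11 1 th st ->
    nmem st 8 12 = 0%N ->
  wp (While (BLeN (NConst 1) 8.[: 2]) (arrive p ;; shortlist_item L ;; track))
    (size ys * (eval_cost K + 40) + 1)
    (fun st' => [/\ full_rep S st', nmem st' 8 3 = arrived st' /\ drop (arrived st') s = rest,
       cand_rep S 8 9 0 (winner S [set y in xs ++ ys]) st',
       [/\ shortlist st \subset shortlist st',
           (#|shortlist st'| <= #|shortlist st| + L)%N &
           (#|passing th ys| <= L)%N -> passing th ys \subset shortlist st']
     & forall a i, loop_cell a i -> nmem st' a i = nmem st a i]) st.
Proof.
move=> rep ar dr xS uys ch c0 cth k0.
pose Inv (done todo : seq E) (st' : state) :=
  [/\ full_rep S st' /\ (forall x, x \in todo -> x \notin S) /\ uniq (done ++ todo),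
     nmem st' 8 3 = arrived st' /\ drop (arrived st') s = todo ++ rest,
     cand_rep S 8 9 0 (winner S [set y in xs ++ done]) st' /\ cand_rep S 10 11 1 th st',
     [/\ nmem st' 8 12 = minn L #|passing th done|,
         shortlist st \subset shortlist st',
         (#|shortlist st'| <= #|shortlist st| + nmem st' 8 12)%N,
         ((#|passing th done| <= L)%N -> passing th done \subset shortlist st') &
         chain (nmem st 6) (nmem st' 8 2) (map vid todo)]
   & forall a i, loop_cell a i -> nmem st' a i = nmem st a i].
eapply wp_post; first eapply wp_cost.
  apply: (wp_while_seq (t := eval_cost K + 30) (Inv := Inv) (xs := ys)).
  - have p0 : passing th [::] = set0 by apply/setP=> y; rewrite !inE.
    split=> //; rewrite ?cats0 //; split=> //; rewrite ?p0 ?cards0 ?minn0 ?sub0set //.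
    by rewrite leq_addr.
  - move=> done x todo st1 [[rep1 [tS uq]] [ar1 dr1] [co1 ct1] [k1 ss1 sz1 in1 [p1 ch1]] fr1].
    split; first by rewrite /= p1.
    have xS1 : x \notin S by apply: tS; rewrite inE eqxx.
    eapply wp_cost.
    eapply wp_seq; first exact: (arrive_wp rep1 ar1 dr1 xS1).
    move=> st2 [[a2 b2 c2 d2] rep2 [ar2 dr2] [X2 px2] v2].
    have co2 : cand_rep S 8 9 0 (winner S [set y in xs ++ done]) st2.
      by move: co1; rewrite /cand_rep; case: winner => [y|]; rewrite ?c2 ?d2.
    have ct2 : cand_rep S 10 11 1 th st2.
      by move: ct1; rewrite /cand_rep; case: (th) => [y|]; rewrite ?c2 ?d2.
    have p2 : nmem st2 8 2 = (vid x).+1 by rewrite c2.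
    eapply wp_seq; first exact: (shortlist_item_wp L ct2 v2 p2 px2).
    rewrite (c2 8 12) //; set tk := (_ && _).
    move=> st3 [k3 sl3 [a3 e3 d3] c3].
    have co3 : cand_rep S 8 9 0 (winner S [set y in xs ++ done]) st3.
      by move: co2; rewrite /cand_rep d3; case: winner => [y|]; rewrite ?c3.
    have ct3 : cand_rep S 10 11 1 th st3.
      by move: ct2; rewrite /cand_rep d3; case: (th) => [y|]; rewrite ?c3.
    have p3 : nmem st3 8 2 = (vid x).+1 by rewrite c3.
    have X3 : nmem st3 8 4 = pos x by rewrite c3.
    have v3 : rmem st3 0 0 = val S x by rewrite d3.
    eapply wp_post; first exact: track_wp co3 v3 p3 X3.
    move=> st4 [co4 p4 [a4 [b4 e4]] c4 d4].
    have xdone : x \notin done.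
      by move: uq; rewrite cat_uniq => /and3P[_ /norP[]].
    have xnp : x \notin passing th done by rewrite inE (negPf xdone).
    have passS : passing th (rcons done x) =
        if oapp (beats S x) true th then x |: passing th done else passing th done.
      apply/setP=> y; rewrite !inE mem_rcons inE.
      case: (eqVneq y x) => [->|yx] /=; last first.
        by case: ifP => _; rewrite !inE ?(negPf yx).
      by case: ifP => h; rewrite !inE ?eqxx // (negPf xdone).
    have k4 : nmem st4 8 12 = (nmem st1 8 12 + tk)%N by rewrite c4.
    split.
    + split; [|split].
      * apply: full_rep_mem rep2; rewrite ?a4 ?a3 ?e4 ?e3 // => a i h.
        by rewrite c4 ?c3 //; move: h; clear; rewrite /rep_cell !inE; lia.
      * by move=> y yt; apply: tS; rewrite inE yt orbT.
      * by rewrite cat_rcons.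
    + by rewrite c4 // c3 // a4 a3.
    + rewrite -rcons_cat winner_rcons; split=> //.
      by move: ct3; rewrite /cand_rep; case: (th) => [y|]; rewrite ?c4 ?d4.
    + split.
      * rewrite k4 passS k1 /tk k1; case: (oapp _ _ _); last by rewrite andbF addn0.
        by rewrite cardsU1 xnp andbT add1n minn_step.
      * by rewrite b4 sl3 b2; apply: subset_trans ss1 (subsetUl _ _).
      * rewrite k4 b4 sl3 b2; apply: leq_trans (leq_card_setU _ _).1 _.
        by rewrite addnA leq_add //; case: (tk); rewrite ?cards1 ?cards0.
      * rewrite passS b4 sl3 b2; case tt: (oapp _ _ _) => pL; last first.
          by apply: subset_trans (in1 pL) (subsetUl _ _).
        move: pL; rewrite cardsU1 xnp add1n => pL.
        have -> : tk by rewrite /tk tt k1 andbT (leq_ltn_trans (geq_minr _ _)).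
        by rewrite subUset subsetUr; apply: subset_trans (in1 (ltnW pL)) (subsetUl _ _).
      * by rewrite p4 c3 // c2 // fr1.
    + move=> a i lc; rewrite c4 ?c3 ?c2 ?fr1 //; move: lc; clear; rewrite /loop_cell !inE; lia.
    rewrite /=; lia.
  - by move=> done st1 [_ _ _ [_ _ _ _ p1] _]; rewrite /= p1.
  - lia.
move=> st' [[rep' _] [ar' dr'] [co' _] [k' ss' sz' in' _] fr']; split=> //; split=> //.
by apply: leq_trans sz' _; rewrite leq_add2l k' geq_minl.
Qed.

End Fixed.

End Slot.

Lemma choices_mem (T : eqType) (cs : seq (seq T)) (c : seq T) :
  c \in choices cs -> all2 (fun y l => y \in l) c cs.
Proof.
elim: cs c => [|l cs IH] c /=; first by rewrite inE => /eqP->.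
by move=> /flattenP[_ /mapP[y yl ->] /mapP[z /IH zcs ->]] /=; rewrite yl.
Qed.

Lemma best_swap_in (R : realType) (E : finType) (q : nat) (M : 'I_q -> matroid E)
    (f : {set E} -> R) (p : nat) (S : seq E) (x : E) c :
  (best_swap M f p S x).2 = Some c ->
  size c = p /\ forall y, Some y \in c -> y \in S.
Proof.
move=> bc; have {bc} : c \in combos M p S x.
  have : (best_swap M f p S x).2 = Some c -> None = Some c :> option (seq (option E)) \/
      c \in combos M p S x.
    rewrite /best_swap; move: None (f _) => o v.
    elim: (combos M p S x) o v => [|d ds IH] o v /=; first by left.
    rewrite {2}/better_swap /=; case: ifP => _ /IH[h|h].
    - by move: h => [->]; right; rewrite inE eqxx.
    - by right; rewrite inE h orbT.
    - by left.
    - by right; rewrite inE h orbT.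
  by move=> /(_ bc)[].
move=> /choices_mem; rewrite all2E size_map size_iota => /andP[/eqP sc al].
split=> // y /(nthP None)[j jc cj].
have jp : (j < p)%N by rewrite -sc.
move: al => /(all_nthP (None, [::])) /(_ j).
rewrite size_zip size_map size_iota sc minnn => /(_ jp).
rewrite nth_zip ?size_map ?size_iota //= cj (nth_map 0%N) ?size_iota //.
rewrite inE /= => /mapP[z + [->]]; by rewrite mem_filter => /andP[].
Qed.

Section Loop.
Variables (R : realType) (E : finType) (q : nat) (M : 'I_q -> matroid E).
Variables (f : {set E} -> R) (p : nat) (vid : E -> nat) (s : seq E).
Hypotheses (us : uniq s) (sE : forall x, x \in s) (Mp : p_matchoid p M).
Hypothesis vid_inj : injective vid.

Local Notation state := (state R E).
Local Notation wp := (wp M f s).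
Local Notation pos x := (index x s).
Local Notation n := (size s).
Local Notation val := (swap_value M f p).
Local Notation beats := (beats M f p vid).
Local Notation winner := (winner M f p vid).
Local Notation process := (process M f p vid).
Local Notation full_rep := (@full_rep R E q M s).

Variables (slot coin : E -> nat) (r : nat -> nat) (lS lN : nat -> seq nat) (m L K k : nat).
Hypothesis szK : forall w l, (size (members M (process slot r w).1 l) <= K)%N.
Hypothesis lSP : forall j y, (vid y \in lS j) = (slot y == j) && (coin y == 0%N).
Hypothesis lNP : forall j y, (vid y \in lN j) = (slot y == j) && (coin y != 0%N).

Definition code (o : option E) : nat := oapp (fun y => (pos y).+1) 0%N o.

Definition main_inv (w : nat) (st : state) :=
  [/\ full_rep (process slot r w).1 st /\ nmem st 8 1 = w /\ nmem st 0 1 = k,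
     nmem st 8 3 = arrived st /\
       map vid (drop (arrived st) s) = flatten [seq lS j ++ lN j | j <- iota w (m - w)],
     forall j, nmem st 7 j = code (nth None (process slot r w).2 j),
     forall j, (j < m)%N -> nmem st 3 j = r j /\
       chain (nmem st 6) (nmem st 4 j) (lS j) /\ chain (nmem st 6) (nmem st 5 j) (lN j)
   & (#|shortlist st| <= w * L)%N /\
     forall j x, (j < w)%N -> nth None (process slot r w).2 j = Some x -> coin x != 0%N ->
       (#|above M f p vid (process slot r j).1 [set y | slot y == j] coin| <= L)%N ->
       x \in shortlist st].

Definition apply_cost : nat := (p * (p * (10 * K + 20) + 40) + 40)%N.

Definition slot_cost (w : nat) : nat :=
  ((size (lS w) + size (lN w)) * (eval_cost p K + 40) + 2 * eval_cost p K
    + apply_cost + 100)%N.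

Lemma slot_wp (w : nat) st : (w < m)%N -> main_inv w st ->
  wp (process_slot_cmd p L) (slot_cost w) (main_inv w.+1) st.
Proof.
move=> wm [[rep [w1 nk]] [ar vdr] win ch [slw caught]].
set S := (process slot r w).1 in rep win caught *.
set h := (process slot r w).2 in win caught.
have szKS : forall l, (size (members M S l) <= K)%N by exact: szK.
(* Labels follow the order of visit, so the next arrivals are the sample of slot [w] and then its
   other items. *)
have [xs [ys [rest [dr [mxs mys]]]]] : exists xs ys rest,
    drop (arrived st) s = xs ++ ys ++ rest /\ map vid xs = lS w /\ map vid ys = lN w.
  have mw : (m - w = (m - w.+1).+1)%N by rewrite subnS prednK ?subn_gt0.
  move: vdr; rewrite mw /= -catA; set d := drop _ s; set fl := flatten _ => vdr.
  exists (take (size (lS w)) d), (take (size (lN w)) (drop (size (lS w)) d)),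
     (drop (size (lN w)) (drop (size (lS w)) d)).
  rewrite !cat_take_drop !map_take map_drop vdr; split=> //.
  by rewrite take_size_cat // drop_size_cat // take_size_cat.
have vrest : map vid rest = flatten [seq lS j ++ lN j | j <- iota w.+1 (m - w.+1)].
  have mw : (m - w = (m - w.+1).+1)%N by rewrite subnS prednK ?subn_gt0.
  move: vdr; rewrite dr !map_cat mxs mys mw /= -catA => /(congr1 (drop (size (lS w)))).
  rewrite !drop_size_cat // => /(congr1 (drop (size (lN w)))).
  by rewrite !drop_size_cat.
have xsP y : (y \in xs) = (slot y == w) && (coin y == 0%N).
  by rewrite -(mem_map vid_inj) mxs lSP.
have ysP y : (y \in ys) = (slot y == w) && (coin y != 0%N).
  by rewrite -(mem_map vid_inj) mys lNP.
have slotS y : y \in S -> (slot y < w)%N.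
  move=> /(process_solution vid_inj)/(nthP None)[j _ hj].
  by have [-> ] := process_slot vid_inj hj.
(* All items still to arrive belong to slots from [w] on. *)
have arrivedP y : (slot y < w)%N -> y \in take (arrived st) s.
  move=> yw; have := sE y; rewrite -{1}(cat_take_drop (arrived st) s) mem_cat.
  case/orP=> //; rewrite -(mem_map vid_inj) vdr => /flattenP[_ /mapP[j + ->]].
  rewrite mem_iota mem_cat lSP lNP => /andP[wj _].
  by case/orP=> /andP[/eqP yj _]; move: yw; rewrite yj ltnNge wj.
have [r3 [chS chN]] : nmem st 3 w = r w /\
       chain (nmem st 6) (nmem st 4 w) (lS w) /\ chain (nmem st 6) (nmem st 5 w) (lN w).
  by have [] := ch w wm.
set T := [set y | slot y == w].
have uys : uniq ys.
  have : uniq (drop (arrived st) s) by rewrite drop_uniq.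
  by rewrite dr cat_uniq cat_uniq => /and3P[_ _ /and3P[]].
have Txy : [set y in xs ++ ys] = T.
  apply/setP=> y; rewrite !inE mem_cat xsP ysP -andb_orr.
  by case: (coin y == 0%N); rewrite andbT.
pose loopP (a i : nat) := loop_cell a i && ((a != 8) || (i \notin [:: 10; 11])).
pose preP (a i : nat) := loopP a i || ((a == 8) && (i == 3)).
have loopr (st1 st2 : state) : (forall a i, loopP a i -> nmem st2 a i = nmem st1 a i) ->
   smem st2 0 0 = smem st1 0 0 -> arrived st2 = arrived st1 -> full_rep S st1 -> full_rep S st2.
  move=> c e a; apply: full_rep_mem => //; rewrite ?a //.
  by move=> b i hb; apply: c; move: hb; clear; rewrite /rep_cell /loopP /loop_cell !inE; lia.
eapply wp_cost.
eapply (wp_seq (Q1 := fun st1 => [/\ arrived st1 = arrived st, shortlist st1 = shortlist st,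
   smem st1 = smem st, [/\ nmem st1 8 8 = 0%N, nmem st1 8 12 = 0%N & nmem st1 8 2 = nmem st 4 w]
   & forall a i, preP a i -> nmem st1 a i = nmem st a i])).
  apply: (wp_det (c := Seq _ _)) => //; split=> //=.
    by split=> //; rewrite /upd /= w1.
  by move=> a i lp; rewrite /upd !(other_cell lp).
move=> st3 [a3 b3 e3 [k3 k3' p3] c3].
have rep3 : full_rep S st3.
  by apply: loopr rep; rewrite ?e3 // => a i lp; rewrite c3 // /preP lp.
eapply wp_seq.
  apply: (sample_wp us sE vid_inj szKS (xs := xs) (rest := ys ++ rest) rep3) => //.
  - by rewrite c3 // ar a3.
  - by rewrite a3.
  - by move=> x; rewrite xsP => /andP[/eqP xw _]; apply/negP => /slotS; rewrite xw ltnn.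
  - rewrite p3 mxs; have e6 i : nmem st3 6 i = nmem st 6 i by rewrite c3.
    have chx hd l : chain (nmem st 6) hd l -> chain (nmem st3 6) hd l.
      by elim: l hd => //= t l IH hd [-> /IH]; rewrite e6.
    exact: chx.
move=> st4 [rep4 [ar4 dr4] co4 [sl4 k4] [c4 _]].
have c4' a i : loopP a i -> nmem st4 a i = nmem st a i.
  by move=> lp; rewrite c4 ?c3 // ?/preP ?lp //; case/andP: lp.
set th := winner S [set y in xs] in co4.
have chx6 (st' : state) hd l : (forall i, nmem st' 6 i = nmem st 6 i) ->
    chain (nmem st 6) hd l -> chain (nmem st' 6) hd l.
  by move=> e6; elim: l hd => //= t l IH hd [-> /IH]; rewrite e6.
eapply (wp_seq (Q1 := fun st1 => [/\ [/\ arrived st1 = arrived st4, shortlist st1 = shortlist st4 &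
   smem st1 = smem st4], cand_rep M f p vid s S 8 9 0 th st1, cand_rep M f p vid s S 10 11 1 th st1,
   [/\ nmem st1 8 12 = 0%N, nmem st1 8 3 = nmem st4 8 3 & nmem st1 8 2 = nmem st 5 w]
   & forall a i, loopP a i -> nmem st1 a i = nmem st a i])).
  apply: (wp_det (c := Seq _ _)) => //; split=> //=.
  - by split=> //; rewrite /upd /= ?k4 // !c4' // w1.
  - by move=> a i lp; rewrite /upd !(other_cell lp) // c4'.
move=> st5 [[a5 b5 e5] co5 ct5 [k5 ar5 p5] c5].
have rep5 : full_rep S st5.
  apply: full_rep_mem rep4; rewrite ?a5 ?e5 // => a i h0.
  by rewrite c5 ?c4' //; move: h0; clear; rewrite /rep_cell /loopP /loop_cell !inE; lia.
eapply wp_seq.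
  apply: (rest_wp us sE vid_inj szKS L (th := th) (xs := xs) (ys := ys) (rest := rest) rep5) => //.
  - by rewrite ar5 a5.
  - by rewrite a5.
  - by move=> x; rewrite ysP => /andP[/eqP xw _]; apply/negP => /slotS; rewrite xw ltnn.
  - by rewrite p5 mys; apply: chx6 => // i; rewrite c5.
rewrite Txy -/T b5 sl4 b3.
move=> st6 [rep6 [ar6 dr6] co6 [sl6 sz6 in6] c6].
have c6' a i : loopP a i -> nmem st6 a i = nmem st a i.
  by move=> lp; rewrite c6 ?c5 //; case/andP: lp.
have w6 : nmem st6 8 1 = w by rewrite c6'.
set x1 := winner S T in co6.
have co6' : nmem st6 8 8 = code x1 by move: co6; rewrite /cand_rep /code; case: (x1) => [y []|].
eapply (wp_seq (Q1 := fun st1 => [/\ [/\ arrived st1 = arrived st6, shortlist st1 = shortlist st6 &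
   smem st1 = smem st6], nmem st1 8 8 = code x1 /\ (forall y, x1 = Some y -> rmem st1 1 0 = val S y),
   nmem st1 8 5 = code (nth None h (r w)),
   forall j, nmem st1 7 j = code (nth None (rcons h x1) j)
   & forall a i, a != 7 -> (a != 8) || (i != 5) -> nmem st1 a i = nmem st6 a i])).
  apply: (wp_det (c := Seq _ _)) => //; split=> //=.
  - split; first by rewrite /upd /= co6'.
    by move=> y xy; move: co6; rewrite /cand_rep xy => -[].
  - by rewrite /upd /= w6 !c6' // r3 win.
  - move=> j; rewrite /upd /= w6 nth_rcons size_process; case: (ltngtP j w) => jw.
    + by rewrite c6' // win.
    + by rewrite c6' // win nth_default // size_process ltnW.
    + by rewrite co6'.
  - move=> a i a7 a8; rewrite /upd (negPf a7) /=.
    by case: (a == 8) a8 => //= /negPf->.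
move=> st7 [[a7 b7 e7] [k7 v7] k7' win7 c7].
have rep7 : full_rep S st7.
  apply: full_rep_mem rep6; rewrite ?a7 ?e7 // => a i h0.
  by apply: c7; move: h0; clear; rewrite /rep_cell !inE; lia.
have ar7 : nmem st7 8 3 = arrived st7 by rewrite c7 // a7.
have arr7 y : (slot y <= w)%N -> y \in take (arrived st7) s.
  move=> yw; have := sE y; rewrite -{1}(cat_take_drop (arrived st7) s) mem_cat.
  case/orP=> //; rewrite a7 dr6 -(mem_map vid_inj) vrest => /flattenP[_ /mapP[j + ->]].
  rewrite mem_iota mem_cat lSP lNP => /andP[wj _].
  by case/orP=> /andP[/eqP yj _]; move: yw; rewrite yj leqNgt wj.
have TnotS y : y \in T -> y \notin S.
  by rewrite inE => /eqP yw; apply/negP => /slotS; rewrite yw ltnn.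
have x1T y : x1 = Some y -> y \in T by exact: (winner_in vid_inj).
pose y1 := contender S h (r w).
pose z1 := select M f p S x1 y1.
have sel_spec z : z1 = Some z -> z \notin S /\ (slot z <= w)%N.
  have x1P y : x1 = Some y -> y \notin S /\ (slot y <= w)%N.
    by move=> /x1T yT; split; [exact: TnotS | move: yT; rewrite inE => /eqP ->].
  have y1P y : y1 = Some y -> y \notin S /\ (slot y <= w)%N.
    move=> e; split; first exact: contender_notin e.
    move: e; rewrite /y1 /contender; case hy: (nth None h (r w)) => [y'|] //.
    case: ifP => // _ [<-]; have [-> ] := process_slot vid_inj hy; exact: ltnW.
  rewrite /z1 /select; case ex: x1 => [a|]; case ey: y1 => [b|] //.
  - by case: ifP => _ [<-]; [exact: x1P | exact: y1P].
  - by move=> [<-]; exact: x1P.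
  - by move=> [<-]; exact: y1P.

pose keep8 (a i : nat) := (a \notin [:: 8; 9; 10; 11; 12; 17]%N) || ((a == 8) && (i \notin [:: 4; 8])).
eapply (wp_seq (Q1 := fun st1 => [/\ full_rep S st1, arrived st1 = arrived st7,
   shortlist st1 = shortlist st7, nmem st1 8 8 = code z1
   & forall a i, keep8 a i -> nmem st1 a i = nmem st7 a i])).
  apply: (wp_if (t := (eval_cost p K + 20)%N)).
  have [_ _ IN7 _] := rep7.
  have -> : beval st7 (BAnd (BLeN (NConst 1) 8.[: 5]) (BLeN (NGet 16 (NSub 8.[: 5] (NConst 1))) Z0)) = isSome y1.
    rewrite /= k7' /y1 /contender /code; case: (nth None h (r w)) => [y|] //=.
    by rewrite subn1 /= IN7; case: (y \in S).
  case ey: y1 => [y|] /=; last first.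
    apply: (wp_cost (t := cost Skip)); last by rewrite /= addnS.
    apply: wp_det => //; split=> //.
    by rewrite /= k7 /z1 ey /select; case: (x1).
  have code5 : nmem st7 8 5 = (pos y).+1.
    rewrite k7' /code; move: ey; rewrite /y1 /contender; case: (nth None h (r w)) => [y'|] //.
    by case: ifP => // _ [->].
  have [yS yw] : y \notin S /\ (slot y <= w)%N.
    split; first exact: contender_notin ey.
    move: ey; rewrite /y1 /contender; case hy: (nth None h (r w)) => [y'|] //.
    case: ifP => // _ [<-]; have [-> ] := process_slot vid_inj hy; exact: ltnW.
  eapply wp_cost.
  eapply (wp_seq (Q1 := fun st1 => [/\ full_rep S st1 /\ nmem st1 8 4 = pos y, arrived st1 = arrived st7,
     shortlist st1 = shortlist st7 /\ rmem st1 = rmem st7, nmem st1 8 8 = code x1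
     & forall a i, keep8 a i -> nmem st1 a i = nmem st7 a i])).
    apply: (wp_det (c := NSet _ _ _)) => //; split=> //=.
    - split; last by rewrite /upd /= code5 subn1.
      apply: full_rep_mem rep7 => //= a i h0.
      by rewrite /upd (other_cell h0).
    - by move=> a i kp; rewrite /upd (other_cell kp).
  move=> st8 [[rep8 X8] a8 [b8 d8] k8 c8].
  have ya8 : y \in take (arrived st8) s by rewrite a8 arr7.
  eapply wp_seq; first exact: (evaluate_full f p us szKS rep8 X8 ya8 yS).
  move=> st9 [[a9 b9 c9 d9 e9] rep9 v9 _].
  have k9 : nmem st9 8 8 = code x1 by rewrite c9.
  apply: (wp_if (t := 1)).
  have -> : beval st9 (BNot (BAnd (BLeN (NConst 1) 8.[: 8]) (BLeR (RGet 0 Z0) (RGet 1 Z0))))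
     = if x1 is Some x then ~~ (val S y <= val S x) else true.
    rewrite /= k9 /code; case ex: x1 => [x|] //=.
    by rewrite v9 d9 // d8 (v7 x ex).
  case cmp: (if x1 is Some x then _ else _); [apply: (wp_det (c := NSet _ _ _)) | apply: (wp_det (c := Skip))] => //; split=> //=.
  - by rewrite a9.
  - by rewrite b9.
  - rewrite /upd /= c9 // c8 // code5 /z1 ey /select; move: cmp.
    by case: (x1) => [x|] //; case: ifP.
  - move=> a i kp; rewrite /upd (other_cell kp) // c9 ?c8 //.
    by move: kp; clear; rewrite /keep8 !inE; lia.
  - by rewrite a9.
  - by rewrite b9.
  - rewrite k9 /z1 ey /select; move: cmp.
    by case: (x1) => [x|] //; case: ifP.
  - move=> a i kp; rewrite c9 ?c8 //.
    by move: kp; clear; rewrite /keep8 !inE; lia.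
  by rewrite /=; lia.
move=> st8 [rep8 a8 b8 k8 c8].
pose keepZ (a i : nat) := (a < 8)%N || ((a == 8) && (i \in [:: 1; 3]%N)).
eapply (wp_seq (Q1 := fun st1 => [/\ full_rep (next_solution M f p S z1) st1,
   arrived st1 = arrived st8, shortlist st1 = shortlist st8
   & forall a i, keepZ a i -> nmem st1 a i = nmem st8 a i])).
  apply: (wp_if (t := (eval_cost p K + apply_cost + 10)%N)).
  rewrite /= k8; case ez: z1 => [z|] /=; last first.
    by apply: (wp_cost (t := cost Skip)); [apply: wp_det | rewrite /= addnS].
  have [zS zw] := sel_spec z ez.
  eapply wp_cost.
  eapply (wp_seq (Q1 := fun st1 => [/\ full_rep S st1, nmem st1 8 4 = pos z, arrived st1 = arrived st8,
     shortlist st1 = shortlist st8 & forall a i, keepZ a i -> nmem st1 a i = nmem st8 a i])).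
    apply: (wp_det (c := NSet _ _ _)) => //; split=> //=.
    - by rewrite /upd /= k8 ez /= subn1.
    - by move=> a i kp; rewrite /upd (other_cell kp).
  move=> st9 [rep9 X9 a9 b9 c9].
  have za9 : z \in take (arrived st9) s by rewrite a9 a8 arr7.
  eapply wp_seq; first exact: (evaluate_full f p us szKS rep9 X9 za9 zS).
  move=> st10 [[a10 b10 c10 d10 e10] rep10 v10 [_ acc10]].
  have c10' a i : keepZ a i -> nmem st10 a i = nmem st8 a i.
    by move=> kp; rewrite c10 ?c9 //; move: kp; clear; rewrite /keepZ !inE; lia.
  apply: (wp_if (t := apply_cost)); rewrite /=.
  case bz: ((best_swap M f p S z).2) acc10 => [c|] /=; last first.
    move=> -> /=; apply: (wp_cost (t := cost Skip)); last by rewrite /= /apply_cost addnS.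
    by apply: wp_det => //; rewrite /= /swap bz a10 b10.
  move=> [-> Bc] /=; have [sc cS] := best_swap_in bz.
  have X10 : nmem st10 8 4 = pos z by rewrite c10.
  have za10 : z \in take (arrived st10) s by rewrite a10.
  eapply wp_post; first exact: (apply_swap_wp f us sE Mp szKS rep10 X10 za10 zS sc cS Bc).
  move=> st11 [[a11 b11 _ c11] rep11]; split.
  - by rewrite /next_solution /swap bz.
  - by rewrite a11 a10.
  - by rewrite b11 b10.
  - move=> a i kp; rewrite c11 ?c10' //.
    by move: kp; clear; rewrite /keepZ /untouched !inE; lia.
  by rewrite /= /eval_cost /apply_cost; lia.
move=> st9 [rep9 a9 b9 c9].
apply: (wp_det (c := NSet _ _ _)) => //.
have e8 a i : keepZ a i -> nmem st9 a i = nmem st7 a i.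
  by move=> kp; rewrite c9 // c8 //; move: kp; clear; rewrite /keepZ /keep8 !inE; lia.
have e36 a i : a \in [:: 0; 3; 4; 5; 6]%N -> nmem st9 a i = nmem st a i.
  move=> ha; rewrite e8; last by move: ha; clear; rewrite /keepZ !inE; lia.
  rewrite c7; first last.
  - by move: ha; clear; rewrite !inE; lia.
  - by move: ha; clear; rewrite !inE; lia.
  by apply: c6'; move: ha; clear; rewrite /loopP /loop_cell !inE; lia.
have sl9 : shortlist st9 = shortlist st6 by rewrite b9 b8 b7.
have arr9 : arrived st9 = arrived st7 by rewrite a9 a8.
rewrite /main_inv processS -/S -/h -/T -/x1 -/y1 -/z1 /=.
split.
- by split=> //; rewrite /upd /= e8 // c7 // w6 addn1 e36.
- by rewrite /upd /= e8 // ar7 arr9 a7 dr6 vrest.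
- by move=> j; rewrite /upd /= e8 // win7.
- move=> j jm; rewrite /upd /= !e36 //; have [-> [ch1 ch2]] := ch j jm.
  by split=> //; split; apply: chx6 => // i; rewrite e36.
rewrite sl9; split.
  by apply: leq_trans sz6 _; rewrite mulSn addnC leq_add2l.
move=> j x; rewrite ltnS leq_eqVlt => /orP[/eqP->|jw]; last first.
  rewrite nth_rcons size_process jw => hj cx ab.
  by apply: (subsetP sl6); exact: caught hj cx ab.
rewrite nth_rcons size_process ltnn eqxx -/T -/S => xx cx ab.
have xT := x1T x xx.
(* An item beats the whole sample exactly when it beats the winner of the sample or the sample is
   empty. *)
have passE : passing M f p vid S th ys = above M f p vid S T coin.
  apply/setP=> y; rewrite /passing /above !inE ysP.
  case: (slot y =P w) => //= yw; case: (coin y =P 0%N) => //= cy.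
  rewrite /th; case wx: (winner S [set y0 in xs]) => [t|] /=.
    have := winner_in vid_inj wx; rewrite inE xsP => /andP[/eqP tw ct].
    apply/idP/forall_inP => [yt z|]; last by move=> /(_ t); rewrite inE tw eqxx ct => /(_ isT).
    rewrite inE => zw; apply/implyP => cz; apply: beats_trans yt _.
    by apply: (winner_beats vid_inj wx); rewrite inE xsP zw.
  symmetry; apply/forall_inP => z; rewrite inE => zw; apply/implyP => cz.
  by have := winner_none vid_inj wx => /setP/(_ z); rewrite !inE xsP zw cz.
rewrite passE in in6; apply: (subsetP (in6 ab)).
rewrite inE xT cx /=; apply/forall_inP => z zT; apply/implyP => _.
exact: (winner_beats vid_inj xx).
rewrite /slot_cost -mxs -mys !size_map /= /apply_cost; lia.
Qed.

End Loop.

(** * The deterministic part of the program *)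

Fixpoint nmul (c : nat) (e : nexp) : nexp :=
  if c is c'.+1 then NAdd e (nmul c' e) else Z0.

Definition push (head : nat) : cmd :=
  NSet 6 8.[: 0] (NGet head (NGet 1 8.[: 0])) ;;
  NSet head (NGet 1 8.[: 0]) (NAdd 8.[: 0] (NConst 1)).

Definition build_buckets : cmd :=
  NSet 8 Z0 Z0 ;;
  While (BLeN (NAdd 8.[: 0] (NConst 1)) 0.[: 0])
    (If (BLeN (NGet 2 8.[: 0]) Z0) (push 4) (push 5) ;;
     NSet 8 Z0 (NAdd 8.[: 0] (NConst 1))).

Definition main_cmd (p c L : nat) : cmd :=
  build_buckets ;;
  NSet 8 (NConst 13) 0.[: 0] ;;
  While (BLeN (NAdd 8.[: 1] (NConst 1)) (nmul c 0.[: 1])) (process_slot_cmd p L).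

Lemma neval_nmul (R : realType) (E : finType) (st : state R E) c e :
  neval st (nmul c e) = (c * neval st e)%N.
Proof. by elim: c => //= c ->; rewrite mulSn. Qed.

Lemma chain_upd nx h l i v : chain nx h l -> i \notin l ->
  chain (fun t => if t == i then v else nx t) h l.
Proof.
elim: l h => //= t l IH h [-> ch]; rewrite inE negb_or eq_sym => /andP[/negPf ti il].
by rewrite ti; split=> //; exact: IH.
Qed.

(** Reversed because [push] inserts at the head. *)
Definition bucket (b : nat -> nat) (P : pred nat) (n j : nat) : seq nat :=
  rev [seq t <- iota 0 n | (b t == j) && P t].

Lemma bucketS b P n j : bucket b P n.+1 j =
  if (b n == j) && P n then n :: bucket b P n j else bucket b P n j.
Proof.
rewrite /bucket -addn1 iotaD filter_cat rev_cat /= add0n.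
by case: ifP.
Qed.

Lemma mem_bucket b (P : pred nat) n j t : (t \in bucket b P n j) = (t < n)%N && ((b t == j) && P t).
Proof. by rewrite mem_rev mem_filter mem_iota add0n andbC. Qed.

Section Main.
Variables (R : realType) (E : finType) (q : nat) (M : 'I_q -> matroid E).
Variables (f : {set E} -> R) (p : nat) (vid : E -> nat) (s : seq E).
Hypotheses (us : uniq s) (sE : forall x, x \in s) (Mp : p_matchoid p M).
Hypotheses (vid_inj : injective vid) (vid_lt : forall x, (vid x < size s)%N).
Hypothesis s0 : (0 < size s)%N.

Local Notation state := (state R E).
Local Notation wp := (wp M f s).
Local Notation n := (size s).
Local Notation process := (process M f p vid).

Variables (b c r : nat -> nat) (k m W L K : nat).
Let slot y := b (vid y).
Let coin y := c (vid y).
Let lS := bucket b (fun t => c t == 0%N) n.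
Let lN := bucket b (fun t => c t != 0%N) n.
Hypothesis szK : forall w l, (size (members M (process slot r w).1 l) <= K)%N.
Hypothesis vids : map vid s = flatten [seq lS j ++ lN j | j <- iota 0 m].

Definition start_rep (st : state) :=
  [/\ [/\ arrived st = 0%N, shortlist st = set0 & smem st 0 0 = set0],
      nmem st 0 0 = n /\ nmem st 0 1 = k,
      forall a i, a \in [:: 4; 5; 6; 7; 13; 14; 15; 16]%N -> nmem st a i = 0%N,
      forall i, i != 0%N -> nmem st 8 i = 0%N
    & [/\ forall t, (t < n)%N -> nmem st 1 t = b t, forall t, (t < n)%N -> nmem st 2 t = c t
        & forall j, (j < m)%N -> nmem st 3 j = r j]].

Lemma build_wp st : start_rep st ->
  wp build_buckets (n * 10 + 3) (fun st' =>
    [/\ [/\ arrived st' = 0%N, shortlist st' = set0 & smem st' 0 0 = set0],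
      forall j, chain (nmem st' 6) (nmem st' 4 j) (lS j) /\
                chain (nmem st' 6) (nmem st' 5 j) (lN j)
    & forall a i, (a \notin [:: 4; 5; 6; 8]%N) || ((a == 8) && (i != 0%N)) ->
       nmem st' a i = nmem st a i]) st.
Proof.
move=> [[a0 b0 e0] [n0 k0] z0 z8 [r1 r2 r3]].
pose P (a i : nat) := (a \notin [:: 4; 5; 6; 8]%N) || ((a == 8) && (i != 0%N)).
pose bS := bucket b (fun t => c t == 0%N).
pose bN := bucket b (fun t => c t != 0%N).
pose Inv0 i (st' : state) :=
    [/\ [/\ arrived st' = 0%N, shortlist st' = set0 & smem st' 0 0 = set0],
      forall j, chain (nmem st' 6) (nmem st' 4 j) (bS i j) /\
                chain (nmem st' 6) (nmem st' 5 j) (bN i j)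
    & forall a i, P a i -> nmem st' a i = nmem st a i].
pose Inv i (st' : state) := Inv0 i st' /\ nmem st' 8 0 = i.
eapply wp_cost.
eapply (wp_seq (Q1 := Inv 0%N)).
  apply: (wp_det (c := NSet _ _ _)) => //; split=> //; split=> //=.
    by move=> j; rewrite /upd /= !z0.
  by move=> a i kp; rewrite /upd (other_cell kp).
move=> st1 I1.
eapply wp_post.
  apply: (wp_while (N := n) (t := fun=> 6%N) (Inv := Inv)) => //.
  - move=> i st2 iN [[[a2 b2 e2] ch2 c2] i2]; split; first by rewrite /= i2 c2 // n0 addn1.
    have b2' : nmem st2 1 i = b i by rewrite c2 // r1.
    eapply wp_cost.
    eapply (wp_seq (Q1 := fun st3 => Inv0 i.+1 st3 /\ nmem st3 8 0 = i)).
      apply: (wp_if (t := 3)); rewrite /= i2 c2 // r2 // leqn0.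
      have notin l j : i \notin bucket b l i j by rewrite mem_bucket ltnn.
      have bSS j : bS i.+1 j = if (b i == j) && (c i == 0%N) then i :: bS i j else bS i j.
        exact: bucketS.
      have bNS j : bN i.+1 j = if (b i == j) && (c i != 0%N) then i :: bN i j else bN i j.
        exact: bucketS.
      case c0: (c i == 0%N); apply: (wp_det (c := push _)) => //; split=> //; split=> //=;
        rewrite /upd /= ?i2 ?b2'; last 1 first.
      + move=> a j kp; by rewrite !(other_cell kp) // c2.
      + move=> j; rewrite bSS bNS c0 /= andbT andbF; have [chS chN] := ch2 j.
        split; last by apply: chain_upd => //; exact: notin.
        rewrite eq_sym; case: eqP => [<-|_] /=; last by apply: chain_upd => //; exact: notin.
        by rewrite addn1 eqxx; split=> //; apply: chain_upd; [case: (ch2 (b i)) | exact: notin].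
      + by move=> a j kp; rewrite !(other_cell kp) // c2.
      + move=> j; rewrite bSS bNS c0 /= andbT andbF; have [chS chN] := ch2 j.
        split; first by apply: chain_upd => //; exact: notin.
        rewrite eq_sym; case: eqP => [<-|_] /=; last by apply: chain_upd => //; exact: notin.
        by rewrite addn1 eqxx; split=> //; apply: chain_upd; [case: (ch2 (b i)) | exact: notin].
    move=> st3 [[h1 h2 h3] h4]; apply: (wp_det (c := NSet _ _ _)) => //; split=> //=.
      split=> // a j kp; by rewrite /= /upd (other_cell kp) // h3.
    by rewrite /upd /= h4 addn1.
    by [].
  - by move=> st2 [[_ _ c2] i2]; rewrite /= i2 c2 // n0 addn1 ltnn.
move=> st' [[h1 h2 h3] _]; split=> //.
by rewrite /= sum_nat_const card_ord; lia.
Qed.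

(** The passes through the buckets meet each item at most once, so their evaluations are charged to
    [n], however many slots there are. *)
Lemma sum_buckets : (W <= m)%N -> (\sum_(w < W) (size (lS w) + size (lN w)) <= n)%N.
Proof.
move=> Wm; rewrite -(size_map vid) vids size_flatten /shape -map_comp sumnE big_map.
rewrite -[m]subn0 -/(index_iota 0 m) (big_cat_nat (n := W)) //=.
by rewrite big_mkord (eq_bigr _ (fun w _ => esym (size_cat _ _))) leq_addr.
Qed.

Lemma main_wp st : (W <= m)%N -> start_rep st -> forall a, W = (a * k)%N ->
  wp (main_cmd p a L) (\sum_(w < W) (slot_cost p lS lN K w + 2) + n * 10 + 10)%N
    (fun st' => (#|shortlist st'| <= W * L)%N /\
       forall w x, (w < W)%N -> nth None (process slot r W).2 w = Some x -> coin x != 0%N ->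
         (#|above M f p vid (process slot r w).1 [set y | slot y == w] coin| <= L)%N ->
         x \in shortlist st') st.
Proof.
move=> Wm st0 a Wa; have [_ [n0 k0] z0 z8 [r1 r2 r3]] := st0.
eapply wp_cost.
eapply wp_seq; first exact: build_wp st0.
move=> st1 [[a1 b1 e1] ch1 c1].
eapply (wp_seq (Q1 := main_inv M f p vid s slot coin r lS lN m L k 0)).
  apply: (wp_det (c := NSet _ _ _)) => //.
  have n1 : nmem st1 0 0 = n by rewrite c1.
  have z1 a' i : a' \in [:: 7; 13; 14; 15; 16]%N -> nmem st1 a' i = 0%N.
    move=> ha; rewrite c1 ?z0 //; move: ha; clear; rewrite !inE; lia.
  split=> /=; rewrite ?a1 ?b1.
  - split; last by rewrite /upd /= c1 // z8 // c1.
    split=> //.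
    + split=> //=; rewrite ?e1 //.
      by move=> l; rewrite /list_of /= /upd /= (z1 14).
    + split=> /=; rewrite /upd /= ?n1 //.
      * by move=> l; rewrite !z1.
      * by move=> l; rewrite z1.
      * by move=> l l' _; rewrite z1.
      * by move=> l; rewrite z1.
    + by move=> y; rewrite /= /upd /= z1.
  - by rewrite /upd /= c1 // z8 // drop0 subn0 vids.
  - by move=> j; rewrite /upd /= z1 // nth_nil.
  - by move=> j jm; rewrite /upd /= c1 // r3.
  - by rewrite cards0.
move=> st2 I2.
eapply wp_post.
  apply: (wp_while (N := W) (t := fun w => slot_cost p lS lN K w)
     (Inv := main_inv M f p vid s slot coin r lS lN m L k)).
  - exact: I2.
  - move=> w st3 wW I3; split.
      have [[_ [w3 k3]] _ _ _ _] := I3.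
      by rewrite /= neval_nmul /= w3 k3 addn1 -Wa.
    apply: slot_wp I3 => //; last exact: leq_trans wW Wm.
    + by move=> j y; rewrite mem_bucket vid_lt.
    + by move=> j y; rewrite mem_bucket vid_lt.
  - move=> st3 [[_ [w3 k3]] _ _ _ _].
    by rewrite /= neval_nmul /= w3 k3 addn1 -Wa ltnn.
move=> st' [_ _ _ _ [h1 h2]]; split=> // w x wW; exact: h2.
have -> : (\sum_(w < W) (slot_cost p lS lN K w).+2 = \sum_(w < W) (slot_cost p lS lN K w + 2))%N.
  by apply: eq_bigr => w _; rewrite addn2.
by rewrite /=; lia.
Qed.

End Main.

(** * Random choices and arrival orders *)

Definition fill (a : nat) (len top : nexp) : cmd :=
  NSet 8 Z0 Z0 ;;
  While (BLeN (NAdd 8.[: 0] (NConst 1)) len)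
    (Rand a 8.[: 0] top ;; NSet 8 Z0 (NAdd 8.[: 0] (NConst 1))).

Section Distributions.
Variable R : realType.

Lemma expect_dbind (A B : Type) (d : dist R A) (g : A -> dist R B) (h : B -> R) :
  expect (dbind d g) h = expect d (fun x => expect (g x) h).
Proof.
rewrite /expect /dbind big_flatten big_map; apply: eq_bigr => x _.
by rewrite big_map mulr_sumr; apply: eq_bigr => y _; rewrite mulrA.
Qed.

Lemma surely_dbind (A B : Type) (d : dist R A) (g : A -> dist R B) (P : B -> bool) :
  surely (dbind d g) P = surely d (fun x => surely (g x) P).
Proof.
rewrite /surely /dbind; elim: d => //= x d IH.
by rewrite all_cat IH all_map.
Qed.

Lemma dbind_cat (A B : Type) (d1 d2 : dist R A) (g : A -> dist R B) :
  dbind (d1 ++ d2) g = dbind d1 g ++ dbind d2 g.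
Proof. by rewrite /dbind map_cat flatten_cat. Qed.

Lemma dbind_scale (A B : Type) (z : R) (d : dist R A) (g : A -> dist R B) :
  dbind [seq (z * y.1, y.2) | y <- d] g = [seq (z * y.1, y.2) | y <- dbind d g].
Proof.
elim: d => //= x d IH; rewrite /dbind /= in IH *; rewrite map_cat -IH; congr (_ ++ _).
by rewrite -map_comp; apply: eq_map => y /=; rewrite mulrA.
Qed.

Lemma dbind_assoc (A B C : Type) (d : dist R A) (g : A -> dist R B) (h : B -> dist R C) :
  dbind (dbind d g) h = dbind d (fun x => dbind (g x) h).
Proof.
have single (A' B' : Type) (y : R * A') (k : A' -> dist R B') :
    dbind [:: y] k = [seq (y.1 * z.1, z.2) | z <- k y.2] by rewrite /dbind /= cats0.
elim: d => // x d IH; rewrite -[x :: d]cat1s !dbind_cat IH; congr (_ ++ _).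
by rewrite dbind_scale [RHS]single; exact: cats0.
Qed.

Lemma eq_in_dbind (A : eqType) (B : Type) (d : dist R A) (g h : A -> dist R B) :
  (forall x, x \in d -> g x.2 = h x.2) -> dbind d g = dbind d h.
Proof.
move=> gh; rewrite /dbind; by congr flatten; apply/eq_in_map => x /gh ->.
Qed.

Lemma expect_dret (A : Type) (a : A) (h : A -> R) : expect (dret R a) h = h a.
Proof. by rewrite /expect /dret big_seq1 mul1r. Qed.

Lemma expect_duniform (m : nat) (h : nat -> R) :
  expect (duniform R m) h = m.+1%:R^-1 * \sum_(i < m.+1) h i.
Proof.
rewrite /expect /duniform big_map mulr_sumr -(big_mkord xpredT (fun i => _ * h i)).
by rewrite /index_iota subn0.
Qed.

Lemma surely_duniform (m : nat) (P : nat -> bool) :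
  (forall i, (i <= m)%N -> P i) -> surely (duniform R m) P.
Proof.
move=> Pi; rewrite /surely /duniform all_map; apply/allP => i.
by rewrite mem_iota add0n ltnS => /andP[_ im]; exact: Pi.
Qed.

Lemma sum_put (A B : finType) (F : {ffun A -> B} -> R) (a : A) :
  \sum_(b : B) \sum_(g : {ffun A -> B}) F (put g a b)
    = #|B|%:R * \sum_(g : {ffun A -> B}) F g.
Proof.
under eq_bigr do rewrite -resample.
rewrite -mulr_sumr; congr (_ * _).
by rewrite [RHS](partition_big (fun g : {ffun A -> B} => g a) predT).
Qed.

End Distributions.

Section Fill.
Variables (R : realType) (E : finType) (q : nat) (M : 'I_q -> matroid E).
Variables (f : {set E} -> R) (s : seq E).

Local Notation state := (state R E).
Local Notation runs := (run_from M f s).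

Definition random_exec (c : cmd) (t : nat) (st : state) (D : dist R state) :=
  forall K T, runs (t + T) (c :: K, st) = dbind D (fun st' => runs T (K, st')).

Definition filled (a N Q : nat) (i : nat) (v : {ffun 'I_N -> 'I_Q}) (st st' : state) :=
  [/\ arrived st' = arrived st, shortlist st' = shortlist st, smem st' = smem st,
     forall j : 'I_N, (i <= j)%N -> nmem st' a j = v j
   & forall b j, ~~ ((b == 8) && (j == 0%N)) -> ~~ ((b == a) && (i <= j)%N) ->
       nmem st' b j = nmem st b j].

(** The final state is tied to the drawn vector [v] only through [filled]. Uniformity is therefore
    expressed by two consequences: what holds for all [v] is sure, and an expectation is bounded
    below by an average over [v]. *)
Lemma fill_exec (a : nat) (len top : nexp) (N Q : nat) st :
    (0 < a < 8)%N ->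
    (forall st' : state, (forall i, nmem st' 0 i = nmem st 0 i) ->
       neval st' len = N /\ neval st' top = Q) ->
  exists D, [/\ random_exec (fill a len top) (4 * N + 3) st D,
    (forall P : state -> bool,
       (forall (v : {ffun 'I_N -> 'I_Q.+1}) st', filled a 0 v st st' -> P st') -> surely D P)
  & (forall (h : state -> R) (G : {ffun 'I_N -> 'I_Q.+1} -> R),
       (forall v st', filled a 0 v st st' -> G v <= h st') ->
       \sum_v G v <= #|{ffun 'I_N -> 'I_Q.+1}|%:R * expect D h)].
Proof.
move=> /andP[a0 a8] ev.
pose loop := While (BLeN (NAdd 8.[: 0] (NConst 1)) len)
    (Rand a 8.[: 0] top ;; NSet 8 Z0 (NAdd 8.[: 0] (NConst 1))).
(* Whole vectors [v] are kept throughout, including the entries below [N - d], which [filled] leaves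
   free and which are averaged along; [sum_put] absorbs the repeated draw of an entry. *)
have main d st1 : (d <= N)%N -> (forall i, nmem st1 0 i = nmem st 0 i) ->
    nmem st1 8 0 = (N - d)%N ->
  exists D, [/\ random_exec loop (4 * d + 1) st1 D,
    (forall P : state -> bool,
       (forall (v : {ffun 'I_N -> 'I_Q.+1}) st', filled a (N - d) v st1 st' -> P st') -> surely D P)
  & (forall (h : state -> R) (G : {ffun 'I_N -> 'I_Q.+1} -> R),
       (forall v st', filled a (N - d) v st1 st' -> G v <= h st') ->
       \sum_v G v <= #|{ffun 'I_N -> 'I_Q.+1}|%:R * expect D h)].
  elim: d st1 => [|d IH] st1 dN n0 i0.
    have fin (v : {ffun 'I_N -> 'I_Q.+1}) : filled a (N - 0) v st1 st1.
      by split=> // j; rewrite subn0 leqNgt ltn_ord.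
    exists (dret R st1); split=> [K T|P Pv|h G Gh].
    - by rewrite /= !dbind_dret i0 addn1 (proj1 (ev st1 n0)) subn0 ltnn.
    - by rewrite /surely /= andbT; apply: (Pv [ffun=> ord0]).
    - rewrite expect_dret mulr_natl -sumr_const; apply: ler_sum => v _.
      exact: Gh.
  set i := (N - d.+1)%N in i0 *.
  have iN : (i < N)%N by rewrite /i; lia.
  have iS : (N - d = i.+1)%N by rewrite /i; lia.
  pose st2 (x : nat) := set_nmem (set_nmem st1 a i x) 8 0 i.+1.
  have n02 x j : nmem (st2 x) 0 j = nmem st 0 j.
    by rewrite /= /upd /= -n0; case: eqP => // e; rewrite -e in a0.
  pose Pr (x : 'I_Q.+1) (Dx : dist R state) :=
    [/\ random_exec loop (4 * d + 1) (st2 x) Dx,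
    (forall P : state -> bool,
       (forall (v : {ffun 'I_N -> 'I_Q.+1}) st', filled a (N - d) v (st2 x) st' -> P st') -> surely Dx P)
  & (forall (h : state -> R) (G : {ffun 'I_N -> 'I_Q.+1} -> R),
       (forall v st', filled a (N - d) v (st2 x) st' -> G v <= h st') ->
       \sum_v G v <= #|{ffun 'I_N -> 'I_Q.+1}|%:R * expect Dx h)].
  have [D DP] : exists D : 'I_Q.+1 -> dist R state, forall x, Pr x (D x).
    apply: (@fin_all_exists _ (fun=> dist R state) Pr) => x.
    apply: IH; [exact: ltnW | exact: n02 |].
    by rewrite /= /upd /= iS.
  have fill_put (x : 'I_Q.+1) (v : {ffun 'I_N -> 'I_Q.+1}) st' : filled a (N - d) v (st2 x) st' ->
      filled a i (put v (Ordinal iN) x) st1 st'.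
    rewrite iS => -[h1 h2 h3 h4 h5]; split=> //.
    - move=> j; rewrite leq_eqVlt ffunE -val_eqE /= => /orP[/eqP <-|ij].
        rewrite eqxx h5 ?ltnn ?andbF //=; last by case: eqP => // e; rewrite e in a8.
        by rewrite /upd /= !eqxx; case: eqP => // e; rewrite e in a8.
      by rewrite gtn_eqF // h4.
    - move=> b j b8 ba; rewrite h5 //; last by apply: contra ba => /andP[-> /ltnW].
      rewrite /= /upd (negPf b8) (_ : (b == a) && (j == i) = false) //.
      by apply: contraNF ba => /andP[-> /eqP ->] /=.
  pose D' (x : nat) : dist R state := oapp D [::] (insub x).
  exists (dbind (duniform R Q) D'); split=> [K T|P Pv|h G Gh].
  - rewrite (_ : 4 * d.+1 + 1 + T = (4 * d + 1 + T).+4)%N; last by lia.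
    rewrite /= dbind_dret i0 addn1 (proj1 (ev st1 n0)) iN.
    rewrite /= dbind_dret /= !dbind_assoc (proj2 (ev st1 n0)).
    apply: eq_in_dbind => -[w x] /=; rewrite /duniform => /mapP[y + [_ ->]].
    rewrite mem_iota add0n => /= yQ; rewrite dbind_dret /= dbind_dret.
    rewrite /D' insubT /=; have [exD _ _] := DP (Ordinal yQ); rewrite -exD /=.
    have a8f : (8 == a) = false by apply: gtn_eqF.
    by rewrite /st2 /upd a8f /= i0 [(i + 1)%N]addn1.
  - rewrite surely_dbind; apply: surely_duniform => x xQ.
    rewrite /D' insubT /=; have [_ sD _] := DP (Ordinal (xQ : (x < Q.+1)%N)).
    by apply: sD => v st' /fill_put/Pv.
  - rewrite expect_dbind expect_duniform mulrCA mulrA.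
    have Q0 : Q.+1%:R != 0 :> R by rewrite pnatr_eq0.
    rewrite -[leLHS](mulKf Q0) -mulrA ler_wpM2l ?invr_ge0 ?ler0n //.
    rewrite -[X in X%:R]card_ord -(sum_put G (Ordinal iN)) mulr_sumr.
    apply: ler_sum => x _; have [_ _ hD] := DP x.
    rewrite /D' valK /=; apply: hD => v st' /fill_put; exact: Gh.
have [||D [exD sD hD]] := main N (set_nmem st 8 0 0) (leqnn N).
- by [].
- by rewrite subnn.
rewrite subnn in sD hD.
have fl (v : {ffun 'I_N -> 'I_Q.+1}) st' :
    filled a 0 v (set_nmem st 8 0 0) st' -> filled a 0 v st st'.
  move=> [h1 h2 h3 h4 h5]; split=> // b j b8 ba.
  by rewrite h5 // /= /upd (negPf b8).
exists D; split=> [K T|P Pv|h G Gh].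
- rewrite (_ : 4 * N + 3 + T = (4 * N + 1 + T).+2)%N; last by lia.
  by rewrite /= dbind_dret /= dbind_dret exD.
- by apply: sD => v st' h; apply: (Pv v); exact: fl.
- by apply: hD => v st' hf; apply: Gh; exact: fl.
Qed.

End Fill.

(** [Rand] includes its upper end, hence the subtractions of one. The text depends on [p] and [D]
    only. *)
Definition program (p D : nat) : cmd :=
  fill 1 0.[: 0] (NSub (nmul (D ^ 2) 0.[: 1]) (NConst 1)) ;;
  fill 2 0.[: 0] (NConst D.-1) ;;
  fill 3 (nmul (D ^ 2) 0.[: 1]) (NSub (nmul (D ^ 2) 0.[: 1]) (NConst 1)) ;;
  main_cmd p (D ^ 2 - D) (D ^ 2).

Lemma natf_lt (N K : nat) (v : {ffun 'I_N -> 'I_K}) (t : nat) : (t < N)%N -> (natf v t < K)%N.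
Proof. by move=> tN; rewrite -[t]/(nat_of_ord (Ordinal tN)) natfE. Qed.

(* Maps arrival positions to virtual positions: the algorithm makes the item
   arriving at time [t] play the role of the [t]-th entry of this list. *)
Definition visit (b c : nat -> nat) (n m : nat) : seq nat :=
  flatten [seq bucket b (fun t => c t == 0%N) n j ++ bucket b (fun t => c t != 0%N) n j
          | j <- iota 0 m].

Lemma visit_perm b c n m : (forall t, (t < n)%N -> (b t < m)%N) ->
  perm_eq (visit b c n m) (iota 0 n).
Proof.
move=> bm; apply: uniq_perm; last 2 first.
- exact: iota_uniq.
- move=> t; rewrite mem_iota add0n /=; apply/flattenP/idP => [[_ /mapP[j _ ->]]|tn].
    by rewrite mem_cat !mem_bucket => /orP[]/andP[].
  exists (bucket b (fun t => c t == 0%N) n (b t) ++ bucket b (fun t => c t != 0%N) n (b t)).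
    by apply/mapP; exists (b t) => //; rewrite mem_iota add0n bm.
  by rewrite mem_cat !mem_bucket tn eqxx /=; case: (c t == 0%N).
rewrite /visit; have := iota_uniq 0 m; elim: (iota 0 m) => //= j js IH /andP[jjs ujs].
rewrite cat_uniq IH // andbT; apply/andP; split.
  rewrite cat_uniq /bucket !rev_uniq !filter_uniq ?iota_uniq //= andbT.
  apply/hasPn => t; rewrite !mem_rev !mem_filter => /andP[/andP[_ ct] _].
  by rewrite (negPf ct) andbF.
apply/hasPn => t /flattenP[_ /mapP[j' j'js ->]].
rewrite !mem_cat !mem_bucket => tj'; apply/negP => tj.
have bj : b t = j by case/orP: tj => /andP[_ /andP[/eqP]].
have bj' : b t = j' by case/orP: tj' => /andP[_ /andP[/eqP]].
by move: jjs; rewrite -bj bj' j'js.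
Qed.

(** * Symmetry of the arrival order *)

Section Relabel.
Variables (R : realType) (E : finType).
Local Notation n := #|E|.

Definition label (i0 : 'I_n) (o : seq nat) (s : seq E) : {ffun E -> 'I_n} :=
  [ffun x => insubd i0 (nth 0%N o (index x s))].

(** Reading arrival times through a permutation [o] amounts to permuting the arrival order, a
    bijection on all orders. So for each fixed random tape the labels are uniform, although the
    order of visit depends on the tape. *)
Lemma sum_relabel (F : {ffun E -> 'I_n} -> R) (i0 : 'I_n) (o : seq nat) :
    perm_eq o (iota 0 n) ->
  \sum_(s in arrival_orders E) F (label i0 o s)
    = \sum_(s in arrival_orders E) F (label i0 (iota 0 n) s).
Proof.
move=> po; have so : size o = n by rewrite (perm_size po) size_iota.
have uo : uniq o by rewrite (perm_uniq po) iota_uniq.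
have lto (i : 'I_n) : (nth 0%N o i < n)%N.
  by have : nth 0%N o i \in o by [rewrite mem_nth ?so]; rewrite (perm_mem po) mem_iota.
have ginj : injective (fun i : 'I_n => Ordinal (lto i)).
  move=> i j /(congr1 (@nat_of_ord n)) /= /eqP; rewrite nth_uniq ?so // => /eqP.
  exact: val_inj.
pose g := perm ginj; have gE i : g i = nth 0%N o i :> nat by rewrite permE.
pose tr (h : {perm 'I_n}) (s : n.-tuple E) : n.-tuple E := [tuple tnth s (h i) | i < n].
have trK (h : {perm 'I_n}) : cancel (tr h) (tr h^-1)%g.
  by move=> s; apply: eq_from_tnth => i; rewrite !tnth_mktuple permKV.
rewrite (reindex (tr g)) /=; last first.
  exists (tr g^-1%g) => s _; first exact: trK.
  by have := trK g^-1%g s; rewrite invgK.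
have uniq_tr h s : (tr h s \in arrival_orders E) = (s \in arrival_orders E).
  rewrite !inE; apply/tuple_uniqP/tuple_uniqP => inj i j.
    move=> ij; apply: (@perm_inj _ h^-1%g); apply: inj.
    by rewrite !tnth_mktuple !permKV.
  by rewrite !tnth_mktuple => /inj /perm_inj.
apply: eq_big => [s|s]; first exact: uniq_tr.
rewrite uniq_tr inE => us; congr F; apply/ffunP => x; rewrite !ffunE; congr insubd.
have xs : x \in s.
  have : #|s| = n by rewrite (card_uniqP us) size_tuple.
  by move=> e; have := subset_cardP e (subset_predT _); move=> ->.
have /tnthP[i xi] := xs.
have ix : index x s = i by rewrite xi (tnth_nth x) index_uniq ?size_tuple.
rewrite ix nth_iota ?ltn_ord // add0n.
have xj : x = tnth (tr g s) (g^-1%g i) by rewrite tnth_mktuple permKV.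
have utr : uniq (tr g s) by have := uniq_tr g s; rewrite !inE us.
have -> : index x (tr g s) = g^-1%g i.
  by rewrite {1}xj (tnth_nth x) index_uniq // size_tuple.
by rewrite -gE permKV.
Qed.

(** Under an injective labelling, choices drawn beforehand for positions are as good as choices
    drawn for items. *)
Lemma sum_reindex (B : finType) (F : {ffun E -> B} -> R) (v : {ffun E -> 'I_n}) :
    injective v ->
  \sum_(b : {ffun 'I_n -> B}) F [ffun x => b (v x)] = \sum_(g : {ffun E -> B}) F g.
Proof.
move=> vinj; have [vi viK vKi] : bijective v.
  by apply: inj_card_bij => //; rewrite card_ord.
rewrite (reindex (fun g : {ffun E -> B} => [ffun t => g (vi t)])) /=.
  by apply: eq_bigr => g _; congr F; apply/ffunP => x; rewrite !ffunE viK.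
exists (fun b : {ffun 'I_n -> B} => [ffun x => b (v x)]) => g _; apply/ffunP => x;
  by rewrite !ffunE ?viK ?vKi.
Qed.

End Relabel.

(** * Collecting the running time *)

Section Cost.
Variables (p D : nat).

Fixpoint swaps_factor (d : nat) : nat :=
  if d is d'.+1 then (2 * swaps_factor d' + 20)%N else (30 * p.+1)%N.

Lemma swaps_cost_le K d : (0 < K)%N -> (swaps_cost p K d <= swaps_factor d * K ^ d)%N.
Proof.
move=> K0; elim: d => [|d IH]; first by rewrite muln1.
rewrite /= expnS; have Kd : (0 < K ^ d)%N by rewrite expn_gt0 K0.
move: (swaps_cost _ _ _) (swaps_factor d) (K ^ d)%N IH Kd => x y z xyz z0.
have h : (K * x <= K * (y * z))%N by rewrite leq_mul2l xyz orbT.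
have h2 : (x <= K * (y * z))%N.
  by apply: leq_trans xyz _; rewrite leq_pmull.
have h3 : (K <= K * z)%N by rewrite leq_pmulr.
have -> : ((2 * y + 20) * (K * z) = 2 * (K * (y * z)) + 20 * (K * z))%N by lia.
have -> : (K * (x + 10) = K * x + 10 * K)%N by lia.
lia.
Qed.

Definition time_factor : nat :=
  let ev := (swaps_factor p + 3 * p + 10)%N in
  let ap := (p * (p * 30 + 40) + 40)%N in
  (100 + 4 * D ^ 2 + ev + D ^ 2 * (2 * ev + ap + 102))%N.

(** Work per slot is charged to [n] through [W <= D ^ 2 * k] and [k <= n], work per item through
    [szs <= n], the total size of the buckets. *)
Lemma time_le (n k W K : nat) (szs : nat) :
    (0 < p)%N -> (0 < K)%N -> (0 < n)%N -> (k <= n)%N -> (W <= D ^ 2 * k)%N -> (szs <= n)%N ->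
  (((4 * n + 3) + ((4 * n + 3) + ((4 * (D ^ 2 * k) + 3) +
     (szs * (eval_cost p K + 40) + W * (2 * eval_cost p K + apply_cost p K + 102)
       + n * 10 + 10)).+1).+1).+1 <= time_factor * (n * K ^ p))%N.
Proof.
move=> p0 K0 n0 kn WD sn.
have KKp : (K <= K ^ p)%N by rewrite -{1}[K]expn1 leq_pexp2l.
have Kp0 : (0 < K ^ p)%N by rewrite expn_gt0 K0.
set ev := (swaps_factor p + 3 * p + 10)%N; set ap := (p * (p * 30 + 40) + 40)%N.
have evb : (eval_cost p K <= ev * K ^ p)%N.
  rewrite /eval_cost /ev; have := swaps_cost_le p K0; move: (K ^ p)%N Kp0 => z z0 h.
  rewrite 2!mulnDl; apply: leq_add; last by rewrite leq_pmulr.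
  by apply: leq_add => //; rewrite leq_pmulr.
have apb : (apply_cost p K <= ap * K ^ p)%N.
  rewrite /apply_cost /ap; move: (K ^ p)%N KKp Kp0 => z Kz z0.
  rewrite mulnDl; apply: leq_add; last by rewrite leq_pmulr.
  rewrite -mulnA leq_mul2l mulnDl; apply/orP; right.
  apply: leq_add; last by rewrite leq_pmulr.
  by rewrite -mulnA leq_mul2l; apply/orP; right; lia.
have nz : (n <= n * K ^ p)%N by rewrite leq_pmulr.
have WDn : (W <= D ^ 2 * n)%N by apply: leq_trans WD _; rewrite leq_mul2l kn orbT.
have t1 : (szs * (eval_cost p K + 40) <= (ev + 40) * (n * K ^ p))%N.
  rewrite [leqRHS](_ : _ = n * ((ev + 40) * K ^ p))%N; last by lia.
  apply: leq_mul => //; rewrite mulnDl leq_add //.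
  by rewrite leq_pmulr.
have t2 : (W * (2 * eval_cost p K + apply_cost p K + 102)
    <= D ^ 2 * (2 * ev + ap + 102) * (n * K ^ p))%N.
  rewrite [leqRHS](_ : _ = (D ^ 2 * n) * ((2 * ev + ap + 102) * K ^ p))%N; last by lia.
  apply: leq_mul => //; rewrite 2!mulnDl; apply: leq_add; last by rewrite leq_pmulr.
  by apply: leq_add => //; rewrite -mulnA leq_mul2l evb.
have t3 : (4 * (D ^ 2 * k) <= 4 * D ^ 2 * (n * K ^ p))%N.
  rewrite -mulnA leq_mul2l /= leq_mul2l; apply/orP; right.
  exact: leq_trans kn nz.
rewrite /time_factor -/ev -/ap.
move: (K ^ p)%N nz t1 t2 t3 {evb apb KKp Kp0} => z.
move: (D ^ 2)%N (W * _)%N (szs * _)%N => d2 w1 w2.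
move: (4 * (d2 * k))%N (d2 * _)%N => w3 w4 nz t1 t2 t3.
rewrite [leqRHS](_ : _ = 60 * (n * z) + (ev + 40) * (n * z) + 4 * d2 * (n * z) + w4 * (n * z))%N.
  lia.
by lia.
Qed.

End Cost.

(** * Competitive ratio *)

Lemma expectZ (R : realType) (A : Type) (a : R) (d : dist R A) (g : A -> R) :
  a * expect d g = expect d (fun x => a * g x).
Proof. by rewrite /expect mulr_sumr; apply: eq_bigr => x _; rewrite mulrCA. Qed.

Section Instance.
Variables (R : realType) (E : finType) (q : nat) (M : 'I_q -> matroid E).
Variables (f : {set E} -> R) (p : nat).
Hypotheses (p0 : (0 < p)%N) (Mp : p_matchoid p M).
Hypotheses (f0 : set_nonneg f) (fm : set_monotone f) (fs : submodular f).

Local Notation k := (max_feasible_size M).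
Local Notation K := (max_rank M).
Hypothesis k0 : (0 < k)%N.

Lemma max_feasible_size_le : (k <= #|E|)%N.
Proof. by apply/bigmax_leqP => S _; exact: max_card. Qed.

Lemma card_feasible_le (O : {set E}) : feasible M O -> (#|O| <= k)%N.
Proof. exact: leq_bigmax_cond. Qed.

Lemma card_indep_le (l : 'I_q) (A : {set E}) : A \in indep (M l) -> (#|A| <= K)%N.
Proof.
move=> Ai; apply: leq_trans (leq_bigmax l); exact: (leq_bigmax_cond (F := fun A : {set E} => #|A|)).
Qed.

Lemma max_rank_gt0 : (0 < K)%N.
Proof.
have [O Of] : exists O : {set E}, feasible M O /\ (0 < #|O|)%N.
  have [O /= /andP[Of O0]|no] := pickP [pred O : {set E} | feasible M O && (0 < #|O|)%N].
    by exists O.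
  move: k0; rewrite lt0n => /negP[]; rewrite -leqn0; apply/bigmax_leqP => O Of.
  by have := no O; rewrite /= Of /= lt0n => /negbFE/eqP ->.
move: Of => [/forallP Of /card_gt0P[x xO]].
have := in_setT x; rewrite -(proj1 Mp) => /bigcupP[l _ xl].
apply: leq_trans (card_indep_le (Of l)); apply/card_gt0P; exists x.
by rewrite inE xO.
Qed.

Lemma size_members_le (S : seq E) (l : nat) : uniq S -> feasible M [set y in S] ->
  (size (members M S l) <= K)%N.
Proof.
move=> uS /forallP Sf; have [lq|ql] := ltnP l q; last first.
  rewrite (_ : members M S l = [::]) //; apply/eqP; rewrite -[_ == _]negbK -has_filter.
  apply/hasPn => y _; apply/negP => /mapP[i _ li].
  by move: ql; rewrite li leqNgt ltn_ord.
apply: leq_trans (card_indep_le (Sf (Ordinal lq))).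
rewrite -(card_uniqP (filter_uniq _ uS)); apply: subset_leq_card.
apply/subsetP => y; rewrite mem_filter !inE => /andP[+ ->] /=.
by rewrite -(mem_matroids_of M y (Ordinal lq)).
Qed.

(** A part of the shortlist that depends on the arrival order only through the labels [vid], as the
    symmetry argument requires. *)
Definition caught_set (vid slot coin : E -> nat) (r : nat -> nat) (W L : nat) : {set E} :=
  [set x | [exists w : 'I_W,
     [&& nth None (process M f p vid slot r W).2 w == Some x, coin x != 0%N
       & (#|above M f p vid (process M f p vid slot r w).1 [set y | slot y == w] coin| <= L)%N]]].

Lemma eq_caught_set vid slot slot' coin coin' r W L : slot =1 slot' -> coin =1 coin' ->
  caught_set vid slot coin r W L = caught_set vid slot' coin' r W L.
Proof.
move=> es ec; have eT j : [set y | slot y == j] = [set y | slot' y == j].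
  by apply/setP => y; rewrite !inE es.
have ep w : process M f p vid slot r w = process M f p vid slot' r w.
  by apply: eq_process.
have ea S T : above M f p vid S T coin = above M f p vid S T coin'.
  apply/setP => y; rewrite !inE ec; do 2!congr (_ && _).
  by apply: eq_forallb => z; rewrite ec.
apply/setP => x; rewrite !inE; apply: eq_existsb => w.
by rewrite !ep eT ea ec.
Qed.

Lemma best_within_mono (A B : {set E}) : A \subset B ->
  best_within M f A <= best_within M f B.
Proof.
move=> AB; apply/bigmax_leP; split=> [|S /andP[SA Sf]].
  exact: bigmax_ge_id.
by apply: le_bigmax_cond; rewrite Sf (subset_trans SA).
Qed.

Lemma OPT_attained : exists2 O : {set E}, feasible M O & OPT M f <= f O.
Proof.
have f_0 : feasible M set0.
  by apply/forallP => l; apply: (indep_subset _ (indep_set0 _)); rewrite set0I sub0set.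
have [O Of Omax] := arg_maxP f f_0; exists O => //.
by apply/bigmax_leP; split=> // S; exact: Omax.
Qed.

Variable D : nat.
Hypothesis D_gt : (p.+3 <= D)%N.
(** Counts are written as successors because a draw with upper end [m'] has [m'.+1] outcomes. *)
Variable m' : nat.
Local Notation m := m'.+1.
Local Notation n := #|E|.
Hypothesis mE : m = (k * D ^ 2)%N.
Let W := ((D ^ 2 - D) * k)%N.
Let L := (D ^ 2)%N.

Lemma W_le : (W <= m)%N.
Proof. by rewrite mE /W mulnC leq_mul2l leq_subr orbT. Qed.

Lemma run_wp (s : n.-tuple E) (i0 : 'I_n) (b : {ffun 'I_n -> 'I_m})
    (c : {ffun 'I_n -> 'I_D.-1.+1}) (r : {ffun 'I_m -> 'I_m}) (st : state R E) :
    uniq s -> start_rep s (natf b) (natf c) (natf r) k m st ->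
    let vid := fun x => label i0 (visit (natf b) (natf c) n m) s x : nat in
  exists2 szs, (szs <= n)%N &
  wp M f s (main_cmd p (D ^ 2 - D) L)
    (szs * (eval_cost p K + 40) + W * (2 * eval_cost p K + apply_cost p K + 102) + n * 10 + 10)
    (fun st' => (#|shortlist st'| <= W * L)%N /\
       caught_set vid (fun x => natf b (vid x)) (fun x => natf c (vid x)) (natf r) W L
         \subset shortlist st') st.
Proof.
move=> us st0; set o := visit _ _ _ _; move=> vid.
have po : perm_eq o (iota 0 n) by apply: visit_perm => t; exact: natf_lt.
have so : size o = n by rewrite (perm_size po) size_iota.
have uo : uniq o by rewrite (perm_uniq po) iota_uniq.
have sn : size s = n by rewrite size_tuple.
have sE x : x \in s.
  have cs : #|s| = n by rewrite (card_uniqP us) size_tuple.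
  by have := subset_cardP cs (subset_predT _); move=> ->.
have ixn x : (index x s < n)%N by have := sE x; rewrite -index_mem sn.
have vidE x : vid x = nth 0%N o (index x s).
  rewrite /vid ffunE val_insubd; suff -> : (nth 0%N o (index x s) < n)%N by [].
  have : nth 0%N o (index x s) \in o by rewrite mem_nth // so.
  by rewrite (perm_mem po) mem_iota.
have vid_inj : injective vid.
  move=> x y /eqP; rewrite !vidE nth_uniq ?so // => /eqP.
  by move=> /(congr1 (nth x s)); rewrite !nth_index.
have vid_lt x : (vid x < size s)%N.
  by rewrite sn; exact: ltn_ord.
have vids : map vid s = o.
  apply: (@eq_from_nth _ 0%N); rewrite size_map sn // => i ilt.
  pose x := tnth s i0.
  by rewrite (nth_map x) ?sn // vidE index_uniq // sn.
have s0 : (0 < size s)%N by rewrite sn (leq_trans k0) ?max_feasible_size_le.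
have {}vids : map vid s = visit (natf b) (natf c) (size s) m by rewrite vids sn.
exists (\sum_(w < W) (size (bucket (natf b) (fun t => natf c t == 0%N) (size s) w)
   + size (bucket (natf b) (fun t => natf c t != 0%N) (size s) w)))%N.
  by rewrite -[X in (_ <= X)%N]sn; apply: (sum_buckets vids W_le).
have szK w l : (size (members M (process M f p vid (fun y => natf b (vid y)) (natf r) w).1 l) <= K)%N.
  by apply: size_members_le; [exact: process_uniq | exact: process_feasible].
have := main_wp us sE Mp vid_inj vid_lt s0 L szK vids W_le st0 (erefl ((D ^ 2 - D) * k)%N).
move=> H; eapply wp_weaken; first exact: H.
  rewrite sn !leq_add2r.
  rewrite big_distrl /= -[X in (_ + X * _)%N](card_ord W) -sum_nat_const -big_split /=.
  by apply: leq_sum => w _; rewrite /slot_cost; lia.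
move=> st' [h1 h2]; split=> //; apply/subsetP => x; rewrite inE => /existsP[w /and3P[/eqP e1 e2 e3]].
exact: h2 e1 e2 e3.
Qed.

Lemma fill_then (s : seq E) (a : nat) (len top : nexp) (N Q T : nat)
    (Ks : seq cmd) (st : state R E) :
    (0 < a < 8)%N ->
    (forall st' : state R E, (forall i, nmem st' 0 i = nmem st 0 i) ->
       neval st' len = N /\ neval st' top = Q) ->
  (forall P : config R E -> bool,
     (forall (v : {ffun 'I_N -> 'I_Q.+1}) st', filled a 0 v st st' ->
        surely (run_from M f s T (Ks, st')) P) ->
     surely (run_from M f s (4 * N + 3 + T) (fill a len top :: Ks, st)) P) /\
  (forall (g : config R E -> R) (G : {ffun 'I_N -> 'I_Q.+1} -> R),
     (forall v st', filled a 0 v st st' -> G v <= expect (run_from M f s T (Ks, st')) g) ->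
     \sum_v G v <= #|{ffun 'I_N -> 'I_Q.+1}|%:R *
        expect (run_from M f s (4 * N + 3 + T) (fill a len top :: Ks, st)) g).
Proof.
move=> a08 ev; have [d [ex sd hd]] := fill_exec M f s a08 ev.
split=> [P Pv|g G Gh]; rewrite ex.
  by rewrite surely_dbind; apply: sd.
by rewrite expect_dbind; apply: hd.
Qed.

Lemma filled_start (s : n.-tuple E) (st1 st2 st3 : state R E)
    (b : {ffun 'I_n -> 'I_m}) (c : {ffun 'I_n -> 'I_D.-1.+1}) (r : {ffun 'I_m -> 'I_m}) :
    filled 1 0 b (init_state R E n k) st1 -> filled 2 0 c st1 st2 -> filled 3 0 r st2 st3 ->
  start_rep s (natf b) (natf c) (natf r) k m st3.
Proof.
move=> [a1 b1 e1 v1 c1] [a2 b2 e2 v2 c2] [a3 b3 e3 v3 c3].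
have sn : size s = n by rewrite size_tuple.
have c123 a i : a \notin [:: 1; 2; 3]%N -> ~~ ((a == 8) && (i == 0%N)) ->
    nmem st3 a i = nmem (init_state R E n k) a i.
  rewrite !inE !negb_or => /and3P[/negPf n1 /negPf n2 /negPf n3] n8.
  by rewrite c3 ?n3 // c2 ?n2 // c1 ?n1.
have z a i : a \notin [:: 0; 1; 2; 3]%N -> ~~ ((a == 8) && (i == 0%N)) -> nmem st3 a i = 0%N.
  rewrite inE negb_or => /andP[/negPf na0 na] n8.
  by rewrite c123 // /= /upd na0.
split.
- by rewrite a3 a2 a1 b3 b2 b1 e3 e2 e1.
- by rewrite !c123 // sn.
- move=> a i ha; apply: z; move: ha; clear; rewrite !inE; lia.
- by move=> i /negPf i0; apply: z; rewrite //= i0.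
- split=> [t|t|j jm].
  + rewrite sn => tn; have := v1 (Ordinal tn) isT; rewrite /= => vt.
    by rewrite c3 // c2 // vt -natfE.
  + rewrite sn => tn; have := v2 (Ordinal tn) isT; rewrite /= => vt.
    by rewrite c3 // vt -natfE.
  + by have := v3 (Ordinal jm) isT; rewrite /= => ->; rewrite -natfE.
Qed.

Lemma run_program (s : n.-tuple E) (i0 : 'I_n) (T : nat) :
    uniq s -> (time_factor p D * (n * K ^ p) <= T)%N ->
  [/\ surely (run M f (program p D) s T) (@halted R E),
      surely (run M f (program p D) s T)
        (fun c : config R E => (#|shortlist c.2| <= W * L)%N)
    & \sum_(b : {ffun 'I_n -> 'I_m}) \sum_(c : {ffun 'I_n -> 'I_D.-1.+1})
        \sum_(r : {ffun 'I_m -> 'I_m})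
        (let vid x := label i0 (visit (natf b) (natf c) n m) s x : nat in
         best_within M f (caught_set vid (fun x => natf b (vid x)) (fun x => natf c (vid x))
           (natf r) W L))
      <= #|{ffun 'I_n -> 'I_m}|%:R * (#|{ffun 'I_n -> 'I_D.-1.+1}|%:R *
           (#|{ffun 'I_m -> 'I_m}|%:R *
         expect (run M f (program p D) s T)
           (fun c : config R E => best_within M f (shortlist c.2))))].
Proof.
move=> us Tge; set st0 := init_state R E n k.
have n0 : (0 < n)%N by rewrite (leq_trans k0) ?max_feasible_size_le.
have mE' : (D ^ 2 * k = m)%N by rewrite mE mulnC.
have WD : (W <= D ^ 2 * k)%N by rewrite leq_mul2r leq_subr orbT.
(* [T'] is the part of [T] left to the deterministic program after the three arrays of random
   choices have been filled. *)
have [T' [TE T'ge]] : exists T', T = (4 * n + 3 + (4 * n + 3 + (4 * m + 3 + T').+1).+1).+1 /\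
   forall szs, (szs <= n)%N -> (szs * (eval_cost p K + 40)
      + W * (2 * eval_cost p K + apply_cost p K + 102) + n * 10 + 10 <= T')%N.
  exists (T - (4 * n + 3 + (4 * n + 3 + (4 * m + 3).+1).+1).+1)%N; split.
    have := time_le p0 max_rank_gt0 n0 max_feasible_size_le WD (leq0n n).
    by rewrite mE'; lia.
  move=> szs szn.
  have := time_le p0 max_rank_gt0 n0 max_feasible_size_le WD szn.
  by rewrite mE'; lia.
have ev1 (st' : state R E) : (forall i, nmem st' 0 i = nmem st0 0 i) ->
    [/\ neval st' (NGet 0 (NConst 0)) = n, neval st' (nmul (D ^ 2) (NGet 0 (NConst 1))) = m,
        neval st' (NSub (nmul (D ^ 2) (NGet 0 (NConst 1))) (NConst 1)) = m'
      & neval st' (NConst D.-1) = D.-1].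
  move=> e0; rewrite /= !neval_nmul /= !e0 /= mE' subn1; by split.
have keep0 a N Q (v : {ffun 'I_N -> 'I_Q}) (st st' : state R E) : (0 < a)%N -> filled a 0 v st st' ->
    (forall i, nmem st 0 i = nmem st0 0 i) -> forall i, nmem st' 0 i = nmem st0 0 i.
  by move=> a0 [_ _ _ _ h] e0 i; rewrite h // eq_sym; case: (a) a0.
have final (st3 : state R E) (b : {ffun 'I_n -> 'I_m}) (c : {ffun 'I_n -> 'I_D.-1.+1})
    (r : {ffun 'I_m -> 'I_m}) : start_rep s (natf b) (natf c) (natf r) k m st3 ->
    exists2 st', run_from M f s T' ([:: main_cmd p (D ^ 2 - D) L], st3) = dret R ([::], st') &
      (#|shortlist st'| <= W * L)%N /\
      (let vid x := label i0 (visit (natf b) (natf c) n m) s x : nat in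
       caught_set vid (fun x => natf b (vid x)) (fun x => natf c (vid x)) (natf r) W L
         \subset shortlist st').
  move=> sr; have [szs szn [st' ex Q]] := run_wp i0 us sr; exists st' => //.
  exact: exec_halt ex (T'ge _ szn).
have step1 Ks st c1 c2 T0 : run_from M f s T0.+1 ((Seq c1 c2) :: Ks, st) =
    run_from M f s T0 ([:: c1, c2 & Ks], st) by rewrite /= dbind_dret.
have base0 : forall i, nmem st0 0 i = nmem st0 0 i by [].
rewrite /run TE /program.
have sure (P : config R E -> bool) : (forall st3 (b : {ffun 'I_n -> 'I_m})
      (c : {ffun 'I_n -> 'I_D.-1.+1}) (r : {ffun 'I_m -> 'I_m}), start_rep s (natf b) (natf c) (natf r) k m st3 ->
      surely (run_from M f s T' ([:: main_cmd p (D ^ 2 - D) L], st3)) P) ->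
   surely (run_from M f s (4 * n + 3 + (4 * n + 3 + (4 * m + 3 + T').+1).+1).+1
      ([:: program p D], st0)) P.
  move=> H; rewrite step1.
  have [e11 _ e13 _] := ev1 st0 base0.
  apply: (proj1 (fill_then s _ _ (a := 1) (N := n) (Q := m') _ _)) => //.
    by move=> st' /ev1[].
  move=> v1 st1 F1; rewrite step1; have b1 := keep0 1%N _ _ _ _ _ isT F1 base0.
  apply: (proj1 (fill_then s _ _ (a := 2) (N := n) (Q := D.-1) _ _)) => //.
    by move=> st' h; have [] := ev1 st' (fun i => etrans (h i) (b1 i)).
  move=> v2 st2 F2; rewrite step1; have b2 := keep0 2%N _ _ _ _ _ isT F2 b1.
  apply: (proj1 (fill_then s _ _ (a := 3) (N := m) (Q := m') _ _)) => //.
    by move=> st' h; have [] := ev1 st' (fun i => etrans (h i) (b2 i)).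
  move=> v3 st3 F3; apply: (H st3 v1 v2 v3); exact: filled_start F1 F2 F3.
split.
- apply: sure => st3 b c r /final[st' -> _]; by rewrite /surely /= /halted.
- apply: sure => st3 b c r /final[st' -> [h _]]; by rewrite /surely /= h.
pose bw (x : config R E) := best_within M f (shortlist x.2).
pose bw1 (x : config R E) := #|{ffun 'I_m -> 'I_m}|%:R * bw x.
pose bw2 (x : config R E) := #|{ffun 'I_n -> 'I_D.-1.+1}|%:R * bw1 x.
rewrite step1 [X in _ * (_ * X)](expectZ _ _ bw) [X in _ * X](expectZ _ _ bw1) -/bw2.
have [e11 _ e13 _] := ev1 st0 base0.
apply: (proj2 (fill_then s _ _ (a := 1) (N := n) (Q := m') _ _)) => //.
  by move=> st' /ev1[].
move=> v1 st1 F1; rewrite step1; have b1 := keep0 1%N _ _ _ _ _ isT F1 base0.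
rewrite -(expectZ _ _ bw1).
apply: (proj2 (fill_then s _ _ (a := 2) (N := n) (Q := D.-1) _ _)) => //.
  by move=> st' h; have [] := ev1 st' (fun i => etrans (h i) (b1 i)).
move=> v2 st2 F2; rewrite step1; have b2 := keep0 2%N _ _ _ _ _ isT F2 b1.
rewrite -(expectZ _ _ bw).
apply: (proj2 (fill_then s _ _ (a := 3) (N := m) (Q := m') _ _)) => //.
  by move=> st' h; have [] := ev1 st' (fun i => etrans (h i) (b2 i)).
move=> v3 st3 F3; have [st' -> [_ h]] := final st3 v1 v2 v3 (filled_start s F1 F2 F3).
by rewrite expect_dret; apply: best_within_mono.
Qed.

Let d : R := D.-1.+1%:R^-1 + (1 - D.-1.+1%:R^-1) ^+ L.
Let a : R := expR (- (p.+1%:R * (1 - 3%:R / D%:R))).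

(** With labels independent of the tape, slots and coins can be attached to items. The coins are
    averaged for fixed slots and draws, and [potential_lower] handles the average over the
    latter. *)
Lemma coins_slots_value (vid : {ffun E -> 'I_n}) : injective vid -> 0 <= 1 - d ->
  p.+1%:R^-1 * ((1 - d) * (1 - a)) * OPT M f
      * (#|{ffun E -> 'I_m}|%:R * (#|{ffun E -> 'I_D.-1.+1}|%:R * #|{ffun 'I_m -> 'I_m}|%:R))
    <= \sum_(b : {ffun 'I_n -> 'I_m}) \sum_(c : {ffun 'I_n -> 'I_D.-1.+1})
         \sum_(r : {ffun 'I_m -> 'I_m})
         best_within M f (caught_set (fun x => vid x) (fun x => natf b (vid x))
           (fun x => natf c (vid x)) (natf r) W L).
Proof.
move=> vinj d1; pose v x : nat := vid x.
have vi : injective v by move=> x y /val_inj/vinj.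
have -> : \sum_(b : {ffun 'I_n -> 'I_m}) \sum_(c : {ffun 'I_n -> 'I_D.-1.+1})
         \sum_(r : {ffun 'I_m -> 'I_m})
         best_within M f (caught_set (fun x => vid x) (fun x => natf b (vid x))
           (fun x => natf c (vid x)) (natf r) W L)
   = \sum_(b : {ffun E -> 'I_m}) \sum_(c : {ffun E -> 'I_D.-1.+1})
         \sum_(r : {ffun 'I_m -> 'I_m})
         best_within M f (caught_set v (fun x => b x : nat) (fun x => c x : nat) (natf r) W L).
  rewrite -(sum_reindex _ vinj); apply: eq_bigr => b _.
  rewrite -(sum_reindex _ vinj); apply: eq_bigr => c _; apply: eq_bigr => r _.
  by congr best_within; apply: eq_caught_set => x; rewrite natfE ffunE.
have [O Of OPTO] := OPT_attained.
have := potential_lower vi Mp f0 fm fs Of (card_feasible_le Of) k0 D_gt mE (mulnC _ k).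
rewrite -/a -/W => H.
apply: (@le_trans _ _ (#|{ffun E -> 'I_D.-1.+1}|%:R * (1 - d) * potential M f p v m W)).
  have P0 : 0 < p.+1%:R :> R by rewrite ltr0n.
  rewrite -(ler_pM2l P0).
  rewrite [leLHS](_ : _ = #|{ffun E -> 'I_D.-1.+1}|%:R * (1 - d) *
     ((#|{ffun E -> 'I_m}| * #|{ffun 'I_m -> 'I_m}|)%:R * (1 - a) * OPT M f)); last first.
    by rewrite natrM; move: (p.+1%:R) P0 => z z0; field; exact: lt0r_neq0.
  rewrite [leRHS](_ : _ = #|{ffun E -> 'I_D.-1.+1}|%:R * (1 - d) * (p.+1%:R * potential M f p v m W)); last by ring.
  apply: ler_wpM2l; first by rewrite mulr_ge0.
  apply: le_trans H; apply: ler_wpM2l => //; apply: mulr_ge0 => //.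
  rewrite subr_ge0 /a -[leRHS]expR0 ler_expR oppr_le0; apply: mulr_ge0 => //; rewrite subr_ge0.
  by rewrite ler_pdivrMr ?mul1r ?ler_nat ?ltr0n; clear -D_gt; lia.
rewrite /potential mulr_sumr; apply: ler_sum => b _.
rewrite exchange_big /= mulr_sumr; apply: ler_sum => r _.
rewrite card_ffun card_ord.
apply: (coins_value vi Mp f0 fm fs) => // c w x wW win cx le.
rewrite inE; apply/existsP; exists (Ordinal wW) => /=.
by rewrite win eqxx cx.
Qed.

(** The labels depend on the tape through [visit], so the tape cannot be averaged for a fixed
    arrival order right away. For each fixed tape the sum over arrival orders is replaced by the one
    with the labels of the identity visit; these are free of the tape, and [coins_slots_value]
    applies to each order. *)
Lemma ALG_lower (T : nat) : (time_factor p D * (n * K ^ p) <= T)%N -> 0 <= 1 - d ->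
  p.+1%:R^-1 * ((1 - d) * (1 - a)) * OPT M f <= ALG M f (program p D) T.
Proof.
move=> Tge d1.
have n0 : (0 < n)%N by rewrite (leq_trans k0) ?max_feasible_size_le.
pose i0 := Ordinal n0.
have No0 : 0 < #|arrival_orders E|%:R :> R.
  rewrite ltr0n; apply/card_gt0P; exists (enum_tuple E); rewrite inE /=; exact: enum_uniq.
have cb : #|{ffun 'I_n -> 'I_m}| = #|{ffun E -> 'I_m}| by rewrite !card_ffun !card_ord.
have cc : #|{ffun 'I_n -> 'I_D.-1.+1}| = #|{ffun E -> 'I_D.-1.+1}| by rewrite !card_ffun !card_ord.
set N : R := #|{ffun E -> 'I_m}|%:R * (#|{ffun E -> 'I_D.-1.+1}|%:R * #|{ffun 'I_m -> 'I_m}|%:R).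
have N0 : 0 < N.
  rewrite !mulr_gt0 // ltr0n; apply/card_gt0P; [exists [ffun=> ord0]|exists [ffun=> ord0]|exists [ffun=> ord0]] => //.
rewrite /ALG ler_pdivlMl // -(ler_pM2r N0) mulr_natl -sumr_const !mulr_suml.
pose Phi (b : {ffun 'I_n -> 'I_m}) (c : {ffun 'I_n -> 'I_D.-1.+1})
    (vid : {ffun E -> 'I_n}) := \sum_(r : {ffun 'I_m -> 'I_m})
  best_within M f (caught_set (fun x => vid x) (fun x => natf b (vid x))
           (fun x => natf c (vid x)) (natf r) W L).
apply: (@le_trans _ _ (\sum_(s in arrival_orders E)
   \sum_(b : {ffun 'I_n -> 'I_m}) \sum_(c : {ffun 'I_n -> 'I_D.-1.+1})
     Phi b c (label i0 (visit (natf b) (natf c) n m) s))); last first.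
  apply: ler_sum => s; rewrite inE => us.
  have [_ _] := run_program i0 us Tge.
  rewrite cb cc => /le_trans; apply.
  by rewrite /N [leRHS]mulrC !mulrA.
rewrite [leRHS](_ : _ = \sum_(s in arrival_orders E)
   \sum_(b : {ffun 'I_n -> 'I_m}) \sum_(c : {ffun 'I_n -> 'I_D.-1.+1})
     Phi b c (label i0 (iota 0 n) s)).
  apply: ler_sum => s; rewrite inE => us; apply: coins_slots_value => // x y /eqP.
  have sx z : z \in s.
    have cs : #|s| = n by rewrite (card_uniqP us) size_tuple.
    by have := subset_cardP cs (subset_predT _); move=> ->.
  have ixn z : (index z s < n)%N by have := sx z; rewrite -index_mem size_tuple.
  rewrite !ffunE -val_eqE !val_insubd !nth_iota // !add0n !ixn => /eqP.
  by move=> /(congr1 (nth x s)); rewrite !nth_index.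
have exch (H : n.-tuple E -> {ffun 'I_n -> 'I_m} -> {ffun 'I_n -> 'I_D.-1.+1} -> R) :
    \sum_(s in arrival_orders E) \sum_b \sum_c H s b c
      = \sum_b \sum_c \sum_(s in arrival_orders E) H s b c.
  by rewrite exchange_big; apply: eq_bigr => b _; exact: exchange_big.
rewrite [LHS]exch [RHS]exch.
clearbody Phi; apply: eq_bigr => b _; apply: eq_bigr => c _.
apply: (sum_relabel (fun vid => Phi b c vid)).
by apply: visit_perm => t; exact: natf_lt.
Qed.

End Instance.

Theorem theorem3 (R : realType) (p : nat) (hp : (1 <= p)%N) :
  exists (P : {poly R}) (C0 : R), forall eps : R, 0 < eps ->
  exists (prog : cmd) (eta : nat -> nat) (C1 : R) (C2 : nat),
    (forall k : nat, (1 <= k)%N ->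
       (eta k)%:R <= C0 * (2 `^ (P.[eps^-1])) * k%:R) /\
    (forall (E : finType) (q : nat) (M : 'I_q -> matroid E)
            (f : {set E} -> R),
       p_matchoid p M ->
       set_nonneg f -> set_monotone f -> submodular f ->
       let n := #|E| in
       let k := max_feasible_size M in
       let T := (C2 * (n * max_rank M ^ p))%N in
       (1 <= k)%N ->
       [/\ halts_within M f prog T,
           shortlist_within M f prog T (eta k)
         & ALG M f prog T >=
             (p.+1)%:R^-1
             * (1 - (expR (p.+1)%:R)^-1 - eps - C1 / k%:R)
             * OPT M f]).
Proof.
(* [3 * p.+1] pays for the exponent shortened by the fraction [3 / D], and 2 for the missed winners;
   [ratio_bound] asks for [c <= eps * D]. *)
pose c : R := (3 * p.+1 + 2)%:R.
(* The polynomial is [4 * D] with [D] below taken before rounding down, as in [list_size_bound]. *)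
exists ((4 * c) *: 'X + (4 * (p + 3))%:R%:P), 1 => eps eps0.
(* The summand [p + 3] makes up for the rounding and gives [p.+3 <= D]. *)
pose D := (Num.truncn (c / eps) + p + 3)%N.
have ce : 0 <= c / eps by rewrite divr_ge0 ?ler0n ?ltW.
have pD : (p.+3 <= D)%N by rewrite /D; lia.
have cD : c <= eps * D%:R.
  rewrite mulrC -ler_pdivrMr //; apply: ltW; apply: lt_le_trans (truncnS_gt _) _.
  rewrite ler_nat; rewrite /D -addnA -addn1 leq_add2l; lia.
(* [eta] is the number of processed slots times the cap per slot. The constant of the [1 / k] term
   is 0, since the number of slots scales with [k] and all losses depend on [p] and [D] alone. *)
exists (program p D), (fun k => ((D ^ 2 - D) * k * D ^ 2)%N), 0, (time_factor p D).
split=> [k _|E q M f Mp f0 fm fs n k T k0].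
  rewrite mul1r; apply: (@le_trans _ _ ((D ^ 4)%:R * k%:R)).
    rewrite -natrM ler_nat mulnAC leq_mul2r; apply/orP; right.
    by rewrite (expnD D 2 2) leq_mul2r leq_subr orbT.
  by rewrite ler_wpM2r // list_size_bound.
have n0 : (0 < n)%N by rewrite (leq_trans k0) ?max_feasible_size_le.
have mE : (k * D ^ 2).-1.+1 = (k * D ^ 2)%N.
  by rewrite prednK // muln_gt0 k0 expn_gt0 /D; lia.
split.
- move=> s; rewrite inE => us.
  by have [] := run_program f hp Mp k0 pD mE (Ordinal n0) us (leqnn T).
- move=> s; rewrite inE => us.
  by have [] := run_program f hp Mp k0 pD mE (Ordinal n0) us (leqnn T).
have D1 : D.-1.+1 = D by rewrite /D; lia.
have D0 : 0 < D%:R :> R by rewrite ltr0n; lia.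
pose d : R := D.-1.+1%:R^-1 + (1 - D.-1.+1%:R^-1) ^+ (D ^ 2).
have D2 : 2 / D%:R <= 1 :> R by rewrite ler_pdivrMr // mul1r ler_nat; lia.
have d2 : d <= 2 / D%:R.
  have -> : 2 / D%:R = D%:R^-1 + D%:R^-1 :> R by rewrite mulrDl mul1r.
  by rewrite /d D1 lerD2l pow_inv_le //; lia.
have d0 : 0 <= d.
  rewrite /d D1 addr_ge0 ?invr_ge0 // exprn_ge0 // subr_ge0 invf_le1 // ler1n; lia.
have d1 : d <= 1 := le_trans d2 D2.
apply: le_trans (ALG_lower hp Mp f0 fm fs k0 pD mE (leqnn _) _); last by rewrite subr_ge0.
apply: ler_wpM2r; first exact: bigmax_ge_id.
rewrite ler_wpM2l ?invr_ge0 // mul0r subr0.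
by apply: ratio_bound => //; [lia | rewrite d0].
Qed.
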